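(* Fix $m\ge 1$. Let $(n_\pm^{(k)},v_\pm^{(k)},\phi^{(k)})(Y,T)$, $1\le k\le m$, be the profiles of the KdV hierarchy described in the context, let $N_\pm^{(m)},V_\pm^{(m)},\Phi^{(m)}$ be the truncated expansions built from them, and let $\mathrm{Res}_{n_\pm}^{(m)},\mathrm{Res}_{v_\pm}^{(m)},\mathrm{Res}_{\phi}^{(m)}$ be the scaled residuals, all as defined in the context. Then $$\sup_{0\le t}\ \|\mathrm{Res}_{n_\pm}^{(m)}(\cdot,t)\|_{L^2(x)}\le C\varepsilon^{9/4},$$ $$\sup_{0\le t}\ \|\mathrm{Res}_{v_\pm}^{(m)}(\cdot,t)\|_{L^2(x)}\le C\varepsilon^{9/4},$$ $$\sup_{0\le t}\ \|\mathrm{Res}_{\phi}^{(m)}(\cdot,t)\|_{L^2(x)}\le C\varepsilon^{7/4},$$ where $C$ is a scalar dependent on $$\sup_{0\le T}\ \left\|\left(N_\pm^{(m)},\ V_\pm^{(m)},\ \Phi^{(m)}\right)(\cdot,T)\right\|_{H^{s_m}(Y)} .$$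
   Context: Setting: the one-dimensional two-fluid Euler--Poisson system for $n_\pm,v_\pm,\phi$ (functions of $x\in\mathbb R$, $t\ge0$) is $\partial_t n_\pm+\partial_x(n_\pm v_\pm)=0$, $\ \partial_t v_++\tfrac12\partial_x v_+^2+\tau_i\partial_x\ln n_++\partial_x\phi=0$, $\ m_e(\partial_t v_-+\tfrac12\partial_x v_-^2)+\partial_x\ln n_--\partial_x\phi=0$, $\ \partial_x^2\phi-n_-+n_+=0$. Here $m_e$ is the electron mass (ion mass scaled to 1, $m_e\approx 0.00054551$) and $\tau_i$ is the ion temperature (electron temperature scaled to 1). Put $c=\sqrt{(1+\tau_i)/(1+m_e)}$. Scaled variables: $Y=\varepsilon^{1/2}(x-ct)$, $T=\varepsilon^{3/2}t$, with $0<\varepsilon\ll1$. Formal expansion: insert $n_\pm=1+\sum_{k\ge1}\varepsilon^k n_\pm^{(k)}$, $v_\pm=\sum_{k\ge1}\varepsilon^k v_\pm^{(k)}$, $\phi=\sum_{k\ge1}\varepsilon^k\phi^{(k)}$ (profiles being functions of $(Y,T)$) into the system written in $(Y,T)$. Setting the coefficient of $\varepsilon^{k+1}$ to zero gives, for $k\ge1$, the order-$k$ evolution system (a,b) $\partial_T n_\pm^{(k)}+\partial_Y v_\pm^{(k+1)}+\partial_Y\big(\sum_{j=1}^k n_\pm^{(j)}v_\pm^{(k+1-j)}\big)-c\,\partial_Y n_\pm^{(k+1)}=0$ (a with $+$, b with $-$); (c) $\partial_T v_+^{(k)}-c\,\partial_Y v_+^{(k+1)}+\tfrac12\partial_Y\big(\sum_{j=1}^k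 v_+^{(j)}v_+^{(k+1-j)}\big)+\tau_i\partial_Y\ell_+^{(k+1)}+\partial_Y\phi^{(k+1)}=0$; (d) $m_e\big(\partial_T v_-^{(k)}-c\,\partial_Y v_-^{(k+1)}+\tfrac12\partial_Y\big(\sum_{j=1}^k v_-^{(j)}v_-^{(k+1-j)}\big)\big)+\partial_Y\ell_-^{(k+1)}-\partial_Y\phi^{(k+1)}=0$; (e) $\partial_Y^2\phi^{(k)}+n_+^{(k+1)}-n_-^{(k+1)}=0$. Here $$\ell_\pm^{(r)}=\sum_{j=1}^{r}\frac{(-1)^{j+1}}{j}\sum\binom{j}{a_1,\dots,a_r}\prod_{i=1}^r (n_\pm^{(i)})^{a_i},$$ the inner sum being over integers $a_i\ge0$ with $a_1+\dots+a_r=j$ and $a_1+2a_2+\dots+ra_r=r$. KdV hierarchy. The profiles satisfy the following for $1\le k\le m$. Relations at order 1: $n_-^{(1)}=n_+^{(1)}$, $\ v_+^{(1)}=c\,n_+^{(1)}$, $\ v_-^{(1)}=c\,n_+^{(1)}$, $\ \phi^{(1)}=(1-\tau_i m_e)\,n_+^{(1)}$. Relations at order $k\ge2$: $n_-^{(k)}=n_+^{(k)}+\partial_Y^2\phi^{(k-1)}$; $v_+^{(k)}=c\,n_+^{(k)}-\int\partial_T n_+^{(k-1)}dY-\sum_{j=1}^{k-1}n_+^{(j)}v_+^{(k-j)}$; $v_-^{(k)}=c\,n_+^{(k)}-\int\partial_T n_-^{(k-1)}dY-\sum_{j=1}^{k-1}n_-^{(j)}v_-^{(k-j)}$; $\phi^{(k)}=c\,v_+^{(k)}-\tau_i\ell_+^{(k)}-\int\partial_T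 v_+^{(k-1)}dY-\tfrac12\sum_{j=1}^{k-1}v_+^{(j)}v_+^{(k-j)}$. KdV equation at order 1: $\partial_T n_+^{(1)}+c\,n_+^{(1)}\partial_Y n_+^{(1)}+\frac{(c^2m_e-1)^2}{2c(1+m_e)}\partial_Y^3n_+^{(1)}=0$. Inhomogeneous linearized KdV equation at order $k\ge2$: $\partial_T n_+^{(k)}+c\,\partial_Y(n_+^{(1)}n_+^{(k)})+\frac{(c^2m_e-1)^2}{2c(1+m_e)}\partial_Y^3n_+^{(k)}=F^{(k-1)}$, where $F^{(k-1)}$ is a function depending only on $n_+^{(1)},\dots,n_+^{(k-1)}$. This equation is obtained by differentiating (e) in $Y$ and multiplying by $c^2(1-\tau_im_e)$, adding $c(1+\tau_i)$ times (a), $c\,m_e(1+\tau_i)$ times (b), $(1+\tau_i)$ times (c) and $(1+\tau_i)$ times (d), and using the relations above. Function classes: $s_1\ge2$ is a sufficiently large integer and, for $2\le k\le m$, $s_k\le s_1-3(k-1)$ is a sufficiently large integer. The profiles are the unique solutions of these initial value problems with order-$k$ initial data in $H^{s_k}(\mathbb R)$ satisfying the relations above, and the order-$k$ profiles lie in $L^\infty\big((-T_0,T_0);H^{s_k}(\mathbb R)\big)$ for every $T_0>0$. Truncated expansions: $N_\pm^{(m)}=1+\sum_{k=1}^m\varepsilon^kn_\pm^{(k)}$, $V_\pm^{(m)}=\sum_{k=1}^m\varepsilon^kv_\pm^{(k)}$, $\Phi^{(m)}=\sum_{k=1}^m\varepsilon^k\phi^{(k)}$, evaluated at $Y=\varepsilon^{1/2}(x-ct)$,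 $T=\varepsilon^{3/2}t$ when regarded as functions of $(x,t)$. Scaled residuals (functions of $(x,t)$): $$\mathrm{Res}_{n_\pm}^{(m)}=-\varepsilon^{1-m}\big[\partial_tN_\pm^{(m)}+\partial_x(N_\pm^{(m)}V_\pm^{(m)})\big],$$ $$\mathrm{Res}_{v_+}^{(m)}=-\varepsilon^{1-m}\Big[\partial_tV_+^{(m)}+\tfrac12\partial_x(V_+^{(m)})^2+\tau_i\sum_{k=1}^m\tfrac{(-1)^{k+1}}{k}\partial_x\big((N_+^{(m)}-1)^k\big)+\partial_x\Phi^{(m)}\Big],$$ $$\mathrm{Res}_{v_-}^{(m)}=-\varepsilon^{1-m}\Big[m_e\big(\partial_tV_-^{(m)}+\tfrac12\partial_x(V_-^{(m)})^2\big)+\sum_{k=1}^m\tfrac{(-1)^{k+1}}{k}\partial_x\big((N_-^{(m)}-1)^k\big)-\partial_x\Phi^{(m)}\Big],$$ $$\mathrm{Res}_{\phi}^{(m)}=-\varepsilon^{1-m}\big[\partial_x^2\Phi^{(m)}-N_-^{(m)}+N_+^{(m)}\big].$$ Statements with $\pm$ hold for each sign.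
   Formalization: Corrected: φ^(1)=((1−τ_i m_e)/(1+m_e)) n_+^(1) and v_-^(k)=c n_-^(k)−…; the antiderivatives ∫∂_T n_±^(k)dY, ∫∂_T v_+^(k)dY are required to be fixed differential polynomials in n_+^(1),…,n_+^(k); the norm controlling C is a sup over 0<ε<1 as well. *)

(* Defs.v *)
From HB Require Import structures.
From mathcomp Require Import all_boot all_order all_algebra.
From mathcomp Require Import all_classical all_reals all_analysis.

Set Implicit Arguments.
Unset Strict Implicit.
Unset Printing Implicit Defensive.

Import Order.TTheory GRing.Theory Num.Theory.
Import numFieldNormedType.Exports.

Local Open Scope classical_set_scope.
Local Open Scope ring_scope.

(* Functions of two variables take the time variable first: [u T Y], [f t x]. *)

Definition d_time (R : realType) (u : R -> R -> R) : R -> R -> R :=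
  fun T Y => derive1 (fun T' => u T' Y) T.

Definition d_space (R : realType) (u : R -> R -> R) : R -> R -> R :=
  fun T => derive1 (u T).

Definition L2norm (R : realType) (f : R -> R) : \bar R :=
  'N[@lebesgue_measure R]_(2%:E)[EFin \o f].

Definition inL2 (R : realType) (f : R -> R) : Prop :=
  measurable_fun setT f /\ (L2norm f < +oo)%E.

(* Test functions are C^1 with compact support, as in Brezis' treatment of
   Sobolev spaces in one dimension. *)
Definition test_fun (R : realType) (p : R -> R) : Prop :=
  [/\ forall x, derivable p x 1,
      continuous (derive1 p)
    & exists A : R, forall x, A < `|x| -> p x = 0].

Definition weak_derivative (R : realType) (f g : R -> R) : Prop :=
  forall p : R -> R, test_fun p ->
    (\int[lebesgue_measure]_x (f x * derive1 p x) =
     - \int[lebesgue_measure]_x (g x * p x))%R.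

(* [g 0, ..., g s] are f and its weak derivatives up to order s, all in L^2. *)
Definition weak_jet (R : realType) (s : nat) (f : R -> R) (g : nat -> R -> R)
    : Prop :=
  [/\ g 0%N = f,
      forall i, (i <= s)%N -> inL2 (g i)
    & forall i, (i < s)%N -> weak_derivative (g i) (g i.+1)].

(* Weak derivatives are unique almost everywhere, so the infimum is over a set
   with at most one element; it is +oo when f is not in H^s. *)
Definition Hnorm (R : realType) (s : nat) (f : R -> R) : \bar R :=
  ereal_inf [set (Num.sqrt (\sum_(i < s.+1) fine (L2norm (g i)) ^+ 2))%:E
            | g in weak_jet s f].

(* Differential polynomials without constant term in functions w_1, w_2, ... *)
Inductive dpoly (R : Type) : Type :=
| DVar of nat
| DScale of R & dpoly R
| DAdd of dpoly R & dpoly R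
| DMul of dpoly R & dpoly R
| DDer of dpoly R.

Fixpoint dpoly_eval (R : realType) (w : nat -> R -> R) (e : dpoly R)
    : R -> R :=
  match e with
  | DVar j => w j
  | DScale a e1 => fun Y => a * dpoly_eval w e1 Y
  | DAdd e1 e2 => fun Y => dpoly_eval w e1 Y + dpoly_eval w e2 Y
  | DMul e1 e2 => fun Y => dpoly_eval w e1 Y * dpoly_eval w e2 Y
  | DDer e1 => derive1 (dpoly_eval w e1)
  end.

(* Only the variables w_1, ..., w_k occur. *)
Fixpoint dpoly_upto (R : Type) (k : nat) (e : dpoly R) : bool :=
  match e with
  | DVar j => (0 < j <= k)%N
  | DScale _ e1 => dpoly_upto k e1
  | DAdd e1 e2 => dpoly_upto k e1 && dpoly_upto k e2
  | DMul e1 e2 => dpoly_upto k e1 && dpoly_upto k e2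
  | DDer e1 => dpoly_upto k e1
  end.

(* The family (n_+^(k), n_-^(k), v_+^(k), v_-^(k), phi^(k)); index 0 is unused. *)
Record profiles (R : realType) := Profiles {
  np : nat -> R -> R -> R;
  nm : nat -> R -> R -> R;
  vp : nat -> R -> R -> R;
  vm : nat -> R -> R -> R;
  ph : nat -> R -> R -> R }.

(* The antiderivatives in Y of the T-derivatives of n_+^(k), n_-^(k), v_+^(k),
   as differential polynomials in n_+^(1), ..., n_+^(k).  The relations then
   express every profile through n_+^(1), n_+^(2), ..., and the forcing of order
   k is a function of n_+^(1), ..., n_+^(k-1) alone. *)
Record antiderivatives (R : realType) := Antiderivatives {
  int_np : nat -> dpoly R;
  int_nm : nat -> dpoly R;
  int_vp : nat -> dpoly R }.

Definition speed (R : realType) (tau me : R) : R :=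
  Num.sqrt ((1 + tau) / (1 + me)).

(* Coefficient of eps^r in ln (1 + \sum_(i >= 1) eps^i x_i). *)
Definition log_coef (R : realType) (r : nat) (x : nat -> R) : R :=
  \sum_(1 <= j < r.+1) (-1) ^+ j.+1 / j%:R *
    \sum_(a : {ffun 'I_r -> 'I_r.+1} |
           ((\sum_(i < r) a i)%N == j) && ((\sum_(i < r) i.+1 * a i)%N == r))
      (j`!)%:R / (\prod_(i < r) (a i)`!)%:R * \prod_(i < r) x i.+1 ^+ a i.

Definition ell (R : realType) (n : nat -> R -> R -> R) (r : nat)
    : R -> R -> R :=
  fun T Y => log_coef r (fun i => n i T Y).

(* \sum_(j = 1)^(r - 1) a_j b_(r - j) *)
Definition conv (R : realType) (a b : nat -> R -> R -> R) (r : nat)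
    : R -> R -> R :=
  fun T Y => \sum_(1 <= j < r) a j T Y * b (r - j)%N T Y.

(* Left-hand sides of the order-k evolution system. *)

Definition mass_lhs (R : realType) (tau me : R) (n v : nat -> R -> R -> R)
    (k : nat) (T Y : R) : R :=
  d_time (n k) T Y + d_space (v k.+1) T Y + d_space (conv n v k.+1) T Y
  - speed tau me * d_space (n k.+1) T Y.

Definition ion_lhs (R : realType) (tau me : R) (P : profiles R)
    (k : nat) (T Y : R) : R :=
  d_time (vp P k) T Y - speed tau me * d_space (vp P k.+1) T Y
  + 2^-1 * d_space (conv (vp P) (vp P) k.+1) T Y
  + tau * d_space (ell (np P) k.+1) T Y + d_space (ph P k.+1) T Y.

Definition electron_lhs (R : realType) (tau me : R) (P : profiles R)
    (k : nat) (T Y : R) : R :=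
  me * (d_time (vm P k) T Y - speed tau me * d_space (vm P k.+1) T Y
        + 2^-1 * d_space (conv (vm P) (vm P) k.+1) T Y)
  + d_space (ell (nm P) k.+1) T Y - d_space (ph P k.+1) T Y.

Definition poisson_lhs (R : realType) (P : profiles R) (k : nat) (T Y : R) : R :=
  d_space (d_space (ph P k)) T Y + np P k.+1 T Y - nm P k.+1 T Y.

(* The linear combination of the system in which all terms of order k + 1
   cancel. *)
Definition solvability (R : realType) (tau me : R) (P : profiles R)
    (k : nat) (T Y : R) : R :=
  speed tau me ^+ 2 * (1 - tau * me) * d_space (poisson_lhs P k) T Y
  + speed tau me * (1 + tau) * mass_lhs tau me (np P) (vp P) k T Y
  + speed tau me * me * (1 + tau) * mass_lhs tau me (nm P) (vm P) k T Y
  + (1 + tau) * ion_lhs tau me P k T Y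
  + (1 + tau) * electron_lhs tau me P k T Y.

(* Right-hand sides of the relations at order k >= 2; apart from n_+^(k) they
   only involve orders < k.  In rel_vm the linear term is c n_-^(k), which is
   what integrating the electron mass equation of order k - 1 gives (a term
   c n_+^(k) would contradict that equation, as n_-^(k) <> n_+^(k)). *)

Definition rel_nm (R : realType) (P : profiles R) (k : nat) (T Y : R) : R :=
  np P k T Y + d_space (d_space (ph P k.-1)) T Y.

Definition rel_vp (R : realType) (tau me : R) (J : antiderivatives R)
    (P : profiles R) (k : nat) (T Y : R) : R :=
  speed tau me * np P k T Y
  - dpoly_eval (fun j => np P j T) (int_np J k.-1) Y
  - conv (np P) (vp P) k T Y.

Definition rel_vm (R : realType) (tau me : R) (J : antiderivatives R)
    (P : profiles R) (k : nat) (T Y : R) : R :=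
  speed tau me * rel_nm P k T Y
  - dpoly_eval (fun j => np P j T) (int_nm J k.-1) Y
  - conv (nm P) (vm P) k T Y.

Definition rel_ph (R : realType) (tau me : R) (J : antiderivatives R)
    (P : profiles R) (k : nat) (T Y : R) : R :=
  speed tau me * rel_vp tau me J P k T Y
  - tau * ell (np P) k T Y
  - dpoly_eval (fun j => np P j T) (int_vp J k.-1) Y
  - 2^-1 * conv (vp P) (vp P) k T Y.

Definition below (R : realType) (P : profiles R) (k : nat) : profiles R :=
  let cut (u : nat -> R -> R -> R) j := if (j < k)%N then u j else fun _ _ => 0
  in Profiles (cut (np P)) (cut (nm P)) (cut (vp P)) (cut (vm P)) (cut (ph P)).

(* The orders < k of P, completed at order k by what the relations give when
   n_+^(k) is replaced by 0. *)
Definition lower_part (R : realType) (tau me : R) (J : antiderivatives R)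
    (P : profiles R) (k : nat) : profiles R :=
  let B := below P k in
  let ext (u : nat -> R -> R -> R) (w : R -> R -> R) j :=
    if j == k then w else u j in
  Profiles (np B) (ext (nm B) (rel_nm B k)) (ext (vp B) (rel_vp tau me J B k))
    (ext (vm B) (rel_vm tau me J B k)) (ext (ph B) (rel_ph tau me J B k)).

Definition dispersion (R : realType) (tau me : R) : R :=
  (speed tau me ^+ 2 * me - 1) ^+ 2 / (2 * speed tau me * (1 + me)).

(* F^(k-1).  Inserting the relations into [solvability] at order k gives
   2 c (1 + tau) (1 + me) times the linearized KdV operator applied to n_+^(k),
   plus the contribution of [lower_part]. *)
Definition forcing (R : realType) (tau me : R) (J : antiderivatives R)
    (P : profiles R) (k : nat) (T Y : R) : R :=
  - solvability tau me (lower_part tau me J P k) k T Y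
  / (2 * speed tau me * (1 + tau) * (1 + me)).

(* [int_np J k], ..., [int_vp J k] are Y-antiderivatives as announced.  They
   have no additive constant: [dpoly] has no constant term. *)
Definition antiderivatives_at (R : realType) (J : antiderivatives R)
    (P : profiles R) (k : nat) : Prop :=
  let is_int (e : dpoly R) (u : R -> R -> R) :=
    dpoly_upto k e /\
    forall T Y : R,
      is_derive Y 1 (dpoly_eval (fun j => np P j T) e) (d_time u T Y) in
  [/\ is_int (int_np J k) (np P k),
      is_int (int_nm J k) (nm P k)
    & is_int (int_vp J k) (vp P k)].

(* phi^(1) = (c^2 - tau) n_+^(1) = (1 - c^2 me) n_+^(1) is forced by the order
   eps terms of the two momentum equations, and is the value for which the
   dispersion coefficient is (c^2 me - 1)^2 / (2 c (1 + me)). *)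
Definition relations_1 (R : realType) (tau me : R) (P : profiles R) : Prop :=
  forall T Y : R,
  [/\ nm P 1 T Y = np P 1 T Y,
      vp P 1 T Y = speed tau me * np P 1 T Y,
      vm P 1 T Y = speed tau me * np P 1 T Y
    & ph P 1 T Y = (1 - tau * me) / (1 + me) * np P 1 T Y].

Definition relations_at (R : realType) (tau me : R) (J : antiderivatives R)
    (P : profiles R) (k : nat) : Prop :=
  forall T Y : R,
  [/\ nm P k T Y = rel_nm P k T Y,
      vp P k T Y = rel_vp tau me J P k T Y,
      vm P k T Y = rel_vm tau me J P k T Y
    & ph P k T Y = rel_ph tau me J P k T Y].

Definition kdv_1 (R : realType) (tau me : R) (P : profiles R) : Prop :=
  forall T Y : R,
  d_time (np P 1) T Y + speed tau me * (np P 1 T Y * d_space (np P 1) T Y)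
  + dispersion tau me * d_space (d_space (d_space (np P 1))) T Y = 0.

Definition kdv_at (R : realType) (tau me : R) (J : antiderivatives R)
    (P : profiles R) (k : nat) : Prop :=
  forall T Y : R,
  d_time (np P k) T Y
  + speed tau me * d_space (fun T' Y' => np P 1 T' Y' * np P k T' Y') T Y
  + dispersion tau me * d_space (d_space (d_space (np P k))) T Y
  = forcing tau me J P k T Y.

(* u belongs to L^oo((-T0, T0); H^s) for every T0, and u(T, .) is the continuous
   representative of its class. *)
Definition in_class (R : realType) (s : nat) (u : R -> R -> R) : Prop :=
  (forall T, continuous (u T)) /\
  forall T0 : R, 0 < T0 -> exists B : R,
    forall T, `|T| < T0 -> (Hnorm s (u T) <= B%:E)%E.

Definition time_derivable (R : realType) (u : R -> R -> R) : Prop :=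
  forall T Y : R, derivable (fun T' => u T' Y) T 1.

(* The order-k initial data [ini k] prescribe n_+^(k) at T = 0; the other
   profiles are then given by the relations. *)
Record kdv_hierarchy (R : realType) (m : nat) (tau me : R)
    (J : antiderivatives R) (s : nat -> nat) (ini : nat -> R -> R)
    (P : profiles R) : Prop := KdVHierarchy {
  hier_data : forall k, (1 <= k <= m)%N ->
    (Hnorm (s k) (ini k) < +oo)%E /\ np P k 0 = ini k;
  hier_class : forall k, (1 <= k <= m)%N ->
    [/\ in_class (s k) (np P k), in_class (s k) (nm P k),
        in_class (s k) (vp P k), in_class (s k) (vm P k)
      & in_class (s k) (ph P k)];
  hier_time : forall k, (1 <= k <= m)%N ->
    [/\ time_derivable (np P k), time_derivable (nm P k),
        time_derivable (vp P k) & time_derivable (vm P k)];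
  hier_int : forall k, (1 <= k < m)%N -> antiderivatives_at J P k;
  hier_rel_1 : relations_1 tau me P;
  hier_rel : forall k, (2 <= k <= m)%N -> relations_at tau me J P k;
  hier_kdv_1 : kdv_1 tau me P;
  hier_kdv : forall k, (2 <= k <= m)%N -> kdv_at tau me J P k }.

(* \sum_(k = 1)^m eps^k u^(k), a function of (T, Y). *)
Definition expansion (R : realType) (m : nat) (eps : R)
    (u : nat -> R -> R -> R) : R -> R -> R :=
  fun T Y => \sum_(1 <= k < m.+1) eps ^+ k * u k T Y.

(* A function of (T, Y) as a function of (t, x). *)
Definition unscale (R : realType) (tau me eps : R) (u : R -> R -> R)
    : R -> R -> R :=
  fun t x => u (eps `^ (3 / 2) * t)
               (eps `^ (1 / 2) * (x - speed tau me * t)).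

Definition Nxt (R : realType) (m : nat) (tau me eps : R)
    (n : nat -> R -> R -> R) : R -> R -> R :=
  unscale tau me eps (fun T Y => 1 + expansion m eps n T Y).

Definition Vxt (R : realType) (m : nat) (tau me eps : R)
    (v : nat -> R -> R -> R) : R -> R -> R :=
  unscale tau me eps (expansion m eps v).

Definition truncated_log (R : realType) (m : nat) (N : R -> R -> R)
    (t x : R) : R :=
  \sum_(1 <= k < m.+1)
    (-1) ^+ k.+1 / k%:R * d_space (fun t' x' => (N t' x' - 1) ^+ k) t x.

Definition res_n (R : realType) (m : nat) (tau me eps : R)
    (n v : nat -> R -> R -> R) (t x : R) : R :=
  let N := Nxt m tau me eps n in let V := Vxt m tau me eps v in
  - (eps * eps ^- m) *
    (d_time N t x + d_space (fun t' x' => N t' x' * V t' x') t x).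

Definition res_np (R : realType) (m : nat) (tau me eps : R) (P : profiles R) :=
  res_n m tau me eps (np P) (vp P).

Definition res_nm (R : realType) (m : nat) (tau me eps : R) (P : profiles R) :=
  res_n m tau me eps (nm P) (vm P).

Definition res_vp (R : realType) (m : nat) (tau me eps : R) (P : profiles R)
    (t x : R) : R :=
  let N := Nxt m tau me eps (np P) in let V := Vxt m tau me eps (vp P) in
  let Phi := Vxt m tau me eps (ph P) in
  - (eps * eps ^- m) *
    (d_time V t x + 2^-1 * d_space (fun t' x' => V t' x' ^+ 2) t x
     + tau * truncated_log m N t x + d_space Phi t x).

Definition res_vm (R : realType) (m : nat) (tau me eps : R) (P : profiles R)
    (t x : R) : R :=
  let N := Nxt m tau me eps (nm P) in let V := Vxt m tau me eps (vm P) in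
  let Phi := Vxt m tau me eps (ph P) in
  - (eps * eps ^- m) *
    (me * (d_time V t x + 2^-1 * d_space (fun t' x' => V t' x' ^+ 2) t x)
     + truncated_log m N t x - d_space Phi t x).

Definition res_ph (R : realType) (m : nat) (tau me eps : R) (P : profiles R)
    (t x : R) : R :=
  - (eps * eps ^- m) *
    (d_space (d_space (Vxt m tau me eps (ph P))) t x
     - Nxt m tau me eps (nm P) t x + Nxt m tau me eps (np P) t x).

(* H^s norm of (N_+ - 1, N_- - 1, V_+, V_-, Phi) at time T; the constant
   background 1 is removed since it does not belong to H^s. *)
Definition expansion_norm (R : realType) (m s : nat) (eps : R) (P : profiles R)
    (T : R) : \bar R :=
  (Hnorm s (expansion m eps (np P) T) + Hnorm s (expansion m eps (nm P) T) +
   Hnorm s (expansion m eps (vp P) T) + Hnorm s (expansion m eps (vm P) T) +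
   Hnorm s (expansion m eps (ph P) T))%E.

Definition expansion_size (R : realType) (m s : nat) (P : profiles R) : \bar R :=
  ereal_sup [set expansion_norm m s z.1 P z.2 | z in
              [set z : R * R | 0 < z.1 < 1 /\ 0 <= z.2]].

Definition sup_L2 (R : realType) (f : R -> R -> R) : \bar R :=
  ereal_sup [set L2norm (f t) | t in [set t : R | 0 <= t]].

(* Main.v *)
Require Import Defs.
From HB Require Import structures.
From mathcomp Require Import all_boot all_order all_algebra.
From mathcomp Require Import all_classical all_reals all_analysis.
From mathcomp Require Import measurable_realfun.
From mathcomp Require Import ring lra zify.

Set Implicit Arguments.
Unset Strict Implicit.
Unset Printing Implicit Defensive.

Import Order.TTheory GRing.Theory Num.Theory.
Import numFieldNormedType.Exports.

Local Open Scope classical_set_scope.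
Local Open Scope ring_scope.

(* Through the relations and the KdV equations, all profiles and their time
   derivatives are differential polynomials in n_+^(1), ..., n_+^(m), hence are
   controlled by Sobolev norms of these functions at the same time T.  Inserting
   the truncated expansions into the Euler-Poisson system gives polynomials in
   eps whose coefficients are differential polynomials of this kind.  The
   coefficient of degree 1 vanishes by the dispersion relation, and that of
   degree k + 1 <= m is the order-k evolution system: its mass, ion and Poisson
   equations are the differentiated relations, and its electron equation then
   follows from the solvability condition, which is the KdV equation.  What
   remains is eps^(m+1) times a differential polynomial in Y.  The change of
   variables from Y to x costs eps^(-1/4) in L^2, the factor eps^(1-m) comes
   from the normalization and eps^(1/2) from the outer d_x or d_t (absent in
   the Poisson equation): this gives eps^(9/4) and eps^(7/4).  Norms of the
   single profiles are recovered from those of the expansion at m distinct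
   values of eps by inverting a Vandermonde matrix. *)

(** A profile is given with weak derivatives in Y at each time and mere pointwise derivability in T;
    no joint regularity in (T, Y) is assumed. The residuals, however, contain time derivatives at
    fixed x, which call for a chain rule along slanted lines in the (T, Y) plane and for exchanging
    d_T with d_Y. Both become available because the KdV equations turn every T-derivative into a
    differential polynomial, that is, into a function of Y with bounds locally uniform in T. Two
    kinds of bounds are kept apart. Those of [in_class] live on bounded time intervals and depend on
    the solution: they only license differentiations. Those of [expansion_size] hold for all T >= 0
    and alone determine C. As C must be chosen before the initial data and the solution, regularity
    thresholds and bounding functions are always quantified before the profiles. For k >= 2 the
    forcing is itself a value of [solvability], taken on the orders below k completed with n_+^(k) =
    0. The solvability condition therefore amounts to computing how [solvability] changes when
    n_+^(k) and the order k + 1 are put back. *)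

Section derivative_estimates.
Context {R : realType}.
Implicit Types f : R -> R.

(** A form of derivability without quotients: h = 0 is no special case, and first-order errors can
    be added by the triangle inequality. *)
Lemma is_derive_epsP f (x d : R) : is_derive x 1 f d <->
  (forall e : R, 0 < e -> exists2 r : R, 0 < r & forall h : R, `|h| < r ->
     `|f (x + h) - f x - h * d| <= e * `|h|).
Proof.
split=> [[df fd] e e0|H].
- have := @derivable1_diffP _ _ f x.
  have : h^-1 *: (f (h *: 1 + x) - f x) @[h --> 0^'] --> d.
    by rewrite -fd; apply: df.
  move=> /cvgrPdist_le/(_ e e0) [r /= r0 Hr] _.
  exists r => // h hr; have [->|h0] := eqVneq h 0.
    by rewrite addr0 subrr mul0r subrr normr0 mulr0.
  have := Hr h; rewrite /ball_/= sub0r normrN => /(_ hr h0).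
  rewrite scaler1 [h + x]addrC (distrC d).
  rewrite [e * _]mulrC -ler_pdivrMl ?normr_gt0// -normfV -normrM; apply: le_trans.
  rewrite le_eqVlt; apply/orP; left.
  apply/eqP; congr (`|_|); rewrite /GRing.scale/=; field; exact: h0.
- have C : h^-1 *: (f (h *: 1 + x) - f x) @[h --> 0^'] --> d.
    apply/cvgrPdist_le => e e0; have [r r0 Hr] := H e e0.
    exists r => //= h; rewrite /ball_/= sub0r normrN => hr h0.
    have := Hr h hr.
    rewrite scaler1 [h + x]addrC (distrC d).
    rewrite [e * _]mulrC -ler_pdivrMl ?normr_gt0//.
    rewrite -normfV -normrM; apply: le_trans; rewrite le_eqVlt; apply/orP; left.
    apply/eqP; congr (`|_|); rewrite /GRing.scale/=; field; exact: h0.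
  by split; [apply/cvg_ex; exists d|apply/cvg_lim].
Qed.

(** In each of the four sign cases of x and x + h the first-order error is at most h^2, so the
    radius e serves for the tolerance e. *)
Lemma is_derive_mul_norm (x : R) : is_derive x 1 (fun y : R => y * `|y|) (2 * `|x|).
Proof.
apply/is_derive_epsP => e e0; exists e => // h he.
apply: (@le_trans _ _ (`|h| * `|h|)); last by rewrite ler_wpM2r// ltW.
rewrite -normrM.
have [x0|x0] := leP 0 x; have [y0|y0] := leP 0 (x + h);
 first [rewrite (ger0_norm x0)|rewrite (ltr0_norm x0)];
 first [rewrite (ger0_norm y0)|rewrite (ltr0_norm y0)];
 rewrite (ger0_norm (_ : 0 <= h * h)) -?expr2 ?sqr_ge0// ler_norml; apply/andP; split; nra.
Qed.

End derivative_estimates.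

(** * The fundamental theorem of calculus for weak derivatives *)

Section second_difference.
Context {R : realType}.
Implicit Types (h x : R).

(* [hat h] is the tent of mass 1 on [-h, h], written as a second difference so
   that its antiderivative [step h] is explicit and C^1. *)
Definition hat h x := (`|x + h| - 2 * `|x| + `|x - h|) / (2 * h ^+ 2).

Definition step h x :=
  ((x + h) * `|x + h| - 2 * (x * `|x|) + (x - h) * `|x - h|) / (4 * h ^+ 2).

Lemma is_derive_mul_norm_shift (c x : R) :
  is_derive x 1 (fun y : R => (y + c) * `|y + c|) (2 * `|x + c|).
Proof.
have /is_derive_epsP H := is_derive_mul_norm (x + c).
apply/is_derive_epsP => e /H[r r0 Hr]; exists r => // h /Hr.
by rewrite (addrAC x).
Qed.

Lemma is_derive_step h (c x : R) : 0 < h ->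
  is_derive x 1 (fun y => step h (y + c)) (hat h (x + c)).
Proof.
move=> h0.
pose F (d y : R) : R := (y + d) * `|y + d|.
have d1 : is_derive x 1 (F (c + h)) _ := is_derive_mul_norm_shift (c + h) x.
have d2 : is_derive x 1 (F c) _ := is_derive_mul_norm_shift c x.
have d3 : is_derive x 1 (F (c - h)) _ := is_derive_mul_norm_shift (c - h) x.
have -> : (fun y => step h (y + c)) =
    (4 * h ^+ 2)^-1 *: (F (c + h) - (2 : R) *: F c + F (c - h)).
  apply/funext => y; rewrite /step !fctE /F /GRing.scale/= !addrA; field; exact: lt0r_neq0.
apply: is_derive_eq.
rewrite /hat /GRing.scale/= !addrA; field; exact: lt0r_neq0.
Qed.

Lemma continuous_hat h (c : R) : continuous (fun x => hat h (x + c)).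
Proof.
move=> x; apply: cvgM; last exact: cvg_cst.
have N (d : R) : (fun y : R => `|y + c + d|) y @[y --> x] --> `|x + c + d|.
  by apply: cvg_norm; do 2! (apply: cvgD; last exact: cvg_cst); exact: cvg_id.
apply: cvgD; last exact: N.
apply: cvgB; first exact: N.
by apply: cvgM; [exact: cvg_cst|have := N 0; under eq_fun do rewrite addr0; rewrite addr0].
Qed.

Lemma hat_ge0 h x : 0 <= hat h x.
Proof.
apply: divr_ge0; last by rewrite mulr_ge0 ?sqr_ge0.
have := ler_normD (x + h) (x - h).
by rewrite (_ : x + h + (x - h) = 2 * x); [rewrite normrM ger0_norm//; lra|ring].
Qed.

Lemma hat_le h x : 0 < h -> hat h x <= h^-1.
Proof.
move=> h0; rewrite /hat ler_pdivrMr ?mulr_gt0 ?exprn_gt0//.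
rewrite (_ : h^-1 * (2 * h ^+ 2) = 2 * h); last by field; exact: lt0r_neq0.
have [x0|x0] := leP 0 x; have [y0|y0] := leP 0 (x + h); have [z0|z0] := leP 0 (x - h);
 first [rewrite (ger0_norm x0)|rewrite (ltr0_norm x0)];
 first [rewrite (ger0_norm y0)|rewrite (ltr0_norm y0)];
 first [rewrite (ger0_norm z0)|rewrite (ltr0_norm z0)]; lra.
Qed.

Lemma hat_out h x : 0 < h -> h <= `|x| -> hat h x = 0.
Proof.
move=> h0; rewrite /hat ler_normr => /orP[hx|hx].
  by rewrite !ger0_norm; lra.
by rewrite !ler0_norm; lra.
Qed.

(** To the right of h all three signs agree and the second difference of x^2 is 2 h^2; by symmetry
    [step] rises from -1/2 to 1/2, which gives [hat] its mass 1. *)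
Lemma step_right h x : 0 < h -> h <= x -> step h x = 2^-1.
Proof.
move=> h0 hx; rewrite /step !ger0_norm; [field; exact: lt0r_neq0| lra..].
Qed.

Lemma step_left h x : 0 < h -> x <= - h -> step h x = - 2^-1.
Proof.
move=> h0 hx; rewrite /step !ler0_norm; [field; exact: lt0r_neq0| lra..].
Qed.

Lemma step_bounded h x : 0 < h -> `|step h x| <= 2^-1.
Proof.
move=> h0; have [hx|hx] := leP h x; first by rewrite step_right// ger0_norm.
have [hx'|hx'] := leP x (- h); first by rewrite step_left// normrN ger0_norm.
have h2 : 0 < h ^+ 2 by rewrite exprn_gt0.
rewrite /step normrM normfV (@ger0_norm _ (4 * _)); last by rewrite mulr_ge0 ?ltW.
rewrite ler_pdivrMr ?mulr_gt0// (_ : 2^-1 * (4 * h ^+ 2) = 2 * (h * h)); last by field.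
rewrite (@ger0_norm _ (x + h)) ?(@ler0_norm _ (x - h)); [|lra..].
have [x0|x0] := leP 0 x;
 first [rewrite (ger0_norm x0)|rewrite (ltr0_norm x0)];
 rewrite ler_norml; apply/andP; split; nra.
Qed.

(** A C^1 substitute for the indicator function of [a, b], with transition layers of half-width h
    around a and b. *)
Definition pulse h (a b x : R) := step h (x - a) - step h (x - b).

Lemma pulse_left h (a b x : R) : 0 < h -> a <= b -> x <= a - h -> pulse h a b x = 0.
Proof. by move=> h0 ab xa; rewrite /pulse !step_left ?subrr//; lra. Qed.

Lemma pulse_right h (a b x : R) : 0 < h -> a <= b -> b + h <= x -> pulse h a b x = 0.
Proof. by move=> h0 ab xa; rewrite /pulse !step_right ?subrr//; lra. Qed.

Lemma pulse_in h (a b x : R) : 0 < h -> a + h <= x -> x <= b - h -> pulse h a b x = 1.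
Proof. by move=> h0 xa xb; rewrite /pulse step_right ?step_left//; lra. Qed.

Lemma pulse_bounded h (a b x : R) : 0 < h -> `|pulse h a b x| <= 1.
Proof.
move=> h0; rewrite (splitr 1) (le_trans (ler_normB _ _))//.
by apply: lerD; rewrite div1r step_bounded.
Qed.

Lemma derive1_pulse h (a b : R) : 0 < h ->
  derive1 (pulse h a b) = (fun x => hat h (x - a) - hat h (x - b)).
Proof.
move=> h0; apply/funext => x; rewrite derive1E.
have D : is_derive x 1 (pulse h a b) (hat h (x - a) - hat h (x - b)).
  by apply: is_deriveB; exact: is_derive_step.
exact: derive_val.
Qed.

Lemma test_fun_pulse h (a b : R) : 0 < h -> a <= b -> test_fun (pulse h a b).
Proof.
move=> h0 ab; split.
- move=> x.
  have D : is_derive x 1 (pulse h a b) (hat h (x - a) - hat h (x - b)).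
    by apply: is_deriveB; exact: is_derive_step.
  exact: ex_derive.
- by rewrite derive1_pulse// => x; apply: cvgB; exact: continuous_hat.
- exists (`|a| + `|b| + h) => x.
  rewrite lter_normr => /orP[|] hx.
    have := ler_norm b; have := normr_ge0 a.
    by move=> *; rewrite pulse_right//; lra.
  have := lerNnormlW (lexx `|a|); have := normr_ge0 b.
  by move=> *; rewrite pulse_left//; lra.
Qed.

Lemma continuous_pulse h (a b : R) : 0 < h -> a <= b -> continuous (pulse h a b).
Proof.
move=> h0 ab x; apply: differentiable_continuous; apply/derivable1_diffP.
by case: (test_fun_pulse h0 ab).
Qed.

End second_difference.

Section sobolev.
Context {R : realType}.
Local Notation mu := (@lebesgue_measure R).
Implicit Types (f g : R -> R) (M x : R).

(** The squared L^2 norm: estimates become monotonicity of integrals of nonnegative functions, and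
    the power 1/2 is dealt with only once. *)
Definition sqint (f : R -> R) : \bar R := (\int[mu]_x (f x ^+ 2)%:E)%E.

Lemma sqint_ge0 f : (0 <= sqint f)%E.
Proof. by apply: integral_ge0 => x _; rewrite lee_fin sqr_ge0. Qed.

Lemma L2normE f : L2norm f = (sqint f `^ 2^-1)%E.
Proof.
rewrite /L2norm unlock /Lnorm/= /sqint; congr (_ `^ _)%E.
apply: eq_integral => x _.
by rewrite -[in RHS]real_normK ?num_real// powR_mulrn.
Qed.

Lemma L2norm_le f (B : R) : 0 <= B ->
  (L2norm f <= B%:E)%E = (sqint f <= (B ^+ 2)%:E)%E.
Proof.
move=> B0; rewrite L2normE; have := sqint_ge0 f.
case: (sqint f) => [r||]//; rewrite ?lee_fin => r0.
- by rewrite powR12_sqrt// -[in RHS](sqr_sqrtr r0) ler_sqr ?nnegrE ?sqrtr_ge0.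
- by rewrite /poweR invr_eq0 pnatr_eq0 /= !leye_eq.
Qed.

Lemma L2norm_lty f : (L2norm f < +oo)%E -> (sqint f < +oo)%E.
Proof.
rewrite L2normE; have := sqint_ge0 f.
case: (sqint f) => [r||]//; rewrite ?ltry//.
by rewrite /poweR invr_eq0 pnatr_eq0.
Qed.

End sobolev.

Section weak_ftc.
Context {R : realType}.
Local Notation mu := (@lebesgue_measure R).
Implicit Types (f g : R -> R) (M x : R).

Definition loc_int f := forall a b : R, mu.-integrable `[a, b] (EFin \o f).

(** On a bounded interval the pointwise bound |f| <= 1 + f^2, read off from (|f| - 1)^2 >= 0, takes
    the place of the Cauchy-Schwarz inequality. *)
Lemma inL2_loc_int f : inL2 f -> loc_int f.
Proof.
move=> [mf /L2norm_lty ff] a b.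
apply: (@le_integrable _ _ _ mu _ _ (EFin \o f) (EFin \o (fun x => 1 + f x ^+ 2))) => //.
- by apply/measurable_EFinP; exact: measurable_funTS.
- move=> x _; rewrite lee_fin [leRHS]ger0_norm ?addr_ge0 ?sqr_ge0//.
  by have := sqr_ge0 (`|f x| - 1); rewrite sqrrB real_normK ?num_real//; have := normr_ge0 (f x); lra.
- rewrite (_ : _ \o _ = (EFin \o cst 1) \+ (EFin \o (fun x => f x ^+ 2)))//.
  apply: integrableD => //.
    apply: continuous_compact_integrable; first exact: segment_compact.
    by apply: continuous_subspaceT => x; exact: cvg_cst.
  apply: (@integrableS _ _ _ mu setT) => //.
  apply/integrableP; split; first by apply/measurable_EFinP; exact: measurable_funX.
  move: ff; rewrite /sqint; congr (_ < _)%E; apply: eq_integral => x _.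
  by rewrite /= ger0_norm ?sqr_ge0.
Qed.

Lemma loc_int_locally_integrable f : loc_int f -> measurable_fun setT f ->
  locally_integrable setT f.
Proof.
move=> lf mf; split => //; first exact: openT.
move=> K _ cK; have [M [_ HM]] := compact_bounded cK.
have KM : K `<=` `[- (`|M| + 1), `|M| + 1].
  move=> x /(HM (`|M| + 1)) H; rewrite /= in_itv/= -ler_norml; apply: H.
  by rewrite ltr_pwDr// ler_norm.
have /integrableP[_] := lf (- (`|M| + 1)) (`|M| + 1); apply: le_lt_trans.
apply: ge0_subset_integral => //; first exact: compact_measurable.
by apply/measurable_EFinP; apply: measurableT_comp => //; exact: measurable_funTS.
Qed.

Lemma inL2_ae_lebesgue_pt f : inL2 f -> {ae mu, forall x, lebesgue_pt f x}.
Proof.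
move=> f2; apply: lebesgue_differentiation.
by apply: loc_int_locally_integrable; [exact: inL2_loc_int|case: f2].
Qed.

Lemma loc_int_bounded f g (a b : R) M : loc_int f -> continuous g ->
  (forall x, `|g x| <= M) -> mu.-integrable `[a, b] (EFin \o (fun x => f x * g x)).
Proof.
move=> lf cg gM; rewrite (_ : _ \o _ = (EFin \o f) \* (EFin \o g))%E; last first.
  by apply/funext => x /=; rewrite EFinM.
apply: integrableMl => //.
  by apply: measurable_funTS; exact: continuous_measurable_fun.
exists M; split; first exact: num_real.
by move=> N MN x _ /=; rewrite (le_trans (gM x))// ltW.
Qed.

Lemma integral_hat (h a A B : R) : 0 < h -> A <= a - h -> a + h <= B ->
  (\int[mu]_(x in `[A, B]) hat h (x - a))%R = 1.
Proof.
move=> h0 hA hB; rewrite /Rintegral.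
rewrite (@continuous_FTC2 _ _ (fun x => step h (x - a))); [|lra|..].
- by rewrite /= step_right ?step_left; [field|lra..].
- by apply: continuous_subspaceT => x; exact: continuous_hat.
- have D x : is_derive x 1 (fun x => step h (x - a)) (hat h (x - a)).
    exact: is_derive_step.
  have C : continuous (fun x => step h (x - a)).
    by move=> x; apply: differentiable_continuous; apply/derivable1_diffP; apply: ex_derive.
  split; first by move=> x _; apply: ex_derive.
    by apply: cvg_at_right_filter; exact: C.
  by apply: cvg_at_left_filter; exact: C.
- move=> x _; rewrite derive1E; have D := is_derive_step (- a) x h0.
  by apply: derive_val.
Qed.

(** The tent has mass 1, height at most 1/h and support in a ball of measure 2h. The tent-weighted
    mean of |f - f a| is thus at most twice the uniform mean over this ball, which is small at a
    Lebesgue point. *)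
Lemma integral_hat_le f (h a A B : R) : loc_int f -> measurable_fun setT f ->
  0 < h -> A <= a - h -> a + h <= B ->
  (`|\int[mu]_(x in `[A, B]) (f x * hat h (x - a)) - f a|%:E <= 2%:E * davg f a h)%E.
Proof.
move=> lf mf h0 hA hB.
have cb : continuous (fun x => hat h (x - a)) by exact: continuous_hat.
have bb x : `|hat h (x - a)| <= h^-1 by rewrite ger0_norm ?hat_ge0// hat_le.
have lc (c : R) : loc_int (cst c).
  move=> ? ?; apply: continuous_compact_integrable; first exact: segment_compact.
  by apply: continuous_subspaceT => x; exact: cvg_cst.
have i1 := loc_int_bounded A B lf cb bb.
have i2 := loc_int_bounded A B (lc (f a)) cb bb.
have i3 : mu.-integrable `[A, B] (EFin \o (fun x => hat h (x - a))).
  have := loc_int_bounded A B (lc 1) cb bb.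
  by apply: eq_integrable => // x _ /=; rewrite mul1r.
have fE : f a = (\int[mu]_(x in `[A, B]) (f a * hat h (x - a)))%R.
  by rewrite RintegralZl// integral_hat// mulr1.
rewrite [X in _ - X]fE.
rewrite -RintegralB//.
rewrite EFin_normr_Rintegral//; last exact: (integrableB _ i1 i2).
apply: le_trans; first apply: le_abse_integral => //.
  apply/measurable_EFinP; apply: measurable_funB; apply: measurable_funM => //;
  apply: measurable_funTS => //; exact: continuous_measurable_fun.
have mm : measurable_fun setT (fun x => `|f x - f a|%:E : \bar R).
  by apply/measurable_EFinP; apply: measurableT_comp => //; apply: measurable_funB.
rewrite /davg /iavg lebesgue_measure_ball ?(ltW h0)// inver mulrn_eq0/= gt_eqF//.
rewrite muleA -EFinM (_ : 2 * _ = h^-1); last by field; exact: lt0r_neq0.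
rewrite -ge0_integralZl//; last 3 first.
- exact: measurable_ball.
- exact: measurable_funTS.
- by rewrite lee_fin invr_ge0 ltW.
rewrite [leRHS]integral_mkcond [leLHS]integral_mkcond.
apply: ge0_le_integral => //.
- by move=> x _; rewrite patchE; case: ifP.
- apply/(measurable_restrictT _ _).1 => //.
  apply/measurable_EFinP; apply: measurableT_comp => //.
  apply: measurable_funB; apply: measurable_funM => //;
  apply: measurable_funTS => //; exact: continuous_measurable_fun.
- apply/(measurable_restrictT _ _).1; first exact: measurable_ball.
  by apply: measurable_funTS; apply: emeasurable_funM.
- move=> x _; rewrite !patchE.
  have [xb|xb] := boolP (x \in (ball a h : set R)).
    case: ifP => _ /=; last by rewrite mule_ge0 ?lee_fin// invr_ge0 ltW.
    by rewrite lee_fin -mulrBl normrM mulrC ler_wpM2r.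
  case: ifP => _ //=; rewrite hat_out ?mulr0 ?subrr ?normr0//.
  by rewrite leNgt; apply: contra xb => xb; rewrite inE /ball/= distrC.
Qed.

Lemma Rintegral_support f (D : set R) : (forall x, ~ D x -> f x = 0) ->
  (\int[mu]_x f x)%R = (\int[mu]_(x in D) f x)%R.
Proof.
move=> f0; rewrite [RHS]Rintegral_mkcond; congr Rintegral; apply/funext => x.
rewrite patchE; case: ifPn => // xD; rewrite f0// => Dx; move: xD.
by rewrite mem_set.
Qed.

Lemma measure_ball_nbhd (a b h : R) : 0 < h ->
  (mu ((`[(a - h)%R, (a + h)%R] `|` `[(b - h)%R, (b + h)%R])%classic : set R) < (5 * h)%:E)%E.
Proof.
move=> h0; apply: (@le_lt_trans _ _ ((2 * h)%:E + (2 * h)%:E)%E); last first.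
  by rewrite -EFinD lte_fin; lra.
apply: le_trans; first by apply: measureU2.
have M (c : R) : (mu (`[(c - h)%R, (c + h)%R]%classic : set R) <= (2 * h)%:E)%E.
  rewrite lebesgue_measure_itv/= lte_fin ifT; last by lra.
  by rewrite -EFinD lee_fin; lra.
by apply: leeD; exact: M.
Qed.

Lemma lebesgue_pt_lt f (x e : R) : lebesgue_pt f x -> 0 < e ->
  \forall h \near (0 : R)^'+, (davg f x h < e%:E)%E.
Proof.
by move=> L e0; apply: (L [set u | (u < e%:E)%E]); apply: open_ereal_lt'; rewrite lte_fin.
Qed.

Lemma integrable_patch f (D : set R) : measurable D ->
  mu.-integrable D (EFin \o f) -> mu.-integrable setT (EFin \o (f \_ D)).
Proof.
by move=> mD iD; rewrite -restrict_EFin; apply/integrable_restrict => //=; rewrite setTI.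
Qed.

(** Off the two layers the pulse equals the indicator function of [a, b]; inside them the difference
    is at most 2. As h < 1, g may be cut off outside [a - 1, b + 1], which leaves an integrable
    function, so that absolute continuity of the integral applies to the right-hand side. *)
Lemma pulse_approx g (a b h : R) : a < b -> 0 < h -> h < 1 -> loc_int g ->
  `|(\int[mu]_x (g x * pulse h a b x))%R - (\int[mu]_(x in `[a, b]) g x)%R| <=
  2 * (\int[mu]_(x in (`[a - h, a + h] `|` `[b - h, b + h])%classic)
         `|(g \_ `[a - 1, b + 1]) x|)%R.
Proof.
move=> ab h0 h1 lg.
set K : set R := `[a - 1, b + 1]%classic; set N := (_ `|` _)%classic.
pose G := g \_ K.
have mK : measurable K by exact: measurable_itv.
have mN : measurable N by apply: measurableU; exact: measurable_itv.
have inK (x : R) : a <= x -> x <= b -> x \in K.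
  move=> xa xb; rewrite inE /K/= in_itv/=.
  by move: xa xb; clear => xa xb; apply/andP; split; lra.
have iG : mu.-integrable setT (EFin \o G) by apply: integrable_patch; last exact: lg.
have iab : mu.-integrable setT (EFin \o (g \_ `[a, b])).
  by apply: integrable_patch => //; exact: lg.
have iGp : mu.-integrable setT (EFin \o (fun x => G x * pulse h a b x)).
  rewrite (_ : _ \o _ = (EFin \o G) \* (EFin \o pulse h a b))%E; last first.
    by apply/funext => x /=; rewrite EFinM.
  apply: integrableMl => //.
    by apply: continuous_measurable_fun; exact: continuous_pulse h0 (ltW ab).
  exists 1; split; first exact: num_real.
  by move=> M MN x _ /=; rewrite (le_trans (pulse_bounded _ _ _ h0))// ltW.
have iN : mu.-integrable setT (EFin \o ((fun x => `|G x|) \_ N)).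
  apply: integrable_patch => //.
  by apply: (@integrableS _ _ _ _ setT) => //; exact: integrable_norm.
have -> : (\int[mu]_x (g x * pulse h a b x))%R = (\int[mu]_x (G x * pulse h a b x))%R.
  apply: eq_Rintegral => x _; rewrite /G patchE; case: ifPn => //.
  move=> /negP xK; have {xK} : ~ K x by move=> /mem_set.
  rewrite /K/= in_itv/= => /negP; rewrite negb_and -!ltNge => /orP[]; move: ab h0 h1.
    clear; move=> ab h0 h1 xa.
    by rewrite pulse_left ?mulr0//; [exact: ltW|lra].
  clear; move=> ab h0 h1 xa.
  by rewrite pulse_right ?mulr0//; [exact: ltW|lra].
rewrite [X in _ - X]Rintegral_mkcond -RintegralB//.
apply: le_trans; first apply: le_normr_Rintegral => //.
  exact: (integrableB _ iGp iab).
rewrite [X in _ <= 2 * X]Rintegral_mkcond -RintegralZl//.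
apply: le_Rintegral => //.
- by apply: integrable_norm; exact: (integrableB _ iGp iab).
- have := @integrableZl _ _ _ mu _ measurableT 2 _ iN.
  by apply: eq_integrable => // x _ /=; rewrite EFinM.
suff H (x : R) : `|G x * pulse h a b x - (g \_ `[a, b]) x| <=
    2 * ((fun x => `|G x|) \_ N) x by move=> x _; exact: H.
rewrite [X in 2 * X]patchE [X in _ - X]patchE; have [xN|/negP xN] := boolP (x \in N).
  have pb := pulse_bounded a b x h0.
  have [xab|xab] := boolP (x \in `[a, b]%classic).
    rewrite /G patchE ifT; last first.
      by move: xab => /set_mem; rewrite /= in_itv/= => /andP[]; exact: inK.
    rewrite -{2}[g x]mulr1 -mulrBr normrM mulrC ler_wpM2r//.
    by rewrite (le_trans (ler_normB _ _))// normr1 -[2]/(1 + 1) lerD2r.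
  by rewrite subr0 normrM mulrC ler_wpM2r// (le_trans pb)// ler1n.
have {}xN : ~ N x by move=> /mem_set.
have xa : x < a - h \/ a + h < x.
  apply/orP; rewrite !ltNge -negb_and; apply/negP => H.
  by apply: xN; left; rewrite /= in_itv.
have xb : x < b - h \/ b + h < x.
  apply/orP; rewrite !ltNge -negb_and; apply/negP => H.
  by apply: xN; right; rewrite /= in_itv.
rewrite mulr0 le_eqVlt; apply/orP; left; rewrite normr_eq0 subr_eq0; apply/eqP.
have [/andP[xa1 xb1]|] := boolP (a <= x <= b).
  rewrite [in RHS]ifT ?inE/= ?in_itv/= ?xa1 ?xb1//.
  rewrite /G patchE ifT; last exact: inK.
  rewrite pulse_in ?mulr1//.
    by case: xa; move: xa1 h0; clear => *; lra.
  by case: xb; move: xb1 h0; clear => *; lra.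
move=> xab; rewrite [in RHS]ifF; last by rewrite memNset//= in_itv/=; exact/negP.
suff -> : pulse h a b x = 0 by rewrite mulr0.
move: xab; rewrite negb_and -!ltNge => /orP[] xab.
  apply: pulse_left => //; first exact: ltW.
  by case: xa; move: xab h0; clear => *; lra.
apply: pulse_right => //; first exact: ltW.
by case: xb; move: xab h0; clear => *; lra.
Qed.

(* Testing against [pulse h a b], whose derivative tends to the difference of the
   Dirac masses at a and b. *)
Lemma weak_derivative_ftc f g (a b : R) : a < b -> inL2 f -> inL2 g ->
  weak_derivative f g -> lebesgue_pt f a -> lebesgue_pt f b ->
  (\int[mu]_(x in `[a, b]) g x)%R = f b - f a.
Proof.
move=> ab f2 g2 fg La Lb.
have lf := inL2_loc_int f2; have lg := inL2_loc_int g2; have [mf _] := f2.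
apply/eqP; rewrite -subr_eq0 -normr_le0; apply/ler_addgt0Pr => e e0; rewrite add0r.
pose K : set R := `[a - 1, b + 1]%classic.
have mK : measurable K by exact: measurable_itv.
have iG : mu.-integrable setT (EFin \o (g \_ K)).
  by apply: integrable_patch; last exact: lg.
have e8 : 0 < e / 8 by rewrite divr_gt0.
have [d [d0 Gd]] := integral_normr_continuous iG e8.
(* Error budget: the endpoints a and b and the transition layers cost 2 (e / 8) = e / 4 each. The
   layers have total measure below 5h < d, where d comes from absolute continuity of the integral of
   |g|. *)
have [h [ha hb h0 h1 hd]] : exists h, [/\ (davg f a h < (e / 8)%:E)%E,
    (davg f b h < (e / 8)%:E)%E, 0 < h, h < 1 & h < d / 5].
  apply: (@filter_ex _ (0 : R)^'+); near=> h; split; near: h => //.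
  - exact: lebesgue_pt_lt.
  - exact: lebesgue_pt_lt.
  - exact: nbhs_right_gt.
  - exact: nbhs_right_lt.
  - by apply: nbhs_right_lt; rewrite divr_gt0.
have E := fg _ (test_fun_pulse h0 (ltW ab)); rewrite derive1_pulse// in E.
have kc (c : R) : continuous (fun x => hat h (x - c)) by exact: continuous_hat.
have kb (c x : R) : `|hat h (x - c)| <= h^-1 by rewrite ger0_norm ?hat_ge0// hat_le.
have i1 := loc_int_bounded (a - 1) (b + 1) lf (kc a) (kb a).
have i2 := loc_int_bounded (a - 1) (b + 1) lf (kc b) (kb b).
have E1 : (\int[mu]_x (f x * (hat h (x - a) - hat h (x - b))))%R =
    (\int[mu]_(x in K) (f x * hat h (x - a)))%R -
    (\int[mu]_(x in K) (f x * hat h (x - b)))%R.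
  rewrite -RintegralB//.
  rewrite (@Rintegral_support _ K); first by apply: eq_Rintegral => x _; rewrite mulrBr.
  move=> x; rewrite /K/= in_itv/= => /negP; rewrite negb_and -!ltNge => /orP[].
    move: ab h0 h1; clear => ab h0 h1 xa.
    by rewrite !hat_out ?subrr ?mulr0//; rewrite ler0_norm; lra.
  move: ab h0 h1; clear => ab h0 h1 xa.
  by rewrite !hat_out ?subrr ?mulr0//; rewrite ger0_norm; lra.
have B (c : R) : a <= c -> c <= b -> (davg f c h < (e / 8)%:E)%E ->
    `|(\int[mu]_(x in K) (f x * hat h (x - c)))%R - f c| <= e / 4.
  move=> ac cb hc; have := @integral_hat_le f h c (a - 1) (b + 1) lf mf h0.
  have H1 : a - 1 <= c - h by move: ac h1; clear; lra.
  have H2 : c + h <= b + 1 by move: cb h1; clear; lra.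
  move=> /(_ H1 H2) H; rewrite -lee_fin; apply: (le_trans H).
  rewrite (_ : e / 4 = 2 * (e / 8)); last by field.
  by rewrite EFinM lee_pmul2l// ltW.
have Ba := B _ (lexx a) (ltW ab) ha; have Bb := B _ (ltW ab) (lexx b) hb.
have Bg : `|(\int[mu]_x (g x * pulse h a b x))%R - (\int[mu]_(x in `[a, b]) g x)%R| <= e / 4.
  apply: le_trans (pulse_approx ab h0 h1 lg) _.
  have -> : e / 4 = 2 * (e / 8) by field.
  rewrite ler_pM2l//; apply/ltW/Gd => //; first exact: measurableU.
  apply: lt_trans (measure_ball_nbhd a b h0) _.
  by rewrite lte_fin; move: hd; clear; lra.
move: E Ba Bb Bg; rewrite E1; clear.
set x1 := (\int[mu]_(_ in K) _)%R; set x2 := (\int[mu]_(_ in K) _)%R.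
set x3 := (\int[mu]_(_ in setT) _)%R; set x4 := (\int[mu]_(_ in `[a, b]) _)%R.
move: x1 x2 x3 x4 (f a) (f b) => x1 x2 x3 x4 fa fb.
rewrite !ler_norml => ? /andP[? ?] /andP[? ?] /andP[? ?].
by apply/andP; split; lra.
Unshelve. all: by end_near. Qed.

End weak_ftc.

(** * Continuous representatives of weakly differentiable functions *)

Section regular_representative.
Context {R : realType}.
Local Notation mu := (@lebesgue_measure R).
Implicit Types (f g h : R -> R) (x : R).

Lemma Rintegral_itv_cat g (a b c : R) : loc_int g -> a <= b -> b <= c ->
  (\int[mu]_(x in `[a, c]) g x = \int[mu]_(x in `[a, b]) g x + \int[mu]_(x in `[b, c]) g x)%R.
Proof.
move=> lg ab bc.
rewrite -[X in _ = _ + X]Rintegral_itv_obnd_cbnd; last first.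
  apply: integrableS (lg b c) => //.
  by apply: subset_itvr; rewrite bnd_simp.
rewrite -(@Rintegral_itvB _ _ (BLeft a) (BRight c) b) ?bnd_simp//.
by rewrite addrC subrK.
Qed.

(** The signed integral from 0 to x: at least one of the two terms always vanishes, its interval
    being empty or reduced to a point. *)
Definition prim g x : R :=
  (\int[mu]_(y in `[0, x]) g y)%R - (\int[mu]_(y in `[x, 0]) g y)%R.

Lemma Rintegral_itv_gt g (a b : R) : b <= a -> (\int[mu]_(y in `[a, b]) g y = 0)%R.
Proof.
rewrite le_eqVlt => /predU1P[->|ba]; first by rewrite set_itv1 Rintegral_set1.
by rewrite set_itv_ge ?bnd_simp -?ltNge// Rintegral_set0.
Qed.

Lemma primB g (a b : R) : loc_int g -> a <= b ->
  prim g b - prim g a = (\int[mu]_(x in `[a, b]) g x)%R.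
Proof.
move=> lg ab; rewrite /prim.
have [a0|a0] := leP 0 a.
  rewrite (@Rintegral_itv_gt g b 0) ?(@Rintegral_itv_gt g a 0)// ?(le_trans a0)//.
  by rewrite (Rintegral_itv_cat lg a0 ab); ring.
have [b0|b0] := leP 0 b.
  rewrite (@Rintegral_itv_gt g b 0)// (@Rintegral_itv_gt g 0 a) ?(ltW a0)//.
  by rewrite (Rintegral_itv_cat lg (ltW a0) b0); ring.
rewrite (@Rintegral_itv_gt g 0 b) ?(ltW b0)// (@Rintegral_itv_gt g 0 a) ?(ltW a0)//.
by rewrite (Rintegral_itv_cat lg ab (ltW b0)); ring.
Qed.

(** Absolute continuity of the integral of |g|, applied after cutting g off outside [x - 1, x + 1],
    since g is only locally integrable. *)
Lemma continuous_increment f g : loc_int g ->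
  (forall a b : R, a < b -> f b - f a = (\int[mu]_(x in `[a, b]) g x)%R) ->
  continuous f.
Proof.
move=> lg fg x; apply/cvgrPdist_le => /= e e0.
have iG : mu.-integrable setT (EFin \o (g \_ `[x - 1, x + 1])).
  by apply: integrable_patch => //; exact: lg.
have [d [d0 Gd]] := integral_normr_continuous iG e0.
have H (a b : R) : a < b -> b - a < d -> x - 1 <= a -> b <= x + 1 ->
    `|f b - f a| <= e.
  move=> ab bad xa bx; rewrite fg//.
  apply: le_trans; first by apply: le_normr_Rintegral => //; exact: lg.
  have E : (\int[mu]_(t in `[a, b]) `|g t| = \int[mu]_(t in `[a, b]) `|(g \_ `[(x - 1)%R, (x + 1)%R]) t|)%R.
    apply: eq_Rintegral => y; rewrite inE/= in_itv/= => /andP[ay yb].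
    by rewrite patchE ifT// inE/= in_itv/= (le_trans xa ay) (le_trans yb bx).
  have M : (mu (`[a, b]%classic : set R) < d%:E)%E.
    by rewrite lebesgue_measure_itv/= lte_fin ab -EFinD lte_fin.
  by rewrite E; apply/ltW/Gd.
near=> y; rewrite distrC.
have y1 : `|x - y| < 1 by near: y; apply: cvgr_dist_lt => //; exact: cvg_id.
have yd : `|x - y| < d by near: y; apply: cvgr_dist_lt => //; exact: cvg_id.
have [xy|yx|<-] := ltgtP x y; last by rewrite subrr normr0 ltW.
- move: y1 yd; rewrite (distrC x y) (@gtr0_norm _ (y - x)) ?subr_gt0// => y1 yd.
  by apply: H => //; [rewrite lerBlDr lerDl|rewrite -lerBlDl ltW].
- move: y1 yd; rewrite (@gtr0_norm _ (x - y)) ?subr_gt0// => y1 yd.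
  by rewrite distrC; apply: H => //; [rewrite lerBlDr -lerBlDl ltW|rewrite lerDl].
Unshelve. all: by end_near. Qed.

(** The indefinite integral of g, anchored at one Lebesgue point of f, agrees with f at all Lebesgue
    points, hence almost everywhere. Such an anchor exists because [0, 1] has positive measure, so
    that a set of full measure is nonempty. *)
Lemma weak_derivative_repr f g : inL2 f -> inL2 g -> weak_derivative f g ->
  exists2 h, continuous h & {ae mu, forall x, h x = f x}.
Proof.
move=> f2 g2 fg; have lg := inL2_loc_int g2.
have L := inL2_ae_lebesgue_pt f2.
have [x0 Lx0] : exists x0, lebesgue_pt f x0.
  apply: (@filter_ex _ (almost_everywhere mu)) => //.
  apply: ae_properfilter_algebraOfSetsType.
  have M : (0 < mu (`[0%R, 1%R]%classic : set R))%E.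
    by rewrite lebesgue_measure_itv/= lte_fin ltr01 -EFinD subr0 lte_fin ltr01.
  by apply: lt_le_trans M _; apply: le_measure => //; rewrite inE.
exists (fun x => f x0 + (prim g x - prim g x0)).
  apply: (@continuous_increment _ g) => // a b ab.
  by rewrite -(primB lg (ltW ab)); ring.
apply: filterS L => [|x Lx]; first exact: (ae_filter_ringOfSetsType mu).
have [xx|xx|->] := ltgtP x x0; last by rewrite subrr addr0.
- by rewrite -[prim g x - _]opprB (primB lg (ltW xx)) (weak_derivative_ftc xx f2 g2 fg)//; ring.
- by rewrite (primB lg (ltW xx)) (weak_derivative_ftc xx f2 g2 fg)//; ring.
Qed.

Lemma ftc_is_derive f g : continuous g ->
  (forall a b : R, a < b -> f b - f a = (\int[mu]_(x in `[a, b]) g x)%R) ->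
  forall x, is_derive x 1 f (g x).
Proof.
move=> cg fg x.
have ig (a b : R) : mu.-integrable `[a, b] (EFin \o g).
  by apply: continuous_compact_integrable; [exact: segment_compact|exact: continuous_subspaceT].
have x2 : x < x + 1 by rewrite ltrDl.
have [] := @continuous_FTC1_closed _ g (x - 1) x (x + 1) x2 (ig _ _) _ (cg x).
  by rewrite ltrBlDr ltrDl.
set F := (fun y : R => _) => dF F'.
have dF' : is_derive x 1 F (g x) by apply: DeriveDef; [exact: dF|rewrite -derive1E].
have /is_derive_epsP H := dF'.
apply/is_derive_epsP => e e0; have [r r0 Hr] := H e e0.
exists (Num.min r 1); first by rewrite lt_min r0 ltr01.
move=> k; rewrite lt_min => /andP[kr k1]; have := Hr k kr.
suff -> : f (x + k) - f x = F (x + k) - F x by [].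
have E y : x - 1 < y -> F y = f y - f (x - 1) by move=> xy; rewrite fg.
rewrite !E ?ltrD2l//; first by ring.
  by rewrite ltrBlDr ltrDl.
by have := ler_norm (- k); rewrite normrN; move: k1; clear; lra.
Qed.

End regular_representative.

(** * Classical derivatives and Sobolev embedding *)

Section smooth.
Context {R : realType}.
Local Notation mu := (@lebesgue_measure R).
Implicit Types (f g h : R -> R) (x B : R).

(** One constant bounds f and its classical derivatives up to order q both in sup norm and in L^2.
    The two belong together: the L^2 norm of a product is the sup norm of one factor times the L^2
    norm of the other, so the class is stable under all operations of [dpoly]. *)
Fixpoint smooth (q : nat) (B : R) (f : R -> R) : Prop :=
  [/\ continuous f, forall x, `|f x| <= B, (sqint f <= (B ^+ 2)%:E)%E &
    if q is q'.+1 then (forall x, derivable f x 1) /\ smooth q' B (derive1 f) else True].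

Lemma Rintegral_norm_le_sqint g (b x y : R) : inL2 g -> (sqint g <= b%:E)%E ->
  x <= y -> y <= x + 1 -> (\int[mu]_(t in `[x, y]) `|g t|)%R <= 1 + b.
Proof.
move=> g2 gb xy yx; have [mg _] := g2.
have lg := inL2_loc_int g2.
have b0 : 0 <= b by rewrite -lee_fin; apply: le_trans (sqint_ge0 g) gb.
have i2 : mu.-integrable setT (EFin \o (fun t => g t ^+ 2)).
  apply/integrableP; split; first by apply/measurable_EFinP; exact: measurable_funX.
  apply: le_lt_trans (ltry b); apply: le_trans gb; rewrite /sqint.
  by rewrite le_eqVlt; apply/orP; left; apply/eqP/eq_integral => t _; rewrite /= ger0_norm ?sqr_ge0.
have i2' : mu.-integrable `[x, y] (EFin \o (fun t => g t ^+ 2)).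
  exact: integrableS i2.
have i1 : mu.-integrable `[x, y] (EFin \o cst (1 : R)).
  apply: continuous_compact_integrable; first exact: segment_compact.
  by apply: continuous_subspaceT => t; exact: cvg_cst.
apply: (@le_trans _ _ (\int[mu]_(t in `[x, y]) (1 + g t ^+ 2))%R).
  apply: le_Rintegral => //; first by apply: integrable_norm; exact: lg.
    exact: (integrableD _ i1 i2').
  move=> t _; have := sqr_ge0 (`|g t| - 1).
  rewrite sqrrB real_normK ?num_real//; have := normr_ge0 (g t).
  by clear; lra.
have M : fine (mu (`[x, y]%classic : set R)) <= 1.
  rewrite lebesgue_measure_itv/= lte_fin.
  by case: ifP => _ //=; move: yx; clear; lra.
rewrite RintegralD// Rintegral_cst// mul1r; apply: lerD; first exact: M.
rewrite -lee_fin; apply: le_trans gb; rewrite /Rintegral fineK; last exact: integrable_fin_num.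
apply: ge0_subset_integral => //; first by case/integrableP : i2.
by move=> t _; rewrite lee_fin sqr_ge0.
Qed.

(** The one-dimensional Sobolev embedding. Somewhere in [x, x + 1] one has f^2 <= b + 1, for
    otherwise the integral of f^2 would exceed b; there |f| <= b + 2. On the way back to x, f
    changes by at most the integral of |g| <= 1 + g^2, which is at most 1 + b. *)
Lemma increment_bounded f g (b : R) : continuous f -> inL2 g ->
  (sqint f <= b%:E)%E -> (sqint g <= b%:E)%E ->
  (forall a b : R, a < b -> f b - f a = (\int[mu]_(x in `[a, b]) g x)%R) ->
  forall x, `|f x| <= 2 * b + 3.
Proof.
move=> cf g2 fb gb fg x.
have b0 : 0 <= b by rewrite -lee_fin; apply: le_trans (sqint_ge0 f) fb.
have [y [xy yx fy]] : exists y, [/\ x <= y, y <= x + 1 & f y ^+ 2 <= b + 1].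
  apply: contrapT => H.
  have {}H y : x <= y -> y <= x + 1 -> b + 1 <= f y ^+ 2.
    by move=> xy yx; rewrite leNgt; apply/negP => /ltW K; apply: H; exists y.
  have mf2 : measurable_fun setT (fun t => (f t ^+ 2)%:E : \bar R).
    by apply/measurable_EFinP; apply: measurable_funX; exact: continuous_measurable_fun.
  suff : ((b + 1)%:E <= b%:E)%E by rewrite lee_fin; clear; lra.
  apply: le_trans fb.
  have M : mu (`[x, x + 1]%classic : set R) = 1%E.
    by rewrite lebesgue_measure_itv/= lte_fin ltrDl ltr01 -EFinD addrAC subrr add0r.
  apply: (@le_trans _ _ (\int[mu]_(t in `[x, (x + 1)%R]) (f t ^+ 2)%:E)%E).
    rewrite (_ : (b + 1)%:E = (\int[mu]_(t in `[x, (x + 1)%R]) (b + 1)%:E)%E); last first.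
      rewrite integral_cst//; transitivity ((b + 1)%:E * 1)%E; first by rewrite mule1.
      by congr (_ * _)%E; rewrite -M.
    apply: ge0_le_integral => //.
    - by move=> t _; rewrite lee_fin addr_ge0.
    - exact: measurable_funTS.
    - by move=> t; rewrite /= in_itv/= => /andP[xt tx]; rewrite lee_fin H.
  by apply: ge0_subset_integral => // t _; rewrite lee_fin sqr_ge0.
have fy' : `|f y| <= b + 2.
  move: fy; rewrite -[f y ^+ 2]real_normK ?num_real// => fy.
  have := sqr_ge0 (`|f y| - 1); have := normr_ge0 (f y).
  move: fy; rewrite sqrrB; clear -b0; move: (`|f y|) => t; nra.
have I : `|f y - f x| <= 1 + b.
  move: xy; rewrite le_eqVlt => /predU1P[->|xy]; first by rewrite subrr normr0 addr_ge0.
  rewrite fg//; apply: le_trans; first by apply: le_normr_Rintegral => //; exact: inL2_loc_int.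
  by apply: Rintegral_norm_le_sqint => //; exact: ltW.
rewrite (_ : f x = f y - (f y - f x)); last by ring.
apply: le_trans (ler_normB _ _) _.
by move: I fy'; clear; lra.
Qed.

Lemma ae_eq_sqint f h : measurable_fun setT f -> measurable_fun setT h ->
  {ae mu, forall x, h x = f x} -> sqint h = sqint f.
Proof.
move=> mf mh hf; apply: ge0_ae_eq_integral => //.
- by apply/measurable_EFinP; exact: measurable_funX.
- by apply/measurable_EFinP; exact: measurable_funX.
- by move=> x _; rewrite lee_fin sqr_ge0.
- by move=> x _; rewrite lee_fin sqr_ge0.
- by apply: filterS hf => [|x -> _//]; exact: (ae_filter_ringOfSetsType mu).
Qed.

(** Every point is a Lebesgue point of a continuous function, so the almost everywhere identity
    holds at all endpoints. *)
Lemma weak_derivative_continuous_ftc f g : continuous f -> inL2 f -> inL2 g ->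
  weak_derivative f g ->
  forall a b : R, a < b -> f b - f a = (\int[mu]_(x in `[a, b]) g x)%R.
Proof.
move=> cf f2 g2 fg a b ab.
have L x : lebesgue_pt f x.
  apply: (@continuous_lebesgue_pt _ f x setT) => //; last exact: cf.
    by split => //; exact: openT.
  exact: continuous_measurable_fun.
by rewrite (weak_derivative_ftc ab f2 g2 fg).
Qed.

(** The continuous representative of the first weak derivative is the classical derivative of f, and
    the induction continues with it. One order is lost because a sup bound for a function uses an
    L^2 bound for its derivative. *)
Lemma weak_jet_smooth (q : nat) (b : R) f (g : nat -> R -> R) : continuous f ->
  weak_jet q.+1 f g -> (forall i, (i <= q.+1)%N -> (sqint (g i) <= b%:E)%E) ->
  smooth q (2 * b + 3) f.
Proof.
have P (h : R -> R) k : continuous h -> inL2 h -> inL2 k -> weak_derivative h k ->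
    (sqint h <= b%:E)%E -> (sqint k <= b%:E)%E ->
    [/\ continuous h, forall x, `|h x| <= 2 * b + 3 & (sqint h <= ((2 * b + 3) ^+ 2)%:E)%E].
  move=> ch h2 k2 hk hb kb; split => //.
    by apply: (@increment_bounded h k) => //; exact: weak_derivative_continuous_ftc.
  have b0 : 0 <= b by rewrite -lee_fin; apply: le_trans (sqint_ge0 h) hb.
  by apply: le_trans hb _; rewrite lee_fin; move: b0; clear; nra.
elim: q f g => [|q IH] f g cf [g0 gL2 gW] gb; subst f.
  by have [*] := P _ (g 1%N) cf (gL2 0%N isT) (gL2 1%N isT) (gW 0%N isT) (gb 0%N isT) (gb 1%N isT).
have [c1 c2 c3] := P _ (g 1%N) cf (gL2 0%N isT) (gL2 1%N isT) (gW 0%N isT) (gb 0%N isT) (gb 1%N isT).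
have [h ch hg] := weak_derivative_repr (gL2 1%N isT) (gL2 2%N isT) (gW 1%N isT).
have mh : measurable_fun setT h by exact: continuous_measurable_fun.
have [mg1 _] := gL2 1%N isT.
have sh : sqint h = sqint (g 1%N) by exact: ae_eq_sqint.
have h2 : inL2 h.
  split => //; rewrite L2normE sh -L2normE; by case: (gL2 1%N isT).
have aeI (D : set R) (p : R -> R) : measurable D -> continuous p ->
    (\int[mu]_(x in D) (h x * p x) = \int[mu]_(x in D) (g 1%N x * p x))%R.
  move=> mD cp; congr fine; apply: ae_eq_integral => //.
  - apply/measurable_EFinP; apply: measurable_funTS; apply: measurable_funM => //.
    exact: continuous_measurable_fun.
  - apply/measurable_EFinP; apply: measurable_funTS; apply: measurable_funM => //.
    exact: continuous_measurable_fun.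
  - by apply: filterS hg => [|x -> _//]; exact: (ae_filter_ringOfSetsType mu).
have dg x : is_derive x 1 (g 0%N) (h x).
  apply: ftc_is_derive => // c d cd.
  rewrite (weak_derivative_continuous_ftc cf (gL2 0%N isT) (gL2 1%N isT) (gW 0%N isT) cd).
  have /= := aeI `[c, d]%classic (cst 1).
  move=> /(_ (measurable_itv _) (fun=> cvg_cst _)) H.
  transitivity (\int[mu]_(x in `[c, d]) (g 1%N x * 1))%R.
    by apply: eq_Rintegral => y _; rewrite mulr1.
  by rewrite -H; apply: eq_Rintegral => y _; rewrite mulr1.
have dE : derive1 (g 0%N) = h by apply/funext => x; rewrite derive1E; apply: derive_val.
split => //; split => [x|]; first exact: ex_derive.
(* The shifted jet starts with h in place of [g 1]. It remains a jet, as weak derivatives see [g 1]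
   only through integrals. *)
rewrite dE; apply: (IH h (fun i => if i is 0%N then h else g i.+1)) => //.
- split => //.
  + by case=> [|i] iq //; apply: gL2.
  + case=> [|i] iq; last by apply: gW.
    move=> p tp; have := gW 1%N isT p tp; rewrite -/(g 2%N) => <-.
    by case: tp => _ cp _; apply: aeI.
- case=> [|i] iq; first by rewrite sh; exact: gb.
  exact: gb.
Qed.

Lemma Hnorm_ge0 (s : nat) f : (0 <= Hnorm s f)%E.
Proof. by apply: le_ereal_inf_tmp => _ [g _ <-]; rewrite lee_fin sqrtr_ge0. Qed.

(** Passing to B + 1 yields an actual jet below the bound without knowing that the infimum is
    attained; the constant is 2 b + 3 with b = (B + 1)^2. *)
Lemma Hnorm_smooth (q s : nat) B f : (q < s)%N -> continuous f ->
  (Hnorm s f <= B%:E)%E -> smooth q (2 * (B + 1) ^+ 2 + 3) f.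
Proof.
move=> qs cf HB.
have : (Hnorm s f < (B + 1)%:E)%E by apply: le_lt_trans HB _; rewrite lte_fin ltrDl.
move=> /ereal_inf_lt[_ [g [g0 gL2 gW] <-]]; rewrite lte_fin => gB.
have B0 : 0 <= B + 1 by apply: le_trans (sqrtr_ge0 _) (ltW gB).
apply: (@weak_jet_smooth q _ f g) => //.
- split => // i iq; [apply: gL2|apply: gW]; first exact: leq_trans iq qs.
  exact: leq_trans iq qs.
- move=> i iq; have is1 : (i < s.+1)%N by rewrite ltnS (leq_trans iq).
  rewrite -L2norm_le//.
  have [_ fin] := gL2 i is1.
  have n0 : (0 <= L2norm (g i))%E by rewrite L2normE; exact: poweR_ge0.
  rewrite -(@fineK _ (L2norm (g i))) ?ge0_fin_numE// lee_fin.
  rewrite -(@ler_sqr _ (fine _)) ?nnegrE ?fine_ge0//.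
  apply: le_trans (_ : (\sum_(i < s.+1) fine (L2norm (g i)) ^+ 2) <= _).
    rewrite (bigD1 (Ordinal is1))//= lerDl; apply: sumr_ge0 => j _; exact: sqr_ge0.
  rewrite -[leLHS]sqr_sqrtr; last by apply: sumr_ge0 => j _; exact: sqr_ge0.
  by rewrite ler_sqr ?nnegrE ?sqrtr_ge0// ltW.
Qed.

End smooth.

(** * Algebra of smooth functions and Taylor estimates *)

Section smooth_algebra.
Context {R : realType}.
Local Notation mu := (@lebesgue_measure R).
Implicit Types (f g : R -> R) (x A B : R).

Lemma derive1_add f g x : derivable f x 1 -> derivable g x 1 ->
  derivable (fun y => f y + g y) x 1 /\
  derive1 (fun y => f y + g y) x = derive1 f x + derive1 g x.
Proof.
move=> /derivableP df /derivableP dg.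
have D : is_derive x 1 (fun y => f y + g y) ('D_1 f x + 'D_1 g x).
  exact: is_deriveD.
by split; [exact: ex_derive|rewrite !derive1E; exact: derive_val].
Qed.

Lemma derive1_scale (a : R) f x : derivable f x 1 ->
  derivable (fun y => a * f y) x 1 /\
  derive1 (fun y => a * f y) x = a * derive1 f x.
Proof.
move=> /derivableP df.
have D : is_derive x 1 (fun y => a * f y) (a * 'D_1 f x) by exact: is_deriveZ.
by split; [exact: ex_derive|rewrite !derive1E; exact: derive_val].
Qed.

Lemma derive1_mul f g x : derivable f x 1 -> derivable g x 1 ->
  derivable (fun y => f y * g y) x 1 /\
  derive1 (fun y => f y * g y) x = derive1 f x * g x + f x * derive1 g x.
Proof.
move=> /derivableP df /derivableP dg.
have D : is_derive x 1 (fun y => f y * g y) (f x *: 'D_1 g x + g x *: 'D_1 f x).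
  exact: is_deriveM.
split; [exact: ex_derive|rewrite !derive1E derive_val].
by rewrite /GRing.scale/=; ring.
Qed.

Lemma smooth_ge0 q B f : smooth q B f -> 0 <= B.
Proof. by case: q => [|q] [_ H _ _]; apply: le_trans (H 0). Qed.

Lemma smooth_continuous q B f : smooth q B f -> continuous f.
Proof. by case: q => [|q] []. Qed.

Lemma smooth_bound q B f : smooth q B f -> forall x, `|f x| <= B.
Proof. by case: q => [|q] []. Qed.

Lemma smooth_sqint q B f : smooth q B f -> (sqint f <= (B ^+ 2)%:E)%E.
Proof. by case: q => [|q] []. Qed.

Lemma smooth_derivable q B f : smooth q.+1 B f -> forall x, derivable f x 1.
Proof. by case=> _ _ _ []. Qed.

Lemma smooth_derive1 q B f : smooth q.+1 B f -> smooth q B (derive1 f).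
Proof. by case=> _ _ _ []. Qed.

Lemma smooth_le q A B f : A <= B -> smooth q A f -> smooth q B f.
Proof.
move=> AB; elim: q f => [|q IH] f S; have A0 := smooth_ge0 S.
  case: S => cf fA iA _; split => // [x|]; first exact: le_trans (fA x) AB.
  by apply: le_trans iA _; rewrite lee_fin ler_sqr ?nnegrE// (le_trans A0).
case: S => cf fA iA [df sf]; split => // [x| |]; first exact: le_trans (fA x) AB.
  by apply: le_trans iA _; rewrite lee_fin ler_sqr ?nnegrE// (le_trans A0).
by split => //; exact: IH.
Qed.

Lemma smooth_leq q r B f : (r <= q)%N -> smooth q B f -> smooth r B f.
Proof.
elim: r q f => [|r IH] [|q] f //; first by move=> _ [? ? ? _]; split.
by rewrite ltnS => rq [? ? ? [df sf]]; split => //; split => //; exact: IH sf.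
Qed.

Let measurable_sqr f : continuous f -> measurable_fun setT (fun x => (f x ^+ 2)%:E : \bar R).
Proof.
move=> cf; apply/measurable_EFinP; apply: measurable_funX.
exact: continuous_measurable_fun.
Qed.

(** The factor 2 comes from the L^2 part, where (h + k)^2 <= 2 h^2 + 2 k^2. It does not grow with q,
    since differentiation keeps the form of a sum. *)
Lemma smooth_add q A B f g : smooth q A f -> smooth q B g ->
  smooth q (2 * (A + B)) (fun x => f x + g x).
Proof.
have P h k : continuous h -> continuous k -> 0 <= A -> 0 <= B ->
    (forall x, `|h x| <= A) -> (forall x, `|k x| <= B) ->
    (sqint h <= (A ^+ 2)%:E)%E -> (sqint k <= (B ^+ 2)%:E)%E ->
    [/\ continuous (fun x => h x + k x), forall x, `|h x + k x| <= 2 * (A + B)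
      & (sqint (fun x => h x + k x)%R <= ((2 * (A + B)) ^+ 2)%:E)%E].
  move=> ch ck A0 B0 hA kB ih ik.
  have c : continuous (fun x => h x + k x) by move=> x; apply: cvgD; [exact: ch|exact: ck].
  split => // [x|].
    apply: le_trans (ler_normD _ _) _; have := hA x; have := kB x.
    by move: A0 B0; clear; move: (`|h x|) (`|k x|) => *; lra.
  apply: (@le_trans _ _ (\int[mu]_x ((2%:E * (h x ^+ 2)%:E) + (2%:E * (k x ^+ 2)%:E)))%E).
    apply: ge0_le_integral => //; first by move=> x _; rewrite lee_fin sqr_ge0.
    - exact: measurable_sqr.
    - apply: emeasurable_funD; apply: emeasurable_funM => //; exact: measurable_sqr.
    - move=> x _; rewrite lee_fin; have := sqr_ge0 (h x - k x).
      by clear; move: (h x) (k x) => u v; rewrite sqrrB sqrrD; lra.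
  rewrite ge0_integralD//.
  - rewrite !ge0_integralZl//; try exact: measurable_sqr; try by move=> x _; rewrite lee_fin sqr_ge0.
    apply: (@le_trans _ _ (2%:E * (A ^+ 2)%:E + 2%:E * (B ^+ 2)%:E)%E).
      by apply: leeD; apply: lee_wpmul2l; rewrite ?lee_fin.
    by rewrite -!EFinM -EFinD lee_fin; move: A0 B0; clear; nra.
  - by move=> x _; rewrite lee_fin mulr_ge0// sqr_ge0.
  - by apply: emeasurable_funM => //; exact: measurable_sqr.
  - by move=> x _; rewrite lee_fin mulr_ge0// sqr_ge0.
  - by apply: emeasurable_funM => //; exact: measurable_sqr.
elim: q f g => [|q IH] f g Sf Sg; have A0 := smooth_ge0 Sf; have B0 := smooth_ge0 Sg.
  by case: Sf Sg => ? ? ? _ [? ? ? _]; have [] := P f g.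
case: Sf Sg => cf bf iF [df sf] [cg bg ig [dg sg]].
have [c b i] := P f g cf cg A0 B0 bf bg iF ig; split; [exact: c|exact: b|exact: i|split].
  by move=> x; have [] := derive1_add (df x) (dg x).
rewrite (_ : derive1 _ = (fun x => derive1 f x + derive1 g x)); first exact: IH.
by apply/funext => x; have [] := derive1_add (df x) (dg x).
Qed.

Lemma smooth_scale (a : R) q A f : smooth q A f -> smooth q (`|a| * A) (fun x => a * f x).
Proof.
have P h : continuous h -> (forall x, `|h x| <= A) -> (sqint h <= (A ^+ 2)%:E)%E ->
    [/\ continuous (fun x => a * h x), forall x, `|a * h x| <= `|a| * A
      & (sqint (fun x => a * h x)%R <= ((`|a| * A) ^+ 2)%:E)%E].
  move=> ch hA ih; split => [x|x|].
  - by apply: cvgM; [exact: cvg_cst|exact: ch].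
  - by rewrite normrM ler_wpM2l.
  have E x : ((a * h x) ^+ 2)%:E = ((a ^+ 2)%:E * (h x ^+ 2)%:E)%E by rewrite exprMn.
  rewrite /sqint; under eq_integral do rewrite E.
  rewrite ge0_integralZl//; last 3 first.
  - exact: measurable_sqr.
  - by move=> x _; rewrite lee_fin sqr_ge0.
  - by rewrite lee_fin sqr_ge0.
  have -> : ((`|a| * A) ^+ 2)%:E = ((a ^+ 2)%:E * (A ^+ 2)%:E)%E.
    by rewrite exprMn real_normK ?num_real.
  by apply: lee_wpmul2l; [rewrite lee_fin sqr_ge0|].
elim: q f => [|q IH] f S.
  by case: S => ? ? ? _; have [] := P f.
case: S => cf bf iF [df sf]; have [c b i] := P f cf bf iF.
split; [exact: c|exact: b|exact: i|split].
  by move=> x; have [] := derive1_scale a (df x).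
rewrite (_ : derive1 _ = (fun x => a * derive1 f x)); first exact: IH.
by apply/funext => x; have [] := derive1_scale a (df x).
Qed.

(** Each derivative splits the product into two by the Leibniz rule, and adding these costs another
    factor 2: hence 4 per order. *)
Lemma smooth_mul q A B f g : smooth q A f -> smooth q B g ->
  smooth q (4 ^+ q * (A * B)) (fun x => f x * g x).
Proof.
have P k h1 h2 : smooth k A h1 -> smooth k B h2 ->
    [/\ continuous (fun x => h1 x * h2 x), forall x, `|h1 x * h2 x| <= 4 ^+ k * (A * B)
      & (sqint (fun x => h1 x * h2 x)%R <= ((4 ^+ k * (A * B)) ^+ 2)%:E)%E].
  move=> S1 S2; have A0 := smooth_ge0 S1; have B0 := smooth_ge0 S2.
  have c1 := smooth_continuous S1; have c2 := smooth_continuous S2.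
  have b1 := smooth_bound S1; have b2 := smooth_bound S2.
  have k1 : 1 <= 4 ^+ k :> R by rewrite exprn_ege1// ler1n.
  have AB : A * B <= 4 ^+ k * (A * B) by rewrite ler_peMl// mulr_ge0.
  split => [x|x|].
  - by apply: cvgM; [exact: c1|exact: c2].
  - by rewrite normrM (le_trans _ AB)// ler_pM.
  apply: (@le_trans _ _ (\int[mu]_x ((A ^+ 2)%:E * (h2 x ^+ 2)%:E))%E).
    apply: ge0_le_integral => //.
    - by move=> x _; rewrite lee_fin sqr_ge0.
    - by apply: measurable_sqr => x; apply: cvgM; [exact: c1|exact: c2].
    - by apply: emeasurable_funM => //; exact: measurable_sqr.
    - move=> x _; rewrite lee_fin exprMn ler_wpM2r ?sqr_ge0//.
      by rewrite -(@real_normK _ (h1 x)) ?num_real// ler_sqr ?nnegrE.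
  rewrite ge0_integralZl//; last 3 first.
  - exact: measurable_sqr.
  - by move=> x _; rewrite lee_fin sqr_ge0.
  - by rewrite lee_fin sqr_ge0.
  apply: (@le_trans _ _ ((A * B) ^+ 2)%:E).
    have -> : ((A * B) ^+ 2)%:E = ((A ^+ 2)%:E * (B ^+ 2)%:E)%E by rewrite exprMn.
    by apply: lee_wpmul2l; [rewrite lee_fin sqr_ge0|exact: smooth_sqint S2].
  by rewrite lee_fin ler_sqr ?nnegrE ?mulr_ge0// exprn_ge0.
elim: q f g => [|q IH] f g Sf Sg; first by have [] := P _ _ _ Sf Sg.
have [? ? ?] := P _ _ _ Sf Sg; split => //.
have df := smooth_derivable Sf; have dg := smooth_derivable Sg.
split; first by move=> x; have [] := derive1_mul (df x) (dg x).
rewrite (_ : derive1 _ = (fun x => derive1 f x * g x + f x * derive1 g x)); last first.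
  by apply/funext => x; have [] := derive1_mul (df x) (dg x).
have S1 := IH _ _ (smooth_derive1 Sf) (smooth_leq (leqnSn q) Sg).
have S2 := IH _ _ (smooth_leq (leqnSn q) Sf) (smooth_derive1 Sg).
by have := smooth_add S1 S2; rewrite (_ : 2 * _ = 4 ^+ q.+1 * (A * B))// exprS; ring.
Qed.

Lemma smooth_lipschitz q B f : smooth q.+1 B f -> forall x y : R, `|f x - f y| <= B * `|x - y|.
Proof.
move=> S x y; wlog xy : x y / y <= x.
  move=> H; have [|/ltW] := leP y x; first exact: H.
  by rewrite distrC (distrC x); exact: H.
have df := smooth_derivable S.
have df' (z : R) : is_derive z 1 f (derive1 f z) by rewrite derive1E; apply: derivableP.
have cf : {within `[y, x], continuous f}.
  by apply: continuous_subspaceT; exact: smooth_continuous S.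
have [z _ ->] := MVT_segment xy (fun z _ => df' z) cf.
by rewrite normrM ler_wpM2r//; exact: smooth_bound (smooth_derive1 S) z.
Qed.

(** Mean value theorem for f y - f'(x) y, followed by the Lipschitz bound on f'. The remainder
    depends on f through B alone, hence is uniform over families with a common bound. *)
Lemma smooth_taylor q B f : smooth q.+2 B f -> forall x h : R,
  `|f (x + h) - f x - h * derive1 f x| <= B * `|h| ^+ 2.
Proof.
move=> S x h; have B0 := smooth_ge0 S.
pose F (y : R) := f y - derive1 f x * y.
have dF (y : R) : is_derive y 1 F (derive1 f y - derive1 f x).
  have d1 : is_derive y 1 f (derive1 f y).
    by rewrite derive1E; apply: derivableP; exact: smooth_derivable S y.
  have d2 : is_derive y 1 (fun z : R => derive1 f x * z) (derive1 f x * 1).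
    exact: (@is_deriveZ _ _ _ id (derive1 f x) y 1 1).
  by rewrite -[X in _ - X]mulr1; exact: is_deriveB.
have cF : continuous F.
  by move=> y; apply: differentiable_continuous; apply/derivable1_diffP; case: (dF y).
have E : f (x + h) - f x - h * derive1 f x = F (x + h) - F x by rewrite /F; ring.
have L := smooth_lipschitz (smooth_derive1 S).
have MV (a b : R) : a <= b -> exists2 c, a <= c <= b &
    F b - F a = (derive1 f c - derive1 f x) * (b - a).
  move=> ab; apply: (MVT_segment ab (fun y _ => dF y)).
  exact: continuous_subspaceT.
rewrite E; have [h0|h0] := leP 0 h.
  have xh : x <= x + h by rewrite lerDl.
  have [z /andP[xz zx] ->] := MV _ _ xh.
  rewrite addrAC subrr add0r normrM expr2 mulrA ler_wpM2r//.
  apply: le_trans (L _ _) _; rewrite ler_wpM2l// !ger0_norm ?subr_ge0//.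
  by rewrite lerBlDl.
have xh : x + h <= x by rewrite gerDl ltW.
have [z /andP[xz zx] H] := MV _ _ xh.
rewrite distrC H normrM opprD addNKr normrN expr2 mulrA ler_wpM2r//.
apply: le_trans (L _ _) _; rewrite ler_wpM2l// (distrC z) (ltr0_norm h0) ger0_norm ?subr_ge0//.
by move: xz; clear; lra.
Qed.

End smooth_algebra.

(** * Differentiation along lines in the (T, Y) plane *)

Section mixed_derivatives.
Context {R : realType}.
Implicit Types (u G : R -> R -> R) (f df : R -> R).

Lemma mean_value_bound f df (M a b : R) : (forall x : R, is_derive x 1 f (df x)) ->
  (forall x : R, `|x - a| <= `|b - a| -> `|df x| <= M) ->
  `|f b - f a| <= M * `|b - a|.
Proof.
move=> dfx dM.
have cf : continuous f.
  by move=> x; apply: differentiable_continuous; apply/derivable1_diffP; case: (dfx x).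
have [ab|ba] := leP a b.
  have [c] := MVT_segment ab (fun x _ => dfx x) (continuous_subspaceT cf).
  rewrite in_itv/= => /andP[ac cb] ->; rewrite normrM ler_wpM2r// dM//.
  by rewrite !ger0_norm ?subr_ge0// lerD2r.
have [c] := MVT_segment (ltW ba) (fun x _ => dfx x) (continuous_subspaceT cf).
rewrite in_itv/= => /andP[ac cb] H; rewrite distrC H normrM (distrC a) ler_wpM2r// dM//.
rewrite (distrC c) (distrC b) !ger0_norm ?subr_ge0// ?(ltW ba)//.
by rewrite lerD2l lerN2.
Qed.

(** The Taylor remainder W(T) of u(T, .) between Y and Y + d should be Lipschitz in T with constant
    of order B d^2, as its formal T-derivative is the Taylor remainder of G. But W contains the
    Y-derivative of u, whose derivability in T is the very claim. The estimate is therefore made on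
    V, where a difference quotient of small step k replaces that derivative, and transferred to W by
    letting the error eta tend to 0. *)
Lemma is_derive_mixed u G (B T0 Y : R) :
  (forall T Y : R, is_derive T 1 (fun T' => u T' Y) (G T Y)) ->
  (forall T : R, `|T - T0| < 1 -> derivable (u T) Y 1) ->
  (forall T : R, `|T - T0| < 1 -> smooth 2 B (G T)) ->
  is_derive T0 1 (fun T => derive1 (u T) Y) (derive1 (G T0) Y).
Proof.
move=> uG du sG.
have sG0 : smooth 2 B (G T0) by apply: sG; rewrite subrr normr0.
have B0 := smooth_ge0 sG0.
apply/is_derive_epsP => e e0.
(* After division by d the errors are 2 B d from W, B d from the Taylor remainder of G and e / 4
   from the T-derivatives at Y and Y + d; 4 B d <= e makes their sum at most e. *)
pose d := e / (4 * (B + 1)).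
have d0 : 0 < d by rewrite divr_gt0// mulr_gt0// ltr_wpDl.
have Bd : 4 * (B * d) <= e.
  rewrite /d (_ : 4 * _ = e * (B / (B + 1))); last first.
    by field; rewrite gt_eqF// ltr_wpDl.
  by rewrite ler_piMr ?(ltW e0)// ler_pdivrMr ?mul1r ?lerDl// ltr_wpDl.
move: d d0 Bd => d d0 Bd.
have Tay (T k : R) : `|T - T0| < 1 ->
    `|G T (Y + k) - G T Y - k * derive1 (G T) Y| <= B * `|k| ^+ 2.
  by move=> /sG S; exact: (smooth_taylor S).
pose W (T : R) : R := u T (Y + d) - u T Y - d * derive1 (u T) Y.
have HW (T : R) : `|T - T0| < 1 -> `|W T - W T0| <= 2 * (B * d ^+ 2) * `|T - T0|.
  move=> T1; apply/ler_addgt0Pr => eta; move: (eta : R) => {}eta eta0.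
  have z0 : 0 < eta / (2 * d) by rewrite divr_gt0// mulr_gt0.
  have eps (S : R) : `|S - T0| < 1 -> exists2 r : R, 0 < r & forall h : R, `|h| < r ->
      `|u S (Y + h) - u S Y - h * derive1 (u S) Y| <= eta / (2 * d) * `|h|.
    move=> /du /derivableP D.
    have {}D : is_derive Y 1 (u S) (derive1 (u S) Y) by rewrite derive1E.
    by move/is_derive_epsP : D => /(_ _ z0).
  have [r1 r10 H1] := eps T T1.
  have [r2 r20 H2] : exists2 r : R, 0 < r & forall h : R, `|h| < r ->
      `|u T0 (Y + h) - u T0 Y - h * derive1 (u T0) Y| <= eta / (2 * d) * `|h|.
    by apply: eps; rewrite subrr normr0.
  pose k := Num.min d (Num.min (r1 / 2) (r2 / 2)).
  have k0 : 0 < k by rewrite !lt_min d0 !divr_gt0.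
  have kd : k <= d by rewrite ge_min lexx.
  have kr1 : k < r1.
    apply: (@le_lt_trans _ _ (r1 / 2)); first by rewrite /k !ge_min lexx orbT.
    by rewrite ltr_pdivrMr// ltr_pMr// ltr1n.
  have kr2 : k < r2.
    apply: (@le_lt_trans _ _ (r2 / 2)); first by rewrite /k !ge_min lexx !orbT.
    by rewrite ltr_pdivrMr// ltr_pMr// ltr1n.
  move: k k0 kd kr1 kr2 => k k0 kd kr1 kr2.
  (* V involves u only at the fixed points Y, Y + k and Y + d, so it is derivable in T by
     hypothesis. *)
  pose V (T : R) : R := u T (Y + d) - u T Y - d / k * (u T (Y + k) - u T Y).
  pose V' (T : R) : R := G T (Y + d) - G T Y - d / k * (G T (Y + k) - G T Y).
  have dV (S : R) : is_derive S 1 V (V' S).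
    rewrite /V /V'; apply: is_deriveB; apply: (@is_deriveZ _ _ _ (fun T => u T (Y + k) - u T Y) (d / k)).
  have VT : `|V T - V T0| <= 2 * (B * d ^+ 2) * `|T - T0|.
    apply: (mean_value_bound dV) => S ST.
    have S1 : `|S - T0| < 1 by apply: le_lt_trans ST T1.
    have t1 := Tay S d S1; have t2 := Tay S k S1.
    rewrite (_ : V' S = (G S (Y + d) - G S Y - d * derive1 (G S) Y)
       - d / k * (G S (Y + k) - G S Y - k * derive1 (G S) Y)); last first.
      by rewrite /V'; field; rewrite gt_eqF.
    apply: le_trans (ler_normB _ _) _.
    rewrite normrM (@gtr0_norm _ (d / k)) ?divr_gt0//.
    have t3 : d / k * `|G S (Y + k) - G S Y - k * derive1 (G S) Y| <= d / k * (B * `|k| ^+ 2).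
      by rewrite ler_pM2l// divr_gt0.
    have t4 : d / k * (B * `|k| ^+ 2) = B * d * k.
      by rewrite (ger0_norm (ltW k0)); field; rewrite gt_eqF.
    rewrite t4 in t3; rewrite (ger0_norm (ltW d0)) in t1.
    have t5 : B * d * k <= B * d ^+ 2 by rewrite expr2 mulrA ler_wpM2l// mulr_ge0// ltW.
    by move: t1 t3 t5; clear; lra.
  have VW (S : R) : `|u S (Y + k) - u S Y - k * derive1 (u S) Y| <= eta / (2 * d) * `|k| ->
      `|V S - W S| <= eta / 2.
    move=> H; rewrite (_ : V S - W S = - (d / k) * (u S (Y + k) - u S Y - k * derive1 (u S) Y)); last first.
      by rewrite /V /W; field; rewrite gt_eqF.
    rewrite normrM normrN (@gtr0_norm _ (d / k)) ?divr_gt0//.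
    apply: (@le_trans _ _ (d / k * (eta / (2 * d) * `|k|))).
      by rewrite ler_pM2l// divr_gt0.
    rewrite (ger0_norm (ltW k0)) le_eqVlt; apply/orP; left; apply/eqP.
    by field; rewrite !gt_eqF.
  have K : `|k| = k by rewrite gtr0_norm.
  have a1 := VW T (H1 k _); have a2 := VW T0 (H2 k _).
  rewrite K in a1 a2; have {}a1 := a1 kr1; have {}a2 := a2 kr2.
  rewrite (_ : W T - W T0 = (V T - V T0) - (V T - W T) + (V T0 - W T0)); last by ring.
  apply: le_trans (ler_normD _ _) _; have := ler_normB (V T - V T0) (V T - W T).
  by move: VT a1 a2; clear; lra.
have ed0 : 0 < e * d / 4 by rewrite !mulr_gt0.
have dU : is_derive T0 1 (fun T => u T (Y + d) - u T Y) (G T0 (Y + d) - G T0 Y).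
  exact: is_deriveB.
move/is_derive_epsP : dU => /(_ _ ed0)[r r0 Hr].
exists (Num.min r 1); first by rewrite lt_min r0 ltr01.
move=> h; rewrite lt_min => /andP[hr h1].
have T1 : `|T0 + h - T0| < 1 by rewrite addrAC subrr add0r.
have b1 := Hr h hr; have b2 := HW _ T1.
have b3 : `|G T0 (Y + d) - G T0 Y - d * derive1 (G T0) Y| <= B * `|d| ^+ 2.
  by apply: Tay; rewrite subrr normr0.
rewrite (addrAC T0 h) subrr add0r in b2; rewrite (ger0_norm (ltW d0)) in b3.
rewrite -(ler_pM2l d0) -{1}(gtr0_norm d0) -normrM.
rewrite (_ : d * _ = (u (T0 + h) (Y + d) - u (T0 + h) Y - (u T0 (Y + d) - u T0 Y) -
   h * (G T0 (Y + d) - G T0 Y)) - (W (T0 + h) - W T0)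
   + h * (G T0 (Y + d) - G T0 Y - d * derive1 (G T0) Y)); last by rewrite /W; ring.
apply: le_trans (ler_normD _ _) _.
apply: le_trans (lerD (ler_normB _ _) (lexx _)) _; rewrite [X in _ + X]normrM.
have b4 : `|h| * `|G T0 (Y + d) - G T0 Y - d * derive1 (G T0) Y| <= `|h| * (B * d ^+ 2).
  by rewrite ler_wpM2l.
have b5 : 4 * (B * d) * (d * `|h|) <= e * (d * `|h|) by rewrite ler_wpM2r// mulr_ge0// ltW.
by move: b1 b2 b4 b5; clear; move: (`|h|) (`|W _ - _|) => H w; lra.
Qed.

(** A chain rule without total differentiability. The step in Y at time T0 + a h has a Taylor
    remainder uniform in T; derivability of the Y-derivative in T moves its slope back to T0; what
    remains is an increment in T at fixed Y0. *)
Lemma is_derive_along u (G0 w B a b c t : R) :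
  is_derive (a * t) 1 (fun T => u T (b * t + c)) G0 ->
  is_derive (a * t) 1 (fun T => derive1 (u T) (b * t + c)) w ->
  (forall T : R, `|T - a * t| < 1 -> smooth 2 B (u T)) ->
  is_derive t 1 (fun t' => u (a * t') (b * t' + c))
    (a * G0 + b * derive1 (u (a * t)) (b * t + c)).
Proof.
set T0 := a * t; set Y0 := b * t + c => d1 d2 su.
have B0 : 0 <= B by apply: (@smooth_ge0 _ 2 _ (u T0)); apply: su; rewrite subrr normr0.
apply/is_derive_epsP => e e0.
(* A bounds the step a h in terms of h, and A2 collects the coefficients of h^2; the linear and the
   quadratic errors get e / 2 each. *)
pose A := `|a| + 1; pose A2 := `|b| * (`|w| + 1) * `|a| + B * `|b| ^+ 2 + 1.
have A0 : 0 < A by rewrite ltr_wpDl.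
have A20 : 0 < A2 by rewrite ltr_wpDl// addr_ge0// !mulr_ge0// addr_ge0.
have eA : 0 < e / (2 * A) by rewrite divr_gt0// mulr_gt0.
move/is_derive_epsP : (d1) => /(_ _ eA)[r1 r10 H1].
move/is_derive_epsP : (d2) => /(_ 1 ltr01)[r2 r20 H2].
pose r := Num.min (Num.min r1 (Num.min r2 1) / A) (e / (2 * A2)).
have r0 : 0 < r by rewrite lt_min !divr_gt0 ?lt_min ?r10 ?r20 ?ltr01 ?mulr_gt0.
exists r => // h; rewrite lt_min => /andP[].
rewrite ltr_pdivlMr// !lt_min => /andP[hr1 /andP[hr2 h1]].
rewrite ltr_pdivlMr ?mulr_gt0// => hA2.
have ah : `|a * h| <= `|h| * A.
  by rewrite normrM mulrC ler_wpM2l// /A lerDl.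
have K1 := H1 (a * h) (le_lt_trans ah hr1).
have K2 := H2 (a * h) (le_lt_trans ah hr2).
have S := su (T0 + a * h); rewrite (addrAC T0) subrr add0r in S.
have K3 := smooth_taylor (S (le_lt_trans ah h1)) Y0 (b * h).
rewrite !mulrDr -/T0 (_ : b * t + b * h + c = Y0 + b * h); last by rewrite /Y0; ring.
rewrite (_ : _ - _ - _ =
  (u (T0 + a * h) (Y0 + b * h) - u (T0 + a * h) Y0 - b * h * derive1 (u (T0 + a * h)) Y0)
  + b * h * (derive1 (u (T0 + a * h)) Y0 - derive1 (u T0) Y0)
  + (u (T0 + a * h) Y0 - u T0 Y0 - a * h * G0)); last by ring.
apply: le_trans (ler_normD _ _) _.
apply: le_trans (lerD (ler_normD _ _) (lexx _)) _.
rewrite (normrM (b * h)) (normrM b).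
have K4 : `|derive1 (u (T0 + a * h)) Y0 - derive1 (u T0) Y0| <= (`|w| + 1) * (`|a| * `|h|).
  rewrite (_ : _ - _ = (derive1 (u (T0 + a * h)) Y0 - derive1 (u T0) Y0 - a * h * w) + a * h * w); last by ring.
  apply: le_trans (ler_normD _ _) _; move: K2; rewrite !normrM mul1r.
  by move: (`|a|) (`|h|) (`|w|) => p q s; clear; lra.
have K5 : `|b| * `|h| * `|derive1 (u (T0 + a * h)) Y0 - derive1 (u T0) Y0| <=
    `|b| * `|h| * ((`|w| + 1) * (`|a| * `|h|)) by rewrite ler_wpM2l// mulr_ge0.
have K6 : e / (2 * A) * `|a * h| <= e / 2 * `|h|.
  rewrite (_ : e / 2 * `|h| = e / (2 * A) * (`|h| * A)); last by field; rewrite gt_eqF.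
  by rewrite ler_pM2l.
have K7 : A2 * `|h| ^+ 2 <= e / 2 * `|h|.
  rewrite expr2 mulrA ler_wpM2r// ler_pdivlMr// (_ : A2 * _ * _ = `|h| * (2 * A2)) ?ltW//; ring.
have K8 : 0 <= `|h| ^+ 2 by rewrite exprn_ge0.
rewrite normrM exprMn in K3.
move: K1 K3 K5 K6 K7 K8; rewrite /A2; clear.
move: (`|u _ _ - _ - b * h * _|) (`|u _ _ - _ - a * h * _|) => p q.
move: (_ * `|derive1 _ _ - _|) (e / (2 * A) * _) => s v.
move: (`|h|) (`|a|) (`|b|) (`|w|) => H P Q W.
by rewrite (_ : e * H = e / 2 * H + e / 2 * H); [lra|field].
Qed.

End mixed_derivatives.

(** * Coefficients of the logarithm *)

Section multinomial.
Context {R : numFieldType} {A : comAlgType R}.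
Implicit Types (y : A).

(* Truncated exponential series in y X: the multinomial coefficients come from the
   functional equation of exp. *)
Definition texp (N : nat) y : {poly A} :=
  \sum_(a < N.+1) ((a`!%:R)^-1 *: y ^+ a) *: 'X^a.

Lemma coef_texp N y j : (j <= N)%N -> (texp N y)`_j = (j`!%:R)^-1 *: y ^+ j.
Proof.
move=> jN; rewrite /texp coef_sum.
rewrite (bigD1 (Ordinal (jN : (j < N.+1)%N)))//= coefZ coefXn eqxx mulr1.
rewrite big1 ?addr0// => i ij; rewrite coefZ coefXn.
case: eqP => [E|_]; last by rewrite mulr0.
by move: ij; rewrite -val_eqE/= E eqxx.
Qed.

Lemma coef_prod_texp N (I : finType) (y : I -> A) j : (j <= N)%N ->
  (\prod_i texp N (y i))`_j = (j`!%:R)^-1 *: (\sum_i y i) ^+ j.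
Proof.
elim/big_rec2 : _ j => [|i S p _ IH] j jN.
  by rewrite coef1 expr0n; case: j jN => [|j] _; rewrite ?fact0 ?invr1 ?scale1r ?scaler0.
rewrite coefM exprDn scaler_sumr.
rewrite (reindex_inj rev_ord_inj)/=; apply: eq_bigr => k _.
have kj : (k <= j)%N by rewrite -ltnS.
rewrite subSS coef_texp ?IH//; last 2 first.
- by rewrite subKn// (leq_trans kj).
- by rewrite (leq_trans (leq_subr _ _)).
rewrite subKn// -scalerAl -scalerAr [LHS]scalerA -[X in _ = _ *: X]scaler_nat [RHS]scalerA; congr (_ *: _).
have := bin_fact kj => /(congr1 (fun n => n%:R : R)); rewrite !natrM => H.
have f0 n : n`!%:R != 0 :> R by rewrite pnatr_eq0 -lt0n fact_gt0.
have E : (j - k)`!%:R^-1 / k`!%:R = j`!%:R^-1 * 'C(j, k)%:R :> R.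
  rewrite -H; have b0 : 'C(j, k)%:R != 0 :> R by rewrite pnatr_eq0 -lt0n bin_gt0.
  by field; rewrite b0 !f0.
exact: E.
Qed.

(** Expanding the product of truncated exponentials by distributivity and comparing coefficients of
    X^j. Truncation at N >= j is invisible there and bounds the exponents, as in the index set of
    [log_coef]. *)
Lemma multinomial N r (y : 'I_r -> A) j : (j <= N)%N ->
  (\sum_i y i) ^+ j = \sum_(a : {ffun 'I_r -> 'I_N.+1} | (\sum_i a i)%N == j)
    (j`!%:R / (\prod_i (a i)`!)%:R) *: \prod_i y i ^+ a i.
Proof.
move=> jN; have f0 n : n`!%:R != 0 :> R by rewrite pnatr_eq0 -lt0n fact_gt0.
have := coef_prod_texp y jN; rewrite /texp bigA_distr_bigA coef_sum => H.
have -> : (\sum_i y i) ^+ j = j`!%:R *: ((j`!%:R)^-1 *: (\sum_i y i) ^+ j).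
  by rewrite scalerA divff// scale1r.
rewrite -H scaler_sumr.
rewrite [RHS]big_mkcond; apply: eq_bigr => a _.
have -> : \prod_i (((a i)`!%:R^-1 *: y i ^+ a i) *: 'X^(a i) : {poly A}) =
   ((\prod_i (a i)`!)%:R^-1 *: \prod_i y i ^+ a i) *: 'X^(\sum_i a i).
  transitivity ((\prod_i ((a i)`!%:R^-1 *: y i ^+ a i)) *: 'X^(\sum_i a i) : {poly A}).
    elim/big_rec3 : _ => [|i p m q _ ->]; first by rewrite scale1r expr0.
    by rewrite -scalerAl -scalerAr -exprD scalerA.
  congr (_ *: _); elim/big_rec3 : _ => [|i p m q _ ->]; first by rewrite invr1 scale1r.
  by rewrite natrM invfM -scalerAl -scalerAr scalerA.
rewrite coefZ coefXn eq_sym; case: ifP => _; last by rewrite mulr0 scaler0.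
by rewrite mulr1 scalerA.
Qed.

End multinomial.

Section log_coefficients.
Context {R : realType}.
Implicit Types (x : nat -> R).

(** The truncated expansion as a polynomial in the formal variable eps, without constant term. *)
Definition tpoly n x : {poly R} := \sum_(i < n) x i.+1 *: 'X^(i.+1).

Lemma log_coefE r x : log_coef r x =
  \sum_(1 <= j < r.+1) (-1) ^+ j.+1 / j%:R * (tpoly r x ^+ j)`_r.
Proof.
rewrite /log_coef; apply: eq_big_nat => j /andP[_ jr]; congr (_ * _).
rewrite /tpoly (@multinomial _ _ r)// coef_sum.
rewrite [RHS]big_mkcond [LHS]big_mkcond/=; apply: eq_bigr => a _.
have -> : \prod_(i < r) (x i.+1 *: 'X^(i.+1) : {poly R}) ^+ a i =
   (\prod_(i < r) x i.+1 ^+ a i) *: 'X^(\sum_(i < r) i.+1 * a i).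
  elim/big_rec3 : _ => [|i p m n _ ->]; first by rewrite scale1r expr0.
  by rewrite exprZn -exprM -scalerAl -scalerAr -exprD scalerA.
rewrite !coefZ coefXn [(r == _)]eq_sym.
case: eqP => //= _; case: eqP => _; last by rewrite !mulr0.
by rewrite mulr1.
Qed.

Lemma tpoly_coef n x i : (tpoly n x)`_i = if (0 < i <= n)%N then x i else 0.
Proof.
rewrite /tpoly coef_sum; case: ifP => [/andP[i0 ik]|ik].
  have i1 : (i.-1 < n)%N by rewrite prednK.
  rewrite (bigD1 (Ordinal i1))//= coefZ coefXn prednK// eqxx mulr1.
  rewrite big1 ?addr0// => l; rewrite -val_eqE/= => li.
  rewrite coefZ coefXn; case: eqP => [E|_]; last by rewrite mulr0.
  by move: li; rewrite E eqxx.
rewrite big1// => l _; rewrite coefZ coefXn; case: eqP => [E|_]; last by rewrite mulr0.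
by move: ik; rewrite E/= ltn_ord.
Qed.

Lemma coef_exp_eq (p q : {poly R}) n : (forall i, (i <= n)%N -> p`_i = q`_i) ->
  forall j i, (i <= n)%N -> (p ^+ j)`_i = (q ^+ j)`_i.
Proof.
move=> pq; elim=> [|j IH] i ni; first by rewrite !expr0.
rewrite !exprS !coefM; apply: eq_bigr => l _.
by rewrite pq ?IH// ?(leq_trans (leq_subr _ _))// (leq_trans _ ni)// -ltnS.
Qed.

Lemma coef_exp_lt (p : {poly R}) : p`_0 = 0 -> forall j i, (i < j)%N -> (p ^+ j)`_i = 0.
Proof.
move=> p0; elim=> [//|j IH] i ij; rewrite exprS coefM big1// => -[[|l] /= li] _.
  by rewrite p0 mul0r.
by rewrite IH ?mulr0//; move: li ij; rewrite !ltnS; case: i => //= i li ij; rewrite subSS (leq_ltn_trans (leq_subr _ _)).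
Qed.

Lemma tpoly_coef0 n x : (tpoly n x)`_0 = 0.
Proof. by rewrite tpoly_coef. Qed.

(** In degree r neither powers j > r nor variables x_i with i > r contribute, for want of a constant
    term. So the logarithm truncated at m, as in the residuals, has the exact coefficients up to
    order m. *)
Lemma log_coef_trunc m r x : (r <= m)%N ->
  \sum_(1 <= j < m.+1) (-1) ^+ j.+1 / j%:R * (tpoly m x ^+ j)`_r = log_coef r x.
Proof.
move=> rm; rewrite (@big_cat_nat _ _ _ r.+1)//= [X in _ + X](_ : _ = 0) ?addr0; last first.
  rewrite big_nat_cond big1// => j /andP[/andP[rj _] _].
  by rewrite coef_exp_lt ?mulr0// tpoly_coef0.
rewrite log_coefE; apply: eq_bigr => j _; congr (_ * _).
apply: (@coef_exp_eq _ _ r) => // i ir.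
by rewrite !tpoly_coef ir (leq_trans ir rm).
Qed.

(** p - q starts in degree k, and its cofactor in p^j - q^j is homogeneous of degree j - 1 in two
    polynomials without constant term. In degree k + 1 only j <= 2 is felt. *)
Lemma coef_exp_diff (p q : {poly R}) k : p`_0 = 0 -> q`_0 = 0 ->
  (forall i, (i < k)%N -> p`_i = q`_i) -> (1 < k)%N ->
  [/\ (p ^+ 2)`_k.+1 - (q ^+ 2)`_k.+1 = 2 * p`_1 * (p`_k - q`_k),
      (p ^+ 2)`_k - (q ^+ 2)`_k = 0
    & forall j, (2 < j)%N -> (p ^+ j)`_k.+1 = (q ^+ j)`_k.+1 /\
                            (p ^+ j)`_k = (q ^+ j)`_k].
Proof.
move=> p0 q0 pq k1.
have D (s : {poly R}) i : (i <= k.+1)%N -> ((p - q) * s)`_i =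
    (p - q)`_k * s`_(i - k) *+ (k <= i)%N + (p - q)`_k.+1 * s`_0 *+ (i == k.+1).
  move=> ik; rewrite coefM.
  have Z l : (l < k)%N -> (p - q)`_l = 0 by move=> lk; rewrite coefB pq// subrr.
  have [E|ki|->] := ltngtP i k.
  - rewrite big1; last by move=> [l li] _ /=; rewrite Z ?mul0r// (leq_trans li).
    by rewrite ltn_eqF ?mulr0n ?addr0// ltnW.
  - have {ki ik} -> : i = k.+1 by apply/eqP; rewrite eqn_leq ik.
    rewrite !big_ord_recr/= big1; last by move=> [l li] _ /=; rewrite Z ?mul0r.
    by rewrite add0r subnn subSnn eqxx !mulr1n.
  - rewrite big_ord_recr/= big1; last by move=> [l li] _ /=; rewrite Z ?mul0r.
    by rewrite add0r subnn eqn_leq ltnn andbF mulr1n addr0.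
have P1 : p`_1 = q`_1 by exact: pq.
split.
- rewrite -coefB subr_sqr D// subSnn leqnSn eqxx !coefD p0 q0 addr0 mulr0 addr0 -P1 coefN mulr1n.
  by ring.
- by rewrite -coefB subr_sqr D ?leqnSn// subnn leqnn !coefD p0 q0 addr0 !mulr0 eqn_leq ltnn andbF mulr0n addr0 mulr1n.
- move=> j j3.
  have S0 i : (i <= 1)%N -> (\sum_(l < j) p ^+ (j.-1 - l) * q ^+ l)`_i = 0.
    move=> i1; rewrite coef_sum big1// => -[l lj] _ /=.
    rewrite coefM big1// => -[a ai] _ /=.
    have [al|al] := ltnP a (j.-1 - l); first by rewrite coef_exp_lt ?mul0r.
    rewrite (@coef_exp_lt q) ?mulr0//.
    move: j3 i1 lj ai al; clear; case: j => [//|j]; rewrite ltnS /= => *; lia.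
  split; apply/eqP; rewrite -subr_eq0 -coefB subrXX D//.
    by rewrite subSnn !S0 ?mulr0 ?mul0rn ?addr0.
  by rewrite subnn !S0 ?mulr0 ?mul0rn ?addr0.
Qed.

(** The way the logarithm depends on its two top variables: linearly in degree k, and as x_(k+1) -
    x_1 x_k in degree k + 1, the product stemming from -1/2 times the square. *)
Lemma log_coef_diff k x y : (1 < k)%N -> (forall i, (0 < i < k)%N -> x i = y i) ->
  log_coef k.+1 x - log_coef k.+1 y = (x k.+1 - y k.+1) - x 1%N * (x k - y k) /\
  log_coef k x - log_coef k y = x k - y k.
Proof.
move=> k1 xy; have k0 : (0 < k)%N by exact: ltnW.
have E r : (1 < r <= k.+1)%N -> forall z, log_coef r z = (tpoly k.+1 z)`_r
    - 2^-1 * (tpoly k.+1 z ^+ 2)`_r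
    + \sum_(3 <= j < k.+2) (-1) ^+ j.+1 / j%:R * (tpoly k.+1 z ^+ j)`_r.
  move=> /andP[r1 rk] z; rewrite -(@log_coef_trunc k.+1)//.
  rewrite big_ltn// big_ltn ?ltnS// expr1 addrA; congr (_ + _).
  by field.
pose p := tpoly k.+1 x; pose q := tpoly k.+1 y.
have pq i : (i < k)%N -> p`_i = q`_i.
  move=> ik; rewrite /p /q !tpoly_coef; case: ifP => // /andP[i0 _].
  by rewrite xy// i0.
have [d1 d2 d3] := coef_exp_diff (tpoly_coef0 _ _) (tpoly_coef0 _ _) pq k1.
have S r : r = k \/ r = k.+1 -> \sum_(3 <= j < k.+2) (-1) ^+ j.+1 / j%:R * (p ^+ j)`_r =
    \sum_(3 <= j < k.+2) (-1) ^+ j.+1 / j%:R * (q ^+ j)`_r.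
  move=> rk; apply: eq_big_nat => j /andP[j3 _]; have [e1 e2] := d3 j j3.
  by case: rk => ->; rewrite ?e1 ?e2.
split.
  rewrite !E ?leqnn ?ltnS ?k0// -/p -/q S; last by right.
  rewrite (_ : _ - _ = p`_k.+1 - q`_k.+1 - 2^-1 * ((p ^+ 2)`_k.+1 - (q ^+ 2)`_k.+1)); last by ring.
  rewrite d1 /p /q !tpoly_coef leqnn leqnSn k0/= .
  by field.
rewrite !E ?leqnn ?leqnSn ?k1// -/p -/q S; last by left.
rewrite (_ : _ - _ = p`_k - q`_k - 2^-1 * ((p ^+ 2)`_k - (q ^+ 2)`_k)); last by ring.
by rewrite d2 /p /q !tpoly_coef leqnSn k0/= mulr0 subr0.
Qed.

Lemma log_coef1 x : log_coef 1 x = x 1%N.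
Proof. by rewrite log_coefE big_nat1 expr1 tpoly_coef/=; field. Qed.

Lemma log_coef2 x : log_coef 2 x = x 2%N - 2^-1 * x 1%N ^+ 2.
Proof.
rewrite log_coefE big_ltn// big_nat1 expr1 expr2 coefM !big_ord_recr big_ord0/=.
by rewrite !tpoly_coef/=; field.
Qed.

Lemma size_tpoly n x : (size (tpoly n x) <= n.+1)%N.
Proof.
apply/leq_sizeP => i ni; rewrite tpoly_coef; case: ifP => // /andP[_].
by rewrite leqNgt ni.
Qed.

Lemma horner_tpoly n x (e : R) : (tpoly n x).[e] = \sum_(1 <= k < n.+1) e ^+ k * x k.
Proof.
rewrite /tpoly horner_sum big_add1 big_mkord; apply: eq_bigr => i _.
by rewrite hornerZ hornerXn mulrC.
Qed.

End log_coefficients.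

(** * Differential polynomials in the profiles *)

Section dpoly_theory.
Context {R : realType}.
Implicit Types (w : nat -> R -> R) (e : dpoly R).

Fixpoint dorder e : nat :=
  match e with
  | DVar _ => 0
  | DScale _ e1 => dorder e1
  | DAdd e1 e2 => maxn (dorder e1) (dorder e2)
  | DMul e1 e2 => maxn (dorder e1) (dorder e2)
  | DDer e1 => (dorder e1).+1
  end.

Lemma eq_dpoly_eval k e w w' : dpoly_upto k e ->
  (forall j, (0 < j <= k)%N -> w j = w' j) -> dpoly_eval w e = dpoly_eval w' e.
Proof.
move=> ke ww; elim: e ke => [j|a e IH|e1 IH1 e2 IH2|e1 IH1 e2 IH2|e IH] /=.
- by move/ww.
- by move/IH => ->.
- by move=> /andP[/IH1 -> /IH2 ->].
- by move=> /andP[/IH1 -> /IH2 ->].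
- by move/IH => ->.
Qed.

Lemma dpoly_upto_le k l e : (k <= l)%N -> dpoly_upto k e -> dpoly_upto l e.
Proof.
move=> kl; elim: e => [j|a e IH|e1 IH1 e2 IH2|e1 IH1 e2 IH2|e IH] //=.
- by move=> /andP[-> /leq_trans]; exact.
- by move=> /andP[/IH1 -> /IH2 ->].
- by move=> /andP[/IH1 -> /IH2 ->].
Qed.

Lemma dpoly_smooth k e : dpoly_upto k e -> forall q, exists K : R -> R,
  forall w (B : R), (forall j, (0 < j <= k)%N -> smooth (q + dorder e) B (w j)) ->
  smooth q (K B) (dpoly_eval w e).
Proof.
elim: e => [j|a e IH|e1 IH1 e2 IH2|e1 IH1 e2 IH2|e IH] /=.
- by move=> jk q; exists id => w B; rewrite addn0; exact.
- move=> /IH {}IH q; have [K HK] := IH q.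
  by exists (fun B => `|a| * K B) => w B /HK; exact: smooth_scale.
- move=> /andP[/IH1 {}IH1 /IH2 {}IH2] q; have [K1 H1] := IH1 q; have [K2 H2] := IH2 q.
  exists (fun B => 2 * (K1 B + K2 B)) => w B wB; apply: smooth_add.
    by apply: H1 => j /wB; apply: smooth_leq; rewrite leq_add2l leq_maxl.
  by apply: H2 => j /wB; apply: smooth_leq; rewrite leq_add2l leq_maxr.
- move=> /andP[/IH1 {}IH1 /IH2 {}IH2] q; have [K1 H1] := IH1 q; have [K2 H2] := IH2 q.
  exists (fun B => 4 ^+ q * (K1 B * K2 B)) => w B wB; apply: smooth_mul.
    by apply: H1 => j /wB; apply: smooth_leq; rewrite leq_add2l leq_maxl.
  by apply: H2 => j /wB; apply: smooth_leq; rewrite leq_add2l leq_maxr.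
- move=> /IH {}IH q; have [K HK] := IH q.+1.
  by exists K => w B wB; apply/smooth_derive1/HK => j /wB; rewrite addnS addSn.
Qed.

End dpoly_theory.

(** * Statements for sufficiently regular solutions, and uniform differential polynomials *)

Section hierarchy.
Context {R : realType}.
Context (m : nat) (tau me : R) (J : antiderivatives R).
Implicit Types (P : profiles R) (u v : profiles R -> R -> R -> R).

Definition hier (r : nat) P : Prop := exists s ini,
  (forall k, (1 <= k <= m)%N -> (r <= s k)%N) /\ kdv_hierarchy m tau me J s ini P.

(* The threshold r makes precise that the s_k are sufficiently large. *)
Definition ev (Q : profiles R -> Prop) := exists r, forall P, hier r P -> Q P.

Lemma hier_le r r' P : (r <= r')%N -> hier r' P -> hier r P.
Proof.
by move=> rr [s [ini [H1 H2]]]; exists s, ini; split => // k /H1; exact: leq_trans.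
Qed.

Lemma ev_hier (Q : profiles R -> Prop) :
  (forall s ini P, kdv_hierarchy m tau me J s ini P -> Q P) -> ev Q.
Proof. by move=> H; exists 0%N => P [s [ini [_ /H]]]. Qed.

Lemma ev1 (A B : profiles R -> Prop) : ev A -> (forall P, A P -> B P) -> ev B.
Proof. by move=> [r H] AB; exists r => P /H /AB. Qed.

Lemma ev_and (A B : profiles R -> Prop) : ev A -> ev B -> ev (fun P => A P /\ B P).
Proof.
move=> [r H] [r' H']; exists (maxn r r') => P HP; split.
  by apply: H; apply: hier_le HP; exact: leq_maxl.
by apply: H'; apply: hier_le HP; exact: leq_maxr.
Qed.

(** Only finitely many thresholds can be merged into one, by taking their maximum. *)
Lemma ev_forall n (A : nat -> profiles R -> Prop) :
  (forall k, (k < n)%N -> ev (A k)) -> ev (fun P => forall k, (k < n)%N -> A k P).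
Proof.
elim: n => [|n IH] H; first by exists 0%N.
have H1 := IH (fun k kn => H k (ltnW kn)).
apply: ev1 (ev_and H1 (H n (ltnSn n))) _ => P [h1 h2] k; rewrite ltnS leq_eqVlt.
by move=> /predU1P[->|/h1].
Qed.

Lemma uniform_smooth n q (w : nat -> R -> R -> R) (T0 : R) :
  (forall j, (0 < j <= n)%N -> exists B : R, forall T : R, `|T| < T0 -> smooth q B (w j T)) ->
  exists B : R, forall T : R, `|T| < T0 -> forall j, (0 < j <= n)%N -> smooth q B (w j T).
Proof.
elim: n => [|n IH] H; first by exists 0 => T _ [].
have [B HB] : exists B : R, forall T : R, `|T| < T0 ->
    forall j, (0 < j <= n)%N -> smooth q B (w j T).
  by apply: IH => j /andP[j0 jn]; apply: H; rewrite j0 leqW.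
have [B' HB'] := H n.+1 (leqnn _).
exists (Num.max B B') => T TT j; rewrite [X in _ && X]leq_eqVlt => /andP[j0 /predU1P[->|jn]].
  by apply: smooth_le (HB' _ TT); rewrite le_max lexx orbT.
by apply: smooth_le (HB _ TT j _); rewrite ?le_max ?lexx// j0.
Qed.

(** B depends on the solution and on T0: this bound justifies differentiations and does not enter
    the constants. *)
Lemma hier_smooth q : ev (fun P => forall T0 : R, exists B : R, forall T : R, `|T| < T0 ->
  forall j, (0 < j <= m)%N -> smooth q B (np P j T)).
Proof.
exists q.+1 => P [s [ini [rs H]]] T0.
apply: uniform_smooth => j jm; have [[cu Hu] _ _ _ _] := hier_class H jm.
have [T00|T00] := ltP 0 T0; last first.
  by exists 0 => T TT; have := le_lt_trans (normr_ge0 T) TT; rewrite ltNge T00.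
have [B HB] := Hu _ T00; exists (2 * (B + 1) ^+ 2 + 3) => T TT.
by apply: (@Hnorm_smooth _ q (s j)) => //; [exact: rs|exact: HB].
Qed.

(* The polynomial e is the same for all solutions, so bounds on u P depend only
   on bounds on n_+^(1), ..., n_+^(K). *)
Definition dp (K : nat) u : Prop := exists e, dpoly_upto K e /\
  ev (fun P => forall T, u P T = dpoly_eval (fun j => np P j T) e).

Lemma dp_ext K u v : ev (fun P => forall T Y, u P T Y = v P T Y) -> dp K v -> dp K u.
Proof.
move=> uv [e [eK He]]; exists e; split => //.
by apply: ev1 (ev_and uv He) _ => P [h1 h2] T; rewrite -h2; apply/funext => Y.
Qed.

Lemma dp_le K L u : (K <= L)%N -> dp K u -> dp L u.
Proof. by move=> KL [e [eK He]]; exists e; split => //; exact: dpoly_upto_le eK. Qed.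

Lemma dp_var K k : (0 < k <= K)%N -> dp K (fun P => np P k).
Proof. by move=> kK; exists (DVar _ k); split => //; exists 0%N. Qed.

Lemma dp_scale K (a : R) u : dp K u -> dp K (fun P T Y => a * u P T Y).
Proof.
move=> [e [eK He]]; exists (DScale a e); split => //.
by apply: ev1 He _ => P H T; rewrite /= -H.
Qed.

Lemma dp_add K u v : dp K u -> dp K v -> dp K (fun P T Y => u P T Y + v P T Y).
Proof.
move=> [e [eK He]] [e' [eK' He']]; exists (DAdd e e'); split => /=; first by rewrite eK.
by apply: ev1 (ev_and He He') _ => P [h1 h2] T; rewrite -h1 -h2.
Qed.

Lemma dp_mul K u v : dp K u -> dp K v -> dp K (fun P T Y => u P T Y * v P T Y).
Proof.
move=> [e [eK He]] [e' [eK' He']]; exists (DMul e e'); split => /=; first by rewrite eK.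
by apply: ev1 (ev_and He He') _ => P [h1 h2] T; rewrite -h1 -h2.
Qed.

Lemma dp_opp K u : dp K u -> dp K (fun P T Y => - u P T Y).
Proof.
by move=> /(dp_scale (-1)); apply: dp_ext; apply: ev_hier => *; rewrite mulN1r.
Qed.

Lemma dp_sub K u v : dp K u -> dp K v -> dp K (fun P T Y => u P T Y - v P T Y).
Proof. by move=> du /dp_opp; exact: dp_add. Qed.

(** Since [dpoly] has no constants, zero is written as 0 times w_1. *)
Lemma dp_zero K : (0 < K)%N -> dp K (fun _ _ _ => 0).
Proof.
move=> K0; have /(dp_scale 0) := @dp_var K 1 K0.
by apply: dp_ext; apply: ev_hier => *; rewrite mul0r.
Qed.

Lemma dp_sum K (I : Type) (r : seq I) (A : pred I) (f : I -> profiles R -> R -> R -> R) :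
  (0 < K)%N -> (forall i, A i -> dp K (f i)) ->
  dp K (fun P T Y => \sum_(i <- r | A i) f i P T Y).
Proof.
move=> K0 H; elim: r => [|i r IH].
  by apply: dp_ext (dp_zero K0); apply: ev_hier => *; rewrite big_nil.
have [Ai|Ai] := boolP (A i).
  by apply: dp_ext (dp_add (H _ Ai) IH); apply: ev_hier => *; rewrite big_cons Ai.
by apply: dp_ext IH; apply: ev_hier => *; rewrite big_cons (negbTE Ai).
Qed.

Lemma dp_sum_nat K (a b : nat) (f : nat -> profiles R -> R -> R -> R) :
  (0 < K)%N -> (forall i, (a <= i < b)%N -> dp K (f i)) ->
  dp K (fun P T Y => \sum_(a <= i < b) f i P T Y).
Proof.
move=> K0 H.
have := @dp_sum K nat (index_iota a b) (fun i => a <= i < b)%N f K0 H.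
by apply: dp_ext; apply: ev_hier => *; rewrite big_nat.
Qed.

Lemma dp_space K u : dp K u -> dp K (fun P T Y => d_space (u P) T Y).
Proof.
move=> [e [eK He]]; exists (DDer e); split => //.
by apply: ev1 He _ => P H T; rewrite /= -H.
Qed.

Lemma dp_smooth K u q : (K <= m)%N -> dp K u -> ev (fun P => forall T0 : R,
  exists B : R, forall T : R, `|T| < T0 -> smooth q B (u P T)).
Proof.
move=> Km [e [eK He]]; have [F HF] := dpoly_smooth eK q.
apply: ev1 (ev_and He (hier_smooth (q + dorder e))) _ => P [h1 h2] T0.
have [B HB] := h2 T0; exists (F B) => T TT; rewrite h1; apply: HF => j /andP[j0 jK].
by apply: HB => //; rewrite j0 (leq_trans jK).
Qed.

(** The quantitative counterpart of [dp_smooth]: a bound at one time T from a bound at the same T,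
    with n and F preceding the solution. *)
Lemma dp_bound K u q : (K <= m)%N -> dp K u -> exists (n : nat) (F : R -> R),
  ev (fun P => forall (T B : R), (forall j, (0 < j <= m)%N -> smooth n B (np P j T)) ->
    smooth q (F B) (u P T)).
Proof.
move=> Km [e [eK He]]; have [F HF] := dpoly_smooth eK q.
exists (q + dorder e)%N, F; apply: ev1 He _ => P h T B HB; rewrite h; apply: HF.
by move=> j /andP[j0 jK]; apply: HB; rewrite j0 (leq_trans jK).
Qed.

Lemma dp_derivable K u : (K <= m)%N -> dp K u ->
  ev (fun P => forall T Y : R, derivable (u P T) Y 1).
Proof.
move=> Km /(dp_smooth 1 Km) H; apply: ev1 H _ => P H T Y.
by have [B HB] := H (`|T| + 1); apply: (smooth_derivable (HB T _)); rewrite ltrDl.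
Qed.

(** For [DDer] the derivatives in T and Y must be exchanged. [is_derive_mixed] wants the
    T-derivative to be smooth in Y, locally uniformly in T; it is, being a differential polynomial
    by induction. *)
Lemma dpoly_time K e : (K <= m)%N ->
  (forall j, (0 < j <= K)%N -> dp K (fun P => d_time (np P j))) ->
  dpoly_upto K e -> exists e', dpoly_upto K e' /\ ev (fun P => forall T Y : R,
    is_derive T 1 (fun T' => dpoly_eval (fun j => np P j T') e Y)
      (dpoly_eval (fun j => np P j T) e' Y)).
Proof.
move=> Km Hd; elim: e => [j|a e IH|e1 IH1 e2 IH2|e1 IH1 e2 IH2|e IH] /=.
- move=> jK; have [e' [eK' He']] := Hd j jK; exists e'; split => //.
  have T : ev (fun P => time_derivable (np P j)).
    apply: ev_hier => s ini P H; have /andP[j0 jk] := jK.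
    by have [] := hier_time H (_ : (1 <= j <= m)%N); rewrite ?j0 ?(leq_trans jk).
  apply: ev1 (ev_and He' T) _ => P [h t] T' Y; rewrite -h /d_time derive1E.
  by apply: derivableP; exact: t.
- move=> /IH[e' [eK' He']]; exists (DScale a e'); split => //.
  by apply: ev1 He' _ => P h T Y /=; apply: is_deriveZ.
- move=> /andP[/IH1[e1' [K1 H1]] /IH2[e2' [K2 H2]]].
  exists (DAdd e1' e2'); split => /=; first by rewrite K1.
  by apply: ev1 (ev_and H1 H2) _ => P [h1 h2] T Y; exact: is_deriveD.
- move=> /andP[k1 k2]; have [e1' [K1 H1]] := IH1 k1; have [e2' [K2 H2]] := IH2 k2.
  exists (DAdd (DMul e1 e2') (DMul e2 e1')); split => /=; first by rewrite K1 k1 k2 K2.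
  by apply: ev1 (ev_and H1 H2) _ => P [h1 h2] T Y; exact: is_deriveM.
- move=> eK; have [e' [eK' He']] := IH eK; exists (DDer e'); split => //.
  have De : dp K (fun P T => dpoly_eval (fun j => np P j T) e).
    by exists e; split => //; exists 0%N.
  have De' : dp K (fun P T => dpoly_eval (fun j => np P j T) e').
    by exists e'; split => //; exists 0%N.
  apply: ev1 (ev_and He' (ev_and (dp_derivable Km De) (dp_smooth 2 Km De'))) _.
  move=> P [h1 [h2 h3]] T Y /=.
  have [B HB] := h3 (`|T| + 1).
  apply: (@is_derive_mixed _ (fun T Y => dpoly_eval (fun j => np P j T) e Y)
    (fun T Y => dpoly_eval (fun j => np P j T) e' Y) B) => // T' TT.
  by apply: HB; rewrite -(subrK T T') addrC (le_lt_trans (ler_normD _ _))// ltrD2l.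
Qed.

Lemma dp_time K u : (K <= m)%N ->
  (forall j, (0 < j <= K)%N -> dp K (fun P => d_time (np P j))) -> dp K u ->
  dp K (fun P T Y => d_time (u P) T Y) /\
  ev (fun P => forall T Y : R, is_derive T 1 (fun T' => u P T' Y) (d_time (u P) T Y)).
Proof.
move=> Km Hd [e [eK He]]; have [e' [eK' He']] := dpoly_time Km Hd eK.
have H : ev (fun P => forall T Y : R, is_derive T 1 (fun T' => u P T' Y) (d_time (u P) T Y) /\
    d_time (u P) T Y = dpoly_eval (fun j => np P j T) e' Y).
  apply: ev1 (ev_and He He') _ => P [h1 h2] T Y.
  have D : is_derive T 1 (fun T' => u P T' Y) (dpoly_eval (fun j => np P j T) e' Y).
    rewrite (_ : (fun T' => _) = (fun T' => dpoly_eval (fun j => np P j T') e Y)); first exact: h2.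
    by apply/funext => T'; rewrite h1.
  have E : d_time (u P) T Y = dpoly_eval (fun j => np P j T) e' Y.
    by rewrite /d_time derive1E; apply: derive_val.
  by split => //; rewrite E.
split; last by apply: ev1 H _ => P h T Y; have [] := h T Y.
exists e'; split => //; apply: ev1 H _ => P h T; apply/funext => Y.
by have [] := h T Y.
Qed.

End hierarchy.

Section profiles_are_differential_polynomials.
Context {R : realType}.
Context (m : nat) (tau me : R) (J : antiderivatives R).
Implicit Types (P : profiles R) (u v : profiles R -> R -> R -> R).
Local Notation ev := (ev m tau me J).
Local Notation dp := (dp m tau me J).
Local Notation conv := Defs.conv.

Lemma dp_tpoly_exp K n (x : nat -> profiles R -> R -> R -> R) j r : (0 < K)%N ->
  (forall i, (0 < i <= n)%N -> dp K (x i)) -> (0 < j)%N ->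
  dp K (fun P T Y => (tpoly n (fun i => x i P T Y) ^+ j)`_r).
Proof.
move=> K0 xK; have D1 i : dp K (fun P T Y => (tpoly n (fun i => x i P T Y))`_i).
  have [iN|iN] := boolP (0 < i <= n)%N.
    by apply: dp_ext (xK i iN); apply: ev_hier => *; rewrite tpoly_coef iN.
  by apply: dp_ext (dp_zero _ _ _ _ K0); apply: ev_hier => *; rewrite tpoly_coef (negbTE iN).
elim: j r => [//|[|j] IH] r _.
  by apply: dp_ext (D1 r); apply: ev_hier => *; rewrite expr1.
have D : dp K (fun P T Y => \sum_(i < r.+1) (tpoly n (fun i => x i P T Y))`_i *
    (tpoly n (fun i => x i P T Y) ^+ j.+1)`_(r - i)).
  by apply: dp_sum => // i _; apply: dp_mul => //; exact: IH.
by apply: dp_ext D; apply: ev_hier => *; rewrite exprS coefM.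
Qed.

Lemma dp_log_coef K r (x : nat -> profiles R -> R -> R -> R) : (0 < K)%N ->
  (forall i, (0 < i <= r)%N -> dp K (x i)) ->
  dp K (fun P T Y => log_coef r (fun i => x i P T Y)).
Proof.
move=> K0 xK.
have D : dp K (fun P T Y => \sum_(1 <= j < r.+1) ((-1) ^+ j.+1 / j%:R) *
    (tpoly r (fun i => x i P T Y) ^+ j)`_r).
  apply: dp_sum_nat => // j /andP[j0 _]; apply: dp_scale.
  exact: dp_tpoly_exp.
by apply: dp_ext D; apply: ev_hier => *; rewrite log_coefE.
Qed.

Lemma dp_conv K r (x y : nat -> profiles R -> R -> R -> R) : (0 < K)%N ->
  (forall i, (0 < i < r)%N -> dp K (x i)) -> (forall i, (0 < i < r)%N -> dp K (y i)) ->
  dp K (fun P T Y => conv (fun i => x i P) (fun i => y i P) r T Y).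
Proof.
move=> K0 xK yK; rewrite /conv; apply: dp_sum_nat => // j /andP[j0 jr].
apply: dp_mul; first by apply: xK; rewrite j0.
by apply: yK; rewrite subn_gt0 jr/= ltn_subrL j0 (leq_trans _ jr).
Qed.

Lemma dp_int K k : (1 <= k < m)%N -> (k <= K)%N ->
  [/\ dp K (fun P T Y => dpoly_eval (fun j => np P j T) (int_np J k) Y),
      dp K (fun P T Y => dpoly_eval (fun j => np P j T) (int_nm J k) Y)
    & dp K (fun P T Y => dpoly_eval (fun j => np P j T) (int_vp J k) Y)].
Proof.
move=> km kK; have /andP[k0 _] := km.
have D (e : dpoly R) : ev (fun=> dpoly_upto k e) ->
    dp K (fun P T Y => dpoly_eval (fun j => np P j T) e Y).
  move=> H; have [ke|ke] := boolP (dpoly_upto k e).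
    by exists e; split; [exact: dpoly_upto_le ke|apply: ev_hier].
  (* If the antiderivative involved variables beyond k, the hierarchy would have no solution for
     this J, and any polynomial would do. *)
  exists (DVar _ 1); split; first by rewrite /= (leq_trans k0).
  by apply: ev1 H _ => P; rewrite (negbTE ke).
by split; apply: D; apply: ev_hier => s ini P H; have [[? _] [? _] [? _]] := hier_int H km.
Qed.

(** The modification Q serves two uses: the identity with K = k gives the profiles of order k, and
    [below] with K = k - 1 gives the completion in [lower_part]. *)
Lemma dp_rel K k (Q : profiles R -> profiles R) : (1 < k <= m)%N -> (k.-1 <= K)%N ->
  (forall P j, (0 < j < k)%N -> np (Q P) j = np P j) ->
  (forall j, (0 < j <= k)%N -> dp K (fun P => np (Q P) j)) ->
  (forall j, (0 < j < k)%N -> dp K (fun P => nm (Q P) j)) ->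
  (forall j, (0 < j < k)%N -> dp K (fun P => vp (Q P) j)) ->
  (forall j, (0 < j < k)%N -> dp K (fun P => vm (Q P) j)) ->
  (forall j, (0 < j < k)%N -> dp K (fun P => ph (Q P) j)) ->
  [/\ dp K (fun P => rel_nm (Q P) k), dp K (fun P => rel_vp tau me J (Q P) k),
      dp K (fun P => rel_vm tau me J (Q P) k) & dp K (fun P => rel_ph tau me J (Q P) k)].
Proof.
move=> /andP[k1 km] kK Qnp Dnp Dnm Dvp Dvm Dph.
have k0 : (0 < k)%N by exact: ltnW.
have k1' : (0 < k.-1 < k)%N by rewrite -ltnS prednK// k1 leqnn.
have K0 : (0 < K)%N by case/andP: k1' => /leq_trans ->.
have km' : (1 <= k.-1 < m)%N by case/andP: k1' => -> /leq_trans ->.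
have Dint (e : dpoly R) : ev (fun=> dpoly_upto k.-1 e) ->
    dp K (fun P T Y => dpoly_eval (fun j => np P j T) e Y) ->
    dp K (fun P T Y => dpoly_eval (fun j => np (Q P) j T) e Y).
  move=> H; apply: dp_ext; apply: ev1 H _ => P H T Y.
  congr (_ Y); apply: (eq_dpoly_eval H) => j /andP[j0 jk]; rewrite Qnp//.
  by rewrite j0 -(prednK k0) ltnS.
have [/Dint I1 /Dint I2 /Dint I3] := dp_int km' kK.
have {}I1 := I1 _; have {}I2 := I2 _; have {}I3 := I3 _.
have U : ev (fun=> [/\ dpoly_upto k.-1 (int_np J k.-1), dpoly_upto k.-1 (int_nm J k.-1)
    & dpoly_upto k.-1 (int_vp J k.-1)]).
  by apply: ev_hier => s ini P H; have [[? _] [? _] [? _]] := hier_int H km'.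
have {}I1 : dp K (fun P T Y => dpoly_eval (fun j => np (Q P) j T) (int_np J k.-1) Y).
  by apply: I1; apply: ev1 U _ => P [].
have {}I2 : dp K (fun P T Y => dpoly_eval (fun j => np (Q P) j T) (int_nm J k.-1) Y).
  by apply: I2; apply: ev1 U _ => P [].
have {}I3 : dp K (fun P T Y => dpoly_eval (fun j => np (Q P) j T) (int_vp J k.-1) Y).
  by apply: I3; apply: ev1 U _ => P [].
have Dk := Dnp k _; rewrite k0 leqnn in Dk; have {}Dk := Dk isT.
have Dnp' j : (0 < j < k)%N -> dp K (fun P => np (Q P) j).
  by move=> /andP[j0 jk]; apply: Dnp; rewrite j0 ltnW.
have R1 : dp K (fun P => rel_nm (Q P) k).
  by apply: dp_add => //; do 2 apply: dp_space; exact: Dph.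
have R2 : dp K (fun P => rel_vp tau me J (Q P) k).
  by apply: dp_sub; [apply: dp_sub => //; exact: dp_scale|exact: dp_conv].
split => //.
- apply: dp_sub; last exact: dp_conv.
  by apply: dp_sub => //; apply: dp_scale.
- apply: dp_sub; last by apply: dp_scale; exact: dp_conv.
  apply: dp_sub => //; apply: dp_sub; first exact: dp_scale.
  by apply: dp_scale; apply: dp_log_coef.
Qed.

Lemma dp_solvability K k (Q : profiles R -> profiles R) : (0 < K)%N -> (0 < k)%N ->
  (forall j, (0 < j <= k.+1)%N -> dp K (fun P => np (Q P) j)) ->
  (forall j, (0 < j <= k.+1)%N -> dp K (fun P => nm (Q P) j)) ->
  (forall j, (0 < j <= k.+1)%N -> dp K (fun P => vp (Q P) j)) ->
  (forall j, (0 < j <= k.+1)%N -> dp K (fun P => vm (Q P) j)) ->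
  (forall j, (0 < j <= k.+1)%N -> dp K (fun P => ph (Q P) j)) ->
  dp K (fun P T Y => d_time (np (Q P) k) T Y) ->
  dp K (fun P T Y => d_time (nm (Q P) k) T Y) ->
  dp K (fun P T Y => d_time (vp (Q P) k) T Y) ->
  dp K (fun P T Y => d_time (vm (Q P) k) T Y) ->
  [/\ dp K (fun P T Y => mass_lhs tau me (np (Q P)) (vp (Q P)) k T Y),
      dp K (fun P T Y => mass_lhs tau me (nm (Q P)) (vm (Q P)) k T Y),
      dp K (fun P T Y => ion_lhs tau me (Q P) k T Y),
      dp K (fun P T Y => electron_lhs tau me (Q P) k T Y)
    & dp K (fun P T Y => solvability tau me (Q P) k T Y)].
Proof.
move=> K0 k0 Dnp Dnm Dvp Dvm Dph Tnp Tnm Tvp Tvm.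
have k1 : (0 < k.+1 <= k.+1)%N by rewrite leqnn.
have k2 : (0 < k <= k.+1)%N by rewrite k0 leqnSn.
have C (x y : profiles R -> nat -> R -> R -> R) :
    (forall j, (0 < j <= k.+1)%N -> dp K (fun P => x P j)) ->
    (forall j, (0 < j <= k.+1)%N -> dp K (fun P => y P j)) ->
    dp K (fun P T Y => d_space (conv (x P) (y P) k.+1) T Y).
  move=> Dx Dy; apply: dp_space; apply: (@dp_conv _ _ (fun j P => x P j) (fun j P => y P j)) => // j.
    by move=> /andP[j0 jk]; apply: Dx; rewrite j0 ltnW.
  by move=> /andP[j0 jk]; apply: Dy; rewrite j0 ltnW.
have M (n v : profiles R -> nat -> R -> R -> R) :
    (forall j, (0 < j <= k.+1)%N -> dp K (fun P => n P j)) ->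
    (forall j, (0 < j <= k.+1)%N -> dp K (fun P => v P j)) ->
    dp K (fun P T Y => d_time (n P k) T Y) ->
    dp K (fun P T Y => mass_lhs tau me (n P) (v P) k T Y).
  move=> Dn Dv Tn; apply: dp_sub; last by apply: dp_scale; apply: dp_space; exact: Dn.
  by apply: dp_add; [apply: dp_add => //; apply: dp_space; exact: Dv|exact: C].
have Lg (n : profiles R -> nat -> R -> R -> R) :
    (forall j, (0 < j <= k.+1)%N -> dp K (fun P => n P j)) ->
    dp K (fun P T Y => d_space (ell (n P) k.+1) T Y).
  by move=> Dn; apply: dp_space; apply: (@dp_log_coef _ _ (fun j P => n P j)).
have S (x : profiles R -> nat -> R -> R -> R) :
    (forall j, (0 < j <= k.+1)%N -> dp K (fun P => x P j)) ->
    dp K (fun P T Y => d_space (x P k.+1) T Y).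
  by move=> Dx; apply: dp_space; exact: Dx.
have M1 := M _ _ Dnp Dvp Tnp; have M2 := M _ _ Dnm Dvm Tnm.
have I1 : dp K (fun P T Y => ion_lhs tau me (Q P) k T Y).
  apply: dp_add; last exact: (S (fun P => ph (Q P))).
  apply: dp_add; last by apply: dp_scale; exact: (Lg (fun P => np (Q P))).
  apply: dp_add; last by apply: dp_scale; exact: (C (fun P => vp (Q P)) (fun P => vp (Q P))).
  by apply: dp_sub => //; apply: dp_scale; exact: (S (fun P => vp (Q P))).
have E1 : dp K (fun P T Y => electron_lhs tau me (Q P) k T Y).
  apply: dp_sub; last exact: (S (fun P => ph (Q P))).
  apply: dp_add; last exact: (Lg (fun P => nm (Q P))).
  apply: dp_scale; apply: dp_add; last by apply: dp_scale; exact: (C (fun P => vm (Q P)) (fun P => vm (Q P))).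
  by apply: dp_sub => //; apply: dp_scale; exact: (S (fun P => vm (Q P))).
split => //.
apply: dp_add; last exact: dp_scale.
apply: dp_add; last exact: dp_scale.
apply: dp_add; last exact: dp_scale.
apply: dp_add; last exact: dp_scale.
apply: dp_scale; apply: dp_space; apply: dp_sub; last exact: Dnm.
by apply: dp_add; [do 2 apply: dp_space; exact: Dph|exact: Dnp].
Qed.

End profiles_are_differential_polynomials.

(** * Induction along the hierarchy *)

Section hierarchy_induction.
Context {R : realType}.
Context (m : nat) (tau me : R) (J : antiderivatives R).
Implicit Types (P : profiles R) (u v : profiles R -> R -> R -> R).
Local Notation ev := (ev m tau me J).
Local Notation dp := (dp m tau me J).
Local Notation conv := Defs.conv.

Lemma dp_below K k (f : profiles R -> nat -> R -> R -> R) j : (0 < K)%N -> (k <= K.+1)%N ->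
  (forall i, (0 < i < k)%N -> dp i (fun P => f P i)) -> (0 < j)%N ->
  dp K (fun P => if (j < k)%N then f P j else fun _ _ => 0).
Proof.
move=> K0 kK H j0; have [jk|jk] := boolP (j < k)%N; last exact: dp_zero.
by apply: (@dp_le _ _ _ _ _ j); [rewrite -ltnS (leq_trans jk)|apply: H; rewrite j0].
Qed.

Definition dp_profiles k :=
  [/\ dp k (fun P => nm P k), dp k (fun P => vp P k), dp k (fun P => vm P k),
      dp k (fun P => ph P k) & dp k (fun P => d_time (np P k))].

(** The forcing of order k contains T-derivatives of profiles, but only of those built from orders
    below k, where the induction hypothesis already expresses them. *)
Lemma dp_lower_part k : (1 < k <= m)%N -> (forall j, (0 < j < k)%N -> dp_profiles j) ->
  [/\ dp k.-1 (fun P => rel_nm (below P k) k),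
      dp k.-1 (fun P => rel_vp tau me J (below P k) k),
      dp k.-1 (fun P => rel_vm tau me J (below P k) k),
      dp k.-1 (fun P => rel_ph tau me J (below P k) k)
    & dp k.-1 (fun P T Y => solvability tau me (lower_part tau me J P k) k T Y)].
Proof.
move=> km IH; have /andP[k1 km'] := km.
have k0 : (0 < k)%N by exact: ltnW.
have K0 : (0 < k.-1)%N by rewrite -ltnS prednK.
have kK : (k <= k.-1.+1)%N by rewrite prednK.
have Km : (k.-1 <= m)%N by rewrite (leq_trans (leq_pred _)).
have Hd j : (0 < j <= k.-1)%N -> dp k.-1 (fun P => d_time (np P j)).
  move=> /andP[j0 jk]; have jk' : (0 < j < k)%N by rewrite j0 -(prednK k0) ltnS.
  by have [_ _ _ _] := IH j jk'; exact: dp_le.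
have Bnp j : (0 < j)%N -> dp k.-1 (fun P => np (below P k) j).
  by apply: dp_below => // i /andP[i0 _]; apply: dp_var; rewrite i0 leqnn.
have Bnm j : (0 < j)%N -> dp k.-1 (fun P => nm (below P k) j).
  by apply: dp_below => // i /IH[].
have Bvp j : (0 < j)%N -> dp k.-1 (fun P => vp (below P k) j).
  by apply: dp_below => // i /IH[].
have Bvm j : (0 < j)%N -> dp k.-1 (fun P => vm (below P k) j).
  by apply: dp_below => // i /IH[].
have Bph j : (0 < j)%N -> dp k.-1 (fun P => ph (below P k) j).
  by apply: dp_below => // i /IH[].
have [R1 R2 R3 R4] : [/\ dp k.-1 (fun P => rel_nm (below P k) k),
   dp k.-1 (fun P => rel_vp tau me J (below P k) k),
   dp k.-1 (fun P => rel_vm tau me J (below P k) k) &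
   dp k.-1 (fun P => rel_ph tau me J (below P k) k)].
  apply: dp_rel => //.
  - by move=> P j /andP[_ jk]; rewrite /= jk.
  - by move=> j /andP[j0 _]; exact: Bnp.
  - by move=> j /andP[j0 _]; exact: Bnm.
  - by move=> j /andP[j0 _]; exact: Bvp.
  - by move=> j /andP[j0 _]; exact: Bvm.
  - by move=> j /andP[j0 _]; exact: Bph.
split => //.
pose L P := lower_part tau me J P k.
have E (w : profiles R -> R -> R -> R) (b : profiles R -> nat -> R -> R -> R) j :
    dp k.-1 w -> (forall j, (0 < j)%N -> dp k.-1 (fun P => b P j)) -> (0 < j)%N ->
    dp k.-1 (fun P => if j == k then w P else b P j).
  by move=> Dw Db j0; case: eqP => // _; exact: Db.
have Lnp j : (0 < j <= k.+1)%N -> dp k.-1 (fun P => np (L P) j).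
  by move=> /andP[j0 _]; exact: Bnp.
have Lnm j : (0 < j <= k.+1)%N -> dp k.-1 (fun P => nm (L P) j).
  by move=> /andP[j0 _]; apply: (E _ (fun P => nm (below P k))).
have Lvp j : (0 < j <= k.+1)%N -> dp k.-1 (fun P => vp (L P) j).
  by move=> /andP[j0 _]; apply: (E _ (fun P => vp (below P k))).
have Lvm j : (0 < j <= k.+1)%N -> dp k.-1 (fun P => vm (L P) j).
  by move=> /andP[j0 _]; apply: (E _ (fun P => vm (below P k))).
have Lph j : (0 < j <= k.+1)%N -> dp k.-1 (fun P => ph (L P) j).
  by move=> /andP[j0 _]; apply: (E _ (fun P => ph (below P k))).
have kk : (0 < k <= k.+1)%N by rewrite k0 leqnSn.
have Tt u : dp k.-1 u -> dp k.-1 (fun P T Y => d_time (u P) T Y).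
  by move=> /(dp_time Km Hd)[].
have [] // := @dp_solvability _ m tau me J k.-1 k L K0 k0 Lnp Lnm Lvp Lvm Lph.
- exact: Tt (Lnp _ kk).
- exact: Tt (Lnm _ kk).
- exact: Tt (Lvp _ kk).
- exact: Tt (Lvm _ kk).
Qed.

(** The T-derivative of n_+^(k) belongs to the induction statement: the KdV equation of order k
    yields it from lower T-derivatives, and the next forcing needs it. *)
Lemma hierarchy_dp k : (0 < k <= m)%N -> dp_profiles k.
Proof.
elim/ltn_ind: k => k IH /andP[k0 km].
have Dk : dp k (fun P => np P k) by apply: dp_var; rewrite k0 leqnn.
have [k1|k1] := leqP k 1.
  have {k1} E : k = 1%N by apply/eqP; rewrite eqn_leq k1.
  subst k.
  have S (a : R) u : ev (fun P => forall T Y, u P T Y = a * np P 1 T Y) -> dp 1 u.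
    by move=> H; apply: dp_ext H _; exact: dp_scale.
  have Rel : ev (relations_1 tau me) by apply: ev_hier => s ini P; exact: hier_rel_1.
  split.
  - by apply: (S 1); apply: ev1 Rel _ => P H T Y; rewrite mul1r; have [] := H T Y.
  - by apply: (S (speed tau me)); apply: ev1 Rel _ => P H T Y; have [] := H T Y.
  - by apply: (S (speed tau me)); apply: ev1 Rel _ => P H T Y; have [] := H T Y.
  - by apply: (S ((1 - tau * me) / (1 + me))); apply: ev1 Rel _ => P H T Y; have [] := H T Y.
  - have D : dp 1 (fun P T Y => - (speed tau me * (np P 1 T Y * d_space (np P 1) T Y))
      - dispersion tau me * d_space (d_space (d_space (np P 1))) T Y).
      apply: dp_sub; last by apply: dp_scale; do 3 apply: dp_space.
      apply: dp_opp; apply: dp_scale; apply: dp_mul => //; exact: dp_space.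
    apply: dp_ext D; apply: ev_hier => s ini P /hier_kdv_1 H T Y.
    by have := H T Y; clear; move=> H; apply/eqP; rewrite -subr_eq0 -H; apply/eqP; ring.
have kk : (1 < k <= m)%N by rewrite k1.
have IH' j : (0 < j < k)%N -> dp_profiles j.
  by move=> /andP[j0 jk]; apply: IH => //; rewrite j0 (leq_trans (ltnW jk)).
have [_ _ _ _ Dsol] := dp_lower_part kk IH'.
have LE j (f : profiles R -> R -> R -> R) : (j < k)%N -> dp j f -> dp k f.
  by move=> jk; apply: dp_le; exact: ltnW.
have [R1 R2 R3 R4] : [/\ dp k (fun P => rel_nm P k),
   dp k (fun P => rel_vp tau me J P k),
   dp k (fun P => rel_vm tau me J P k) &
   dp k (fun P => rel_ph tau me J P k)].
  apply: (@dp_rel _ m tau me J k k id) => //.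
  - exact: leq_pred.
  - by move=> j jk; exact: dp_var.
  - by move=> j jk; have [*] := IH' j jk; have /andP[_ ?] := jk; exact: (LE j).
  - by move=> j jk; have [*] := IH' j jk; have /andP[_ ?] := jk; exact: (LE j).
  - by move=> j jk; have [*] := IH' j jk; have /andP[_ ?] := jk; exact: (LE j).
  - by move=> j jk; have [*] := IH' j jk; have /andP[_ ?] := jk; exact: (LE j).
have Rel : ev (fun P => relations_at tau me J P k).
  by apply: ev_hier => s ini P H; exact: hier_rel H k kk.
split.
- by apply: dp_ext R1; apply: ev1 Rel _ => P H T Y; have [] := H T Y.
- by apply: dp_ext R2; apply: ev1 Rel _ => P H T Y; have [] := H T Y.
- by apply: dp_ext R3; apply: ev1 Rel _ => P H T Y; have [] := H T Y.
- by apply: dp_ext R4; apply: ev1 Rel _ => P H T Y; have [] := H T Y.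
have D1 : dp k (fun P => np P 1) by apply: dp_var.
have D : dp k (fun P T Y => (- (2 * speed tau me * (1 + tau) * (1 + me))^-1) *
      solvability tau me (lower_part tau me J P k) k T Y
    - speed tau me * d_space (fun T' Y' => np P 1 T' Y' * np P k T' Y') T Y
    - dispersion tau me * d_space (d_space (d_space (np P k))) T Y).
  apply: dp_sub; last by apply: dp_scale; do 3 apply: dp_space.
  apply: dp_sub; last first.
    by apply: dp_scale; apply: (@dp_space _ _ _ _ _ _ (fun P T' Y' => np P 1 T' Y' * np P k T' Y')); exact: dp_mul.
  by apply: dp_scale; apply: dp_le Dsol; exact: leq_pred.
apply: dp_ext D; apply: ev_hier => s ini P H T Y.
have := hier_kdv H kk T Y; rewrite /forcing; clear => H.
move: H; set z := solvability _ _ _ _ _ _; set i := (_ * _)^-1 => H.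
by rewrite (_ : - i * z = - z * i); [rewrite -H; ring|ring].
Qed.

Lemma hierarchy_dp_le k : (0 < k <= m)%N ->
  [/\ dp m (fun P => np P k), dp m (fun P => nm P k), dp m (fun P => vp P k),
      dp m (fun P => vm P k) & dp m (fun P => ph P k)].
Proof.
move=> km; have [Dnm Dvp Dvm Dph _] := hierarchy_dp km; have /andP[_ km'] := km.
by split; [exact: dp_var|exact: dp_le Dnm|exact: dp_le Dvp|exact: dp_le Dvm|exact: dp_le Dph].
Qed.

Lemma dp_time_le u : dp m u -> dp m (fun P T Y => d_time (u P) T Y) /\
  ev (fun P => forall T Y : R, is_derive T 1 (fun T' => u P T' Y) (d_time (u P) T Y)).
Proof.
apply: dp_time => // j jm; have [_ _ _ _] := hierarchy_dp jm.
by apply: dp_le; case/andP: jm.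
Qed.

End hierarchy_induction.

(** * The order-k evolution system *)

Section evolution_system.
Context {R : realType}.
Context (m : nat) (tau me : R) (J : antiderivatives R).
Implicit Types (P : profiles R) (u v : profiles R -> R -> R -> R) (f g h : R -> R -> R).
Local Notation ev := (ev m tau me J).
Local Notation dp := (dp m tau me J).
Local Notation conv := Defs.conv.
Local Notation c := (speed tau me).

Definition space_regular f :=
  forall T Y : R, is_derive Y 1 (f T) (d_space f T Y).
Definition time_regular f :=
  forall T Y : R, is_derive T 1 (fun T' => f T' Y) (d_time f T Y).

Lemma d_space_eq f (d T Y : R) : is_derive Y 1 (f T) d -> d_space f T Y = d.
Proof. by move=> D; rewrite /d_space derive1E; apply: derive_val. Qed.

Lemma d_time_eq f (d T Y : R) : is_derive T 1 (fun T' => f T' Y) d -> d_time f T Y = d.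
Proof. by move=> D; rewrite /d_time derive1E; apply: derive_val. Qed.

Lemma is_derive_sub (f g : R -> R) (df dg x : R) : is_derive x 1 f df ->
  is_derive x 1 g dg -> is_derive x 1 (fun y => f y - g y) (df - dg).
Proof. by move=> Df Dg; exact: is_deriveB. Qed.

Lemma is_derive_scale (a : R) (f : R -> R) (df x : R) : is_derive x 1 f df ->
  is_derive x 1 (fun y => a * f y) (a * df).
Proof. by move=> Df; exact: is_deriveZ. Qed.

Lemma is_derive_lin (f g : R -> R) (a df dg x : R) : is_derive x 1 f df ->
  is_derive x 1 g dg -> is_derive x 1 (fun y => f y + a * g y) (df + a * dg).
Proof. by move=> Df Dg; apply: is_deriveD; exact: is_deriveZ. Qed.

Lemma d_space_lin f g h (a : R) : space_regular f -> space_regular g ->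
  (forall T Y, h T Y = f T Y + a * g T Y) ->
  (forall T Y, d_space h T Y = d_space f T Y + a * d_space g T Y) /\ space_regular h.
Proof.
move=> rf rg hE.
have D (T Y : R) : is_derive Y 1 (h T) (d_space f T Y + a * d_space g T Y).
  rewrite (_ : h T = fun Y => f T Y + a * g T Y); last exact/funext.
  exact: is_derive_lin.
by split => T Y; [exact: d_space_eq|rewrite (d_space_eq (D T Y))].
Qed.

Lemma d_time_lin f g h (a : R) : time_regular f -> time_regular g ->
  (forall T Y, h T Y = f T Y + a * g T Y) ->
  forall T Y, d_time h T Y = d_time f T Y + a * d_time g T Y.
Proof.
move=> rf rg hE T Y; apply: d_time_eq.
rewrite (_ : (fun T' => _) = fun T' => f T' Y + a * g T' Y); last exact/funext.
exact: is_derive_lin (rf _ _) (rg _ _).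
Qed.

Lemma d_space0 (T Y : R) : d_space (fun _ _ => 0 : R) T Y = 0.
Proof. by rewrite /d_space derive1_cst. Qed.

Lemma d_time0 (T Y : R) : d_time (fun _ _ => 0 : R) T Y = 0.
Proof. by rewrite /d_time derive1_cst. Qed.

Lemma dp_space_regular u : dp m u -> ev (fun P => space_regular (u P)).
Proof.
move=> /(dp_derivable (leqnn m)) H; apply: ev1 H _ => P H T Y.
by rewrite /d_space derive1E; apply: derivableP; exact: H.
Qed.

Lemma dp_time_regular u : dp m u -> ev (fun P => time_regular (u P)).
Proof. by move=> /dp_time_le[]. Qed.

(** In a convolution of order k + 1 an entry of order k > 1 meets only entries of order 1, so a
    change at order k acts linearly. *)
Lemma conv_diff k (a b a' b' : nat -> R -> R -> R) (T Y : R) : (1 < k)%N ->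
  (forall j, (0 < j < k)%N -> a j = a' j) -> (forall j, (0 < j < k)%N -> b j = b' j) ->
  conv a b k.+1 T Y - conv a' b' k.+1 T Y =
  a 1%N T Y * (b k T Y - b' k T Y) + (a k T Y - a' k T Y) * b 1%N T Y.
Proof.
move=> k1 aa bb; have k0 : (0 < k)%N by exact: ltnW.
have E (x y : nat -> R -> R -> R) : conv x y k.+1 T Y = x 1%N T Y * y k T Y +
    \sum_(2 <= i < k) x i T Y * y (k.+1 - i)%N T Y + x k T Y * y 1%N T Y.
  by rewrite /conv big_nat_recr//= big_ltn// subSS subn0 subSnn.
have S : \sum_(2 <= i < k) a i T Y * b (k.+1 - i)%N T Y =
    \sum_(2 <= i < k) a' i T Y * b' (k.+1 - i)%N T Y.
  by apply: eq_big_nat => i ik; rewrite aa ?bb//; lia.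
by rewrite !E S -(aa 1%N) ?k1// -(bb 1%N) ?k1//; ring.
Qed.

Lemma eq_conv k (a b a' b' : nat -> R -> R -> R) (T Y : R) :
  (forall j, (0 < j < k)%N -> a j = a' j) -> (forall j, (0 < j < k)%N -> b j = b' j) ->
  conv a b k T Y = conv a' b' k T Y.
Proof.
by move=> aa bb; rewrite /conv; apply: eq_big_nat => i ik; rewrite aa// bb//; lia.
Qed.

Context (htau : 0 <= tau) (hme : 0 < me).

Lemma speed_gt0 : 0 < c.
Proof. by rewrite /speed sqrtr_gt0 divr_gt0//; [rewrite ltr_pwDl|rewrite addr_gt0]. Qed.

(** Written so as to eliminate tau: the coefficient identities become rational in c and [me],
    without square roots. *)
Lemma speed_sqr : tau = c ^+ 2 * (1 + me) - 1.
Proof.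
rewrite /speed sqr_sqrtr; last by rewrite divr_ge0// addr_ge0// ltW.
by rewrite divfK; [ring|rewrite gt_eqF// addr_gt0].
Qed.

Lemma ion_mass_poisson k : (0 < k < m)%N -> ev (fun P => forall T Y : R,
  [/\ mass_lhs tau me (np P) (vp P) k T Y = 0, mass_lhs tau me (nm P) (vm P) k T Y = 0,
      ion_lhs tau me P k T Y = 0 & poisson_lhs P k T Y = 0]).
Proof.
move=> /andP[k0 km].
have k1m : (0 < k.+1 <= m)%N by [].
have m0 : (0 < m)%N by exact: leq_trans km.
have D j : (0 < j <= k.+1)%N -> [/\ dp m (fun P => np P j), dp m (fun P => nm P j),
    dp m (fun P => vp P j), dp m (fun P => vm P j) & dp m (fun P => ph P j)].
  by move=> /andP[j0 jk]; apply: hierarchy_dp_le; rewrite j0 (leq_trans jk).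
have D' j : (0 < j < k.+1)%N -> [/\ dp m (fun P => np P j), dp m (fun P => nm P j),
    dp m (fun P => vp P j), dp m (fun P => vm P j) & dp m (fun P => ph P j)].
  by move=> /andP[j0 jk]; apply: D; rewrite j0 ltnW.
have [Dnp Dnm Dvp Dvm Dph] := D k.+1 (leqnn _).
have C1 : dp m (fun P => conv (np P) (vp P) k.+1).
  by apply: (@dp_conv _ m tau me J m k.+1 (fun j P => np P j) (fun j P => vp P j)) => // j /D'[].
have C2 : dp m (fun P => conv (nm P) (vm P) k.+1).
  by apply: (@dp_conv _ m tau me J m k.+1 (fun j P => nm P j) (fun j P => vm P j)) => // j /D'[].
have C3 : dp m (fun P => conv (vp P) (vp P) k.+1).
  by apply: (@dp_conv _ m tau me J m k.+1 (fun j P => vp P j) (fun j P => vp P j)) => // j /D'[].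
have E1 : dp m (fun P => ell (np P) k.+1).
  by apply: (@dp_log_coef _ m tau me J m k.+1 (fun j P => np P j)) => // j /D[].
have Rel : ev (fun P => relations_at tau me J P k.+1).
  by apply: ev_hier => s ini P H; apply: (hier_rel H); rewrite ltnS k0.
have Int : ev (fun P => antiderivatives_at J P k).
  by apply: ev_hier => s ini P H; apply: (hier_int H); rewrite k0.
have A := ev_and (dp_space_regular Dnp) (ev_and (dp_space_regular Dnm)
  (ev_and (dp_space_regular Dvp) (ev_and (dp_space_regular C1) (ev_and (dp_space_regular C2)
  (ev_and (dp_space_regular C3) (dp_space_regular E1)))))).
apply: ev1 (ev_and A (ev_and Rel Int)) _.
move=> P [[rnp [rnm [rvp [rc1 [rc2 [rc3 re1]]]]]] [rel [[_ i1] [_ i2] [_ i3]]]] T Y.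
split.
- suff E : d_space (vp P k.+1) T Y = c * d_space (np P k.+1) T Y
      - d_time (np P k) T Y - d_space (conv (np P) (vp P) k.+1) T Y by rewrite /mass_lhs E; ring.
  apply: d_space_eq.
  rewrite (_ : vp P k.+1 T = fun Y => c * np P k.+1 T Y -
    dpoly_eval (fun j => np P j T) (int_np J k) Y - conv (np P) (vp P) k.+1 T Y); last first.
    by apply/funext => y; have [] := rel T y.
  exact: is_derive_sub (is_derive_sub (is_derive_scale c (rnp T Y)) (i1 T Y)) (rc1 T Y).
- suff E : d_space (vm P k.+1) T Y = c * d_space (nm P k.+1) T Y
      - d_time (nm P k) T Y - d_space (conv (nm P) (vm P) k.+1) T Y by rewrite /mass_lhs E; ring.
  apply: d_space_eq.
  rewrite (_ : vm P k.+1 T = fun Y => c * nm P k.+1 T Y -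
    dpoly_eval (fun j => np P j T) (int_nm J k) Y - conv (nm P) (vm P) k.+1 T Y); last first.
    by apply/funext => y; have [e1 _ e2 _] := rel T y; rewrite e2 /rel_vm -e1.
  exact: is_derive_sub (is_derive_sub (is_derive_scale c (rnm T Y)) (i2 T Y)) (rc2 T Y).
- suff E : d_space (ph P k.+1) T Y = c * d_space (vp P k.+1) T Y
      - tau * d_space (ell (np P) k.+1) T Y - d_time (vp P k) T Y
      - 2^-1 * d_space (conv (vp P) (vp P) k.+1) T Y by rewrite /ion_lhs E; ring.
  apply: d_space_eq.
  rewrite (_ : ph P k.+1 T = fun Y => c * vp P k.+1 T Y - tau * ell (np P) k.+1 T Y -
    dpoly_eval (fun j => np P j T) (int_vp J k) Y - 2^-1 * conv (vp P) (vp P) k.+1 T Y); last first.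
    by apply/funext => y; have [_ e1 _ e2] := rel T y; rewrite e2 /rel_ph -e1.
  apply: is_derive_sub (is_derive_scale _ (rc3 T Y)).
  apply: is_derive_sub (i3 T Y).
  exact: is_derive_sub (is_derive_scale _ (rvp T Y)) (is_derive_scale _ (re1 T Y)).
- by rewrite /poisson_lhs; have [e1 _ _ _] := rel T Y; rewrite e1 /rel_nm/=; ring.
Qed.

End evolution_system.

(** * The KdV equations as solvability conditions *)

Section solvability_condition.
Context {R : realType}.
Context (m : nat) (tau me : R) (J : antiderivatives R).
Implicit Types (P : profiles R) (u v : profiles R -> R -> R -> R) (f g h : R -> R -> R).
Local Notation ev := (ev m tau me J).
Local Notation dp := (dp m tau me J).
Local Notation conv := Defs.conv.
Local Notation c := (speed tau me).

Lemma d_space_poisson P k :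
  space_regular (d_space (d_space (ph P k))) -> space_regular (np P k.+1) ->
  space_regular (nm P k.+1) -> forall T Y, d_space (poisson_lhs P k) T Y =
  d_space (d_space (d_space (ph P k))) T Y + d_space (np P k.+1) T Y - d_space (nm P k.+1) T Y.
Proof.
move=> rph rnp rnm T Y.
have [E1 r1] := @d_space_lin _ _ _ (fun T Y => d_space (d_space (ph P k)) T Y + 1 * np P k.+1 T Y)
  1 rph rnp (fun _ _ => erefl).
have hE T' Y' : poisson_lhs P k T' Y' =
    d_space (d_space (ph P k)) T' Y' + 1 * np P k.+1 T' Y' + (-1) * nm P k.+1 T' Y'.
  by rewrite /poisson_lhs; ring.
by have [-> _] := d_space_lin r1 rnm hE; rewrite E1; ring.
Qed.

Lemma d_space3_lin f g h (a : R) : space_regular f -> space_regular g ->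
  space_regular (d_space f) -> space_regular (d_space g) ->
  space_regular (d_space (d_space f)) -> space_regular (d_space (d_space g)) ->
  (forall T Y, h T Y = f T Y + a * g T Y) ->
  (forall T Y, d_space (d_space (d_space h)) T Y =
     d_space (d_space (d_space f)) T Y + a * d_space (d_space (d_space g)) T Y) /\
  space_regular (d_space (d_space h)).
Proof.
move=> f0 g0 f1 g1 f2 g2 hE.
have [E1 _] := d_space_lin f0 g0 hE; have [E2 _] := d_space_lin f1 g1 E1.
exact: (d_space_lin f2 g2 E2).
Qed.

Lemma ev_space_regular3 u : dp m u -> ev (fun P => [/\ space_regular (u P),
  space_regular (d_space (u P)) & space_regular (d_space (d_space (u P)))]).
Proof.
move=> D0; have D1 : dp m (fun P => d_space (u P)) by exact: dp_space.
have D2 : dp m (fun P => d_space (d_space (u P))) by exact: dp_space.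
by apply: ev1 (ev_and (dp_space_regular D0) (ev_and (dp_space_regular D1) (dp_space_regular D2))) _ => P [? []].
Qed.

Context (htau : 0 <= tau) (hme : 0 < me).

(** All order-2 terms cancel, and all order-1 profiles are multiples of n_+^(1); what remains is 2 c
    (1 + tau) (1 + me) times the KdV equation. *)
Lemma solvability1 : (1 < m)%N -> ev (fun P => forall T Y : R, solvability tau me P 1 T Y = 0).
Proof.
move=> m1; have m0 : (0 < m)%N by exact: ltnW.
have [Dnp _ _ _ _] := @hierarchy_dp_le _ m tau me J 1 m0.
have [Dnp2 Dnm2 _ _ _] := @hierarchy_dp_le _ m tau me J 2 m1.
have Rel : ev (relations_1 tau me) by apply: ev_hier => s ini P; exact: hier_rel_1.
have Kdv : ev (kdv_1 tau me) by apply: ev_hier => s ini P; exact: hier_kdv_1.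
have Dnn : dp m (fun P T Y => np P 1 T Y * np P 1 T Y) by exact: dp_mul.
have A := ev_and (ev_space_regular3 Dnp) (ev_and (dp_space_regular Dnp2)
  (ev_and (dp_space_regular Dnm2) (ev_and (dp_space_regular Dnn) (dp_time_regular Dnp)))).
apply: ev1 (ev_and A (ev_and Rel Kdv)) _ => P [[[n0 n1 n2] [rnp2 [rnm2 [rnn tn]]]] [rel kdv]] T Y.
have c0 : c != 0 by rewrite gt_eqF// speed_gt0.
have me0 : 1 + me != 0 by rewrite gt_eqF// addr_gt0.
(* The zero function lets a multiple a g be treated as 0 + a g by the linearity lemmas. *)
have z0 : space_regular (fun _ _ => 0 : R).
  by move=> T' Y'; rewrite d_space0; exact: is_derive_cst.
have t0 : time_regular (fun _ _ => 0 : R).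
  by move=> T' Y'; rewrite d_time0; exact: is_derive_cst.
pose k0 := (1 - tau * me) / (1 + me).
have Z : d_space (fun _ _ => 0 : R) = fun _ _ => 0.
  by apply/funext => T'; apply/funext => Y'; rewrite d_space0.
have z1 : space_regular (d_space (fun _ _ => 0 : R)) by rewrite Z.
have z2 : space_regular (d_space (d_space (fun _ _ => 0 : R))) by rewrite !Z.
have phE T' Y' : ph P 1 T' Y' = 0 + k0 * np P 1 T' Y' by rewrite add0r; have [] := rel T' Y'.
have [P3 rph] := d_space3_lin z0 n0 z1 n1 z2 n2 phE.
have z3 : d_space (d_space (d_space (fun _ _ => 0 : R))) T Y = 0 by rewrite !Z.
have N2 (a b : nat -> R -> R -> R) (x y : R) : (forall T Y, a 1%N T Y = x * np P 1 T Y) ->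
    (forall T Y, b 1%N T Y = y * np P 1 T Y) ->
    d_space (conv a b 2) T Y = x * y * d_space (fun T Y => np P 1 T Y * np P 1 T Y) T Y.
  move=> aE bE; have hE T' Y' : conv a b 2 T' Y' = 0 + x * y * (np P 1 T' Y' * np P 1 T' Y').
    by rewrite /conv big_nat1 aE bE; ring.
  by have [-> _] := d_space_lin z0 rnn hE; rewrite d_space0 add0r.
have relnp T' Y' : np P 1 T' Y' = 1 * np P 1 T' Y' by rewrite mul1r.
have relnm T' Y' : nm P 1 T' Y' = 1 * np P 1 T' Y' by rewrite mul1r; have [] := rel T' Y'.
have relvp T' Y' : vp P 1 T' Y' = c * np P 1 T' Y' by have [] := rel T' Y'.
have relvm T' Y' : vm P 1 T' Y' = c * np P 1 T' Y' by have [] := rel T' Y'.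
have E2 (a : nat -> R -> R -> R) : space_regular (a 2%N) ->
    (forall T Y, a 1%N T Y = 1 * np P 1 T Y) ->
    d_space (ell a 2) T Y = d_space (a 2%N) T Y
      - 2^-1 * d_space (fun T Y => np P 1 T Y * np P 1 T Y) T Y.
  move=> ra aE; have hE T' Y' : ell a 2 T' Y' = a 2%N T' Y' + (- 2^-1) * (np P 1 T' Y' * np P 1 T' Y').
    by rewrite /ell log_coef2 aE; ring.
  by have [-> _] := d_space_lin ra rnn hE; rewrite mulNr.
have T1 (w : R -> R -> R) (x : R) : (forall T Y, w T Y = x * np P 1 T Y) ->
    d_time w T Y = x * d_time (np P 1) T Y.
  move=> wE; rewrite (@d_time_lin _ _ _ w x t0 tn) ?d_time0 ?add0r//.
  by move=> T' Y'; rewrite add0r.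
have X : d_space (fun T Y => np P 1 T Y * np P 1 T Y) T Y = 2 * (np P 1 T Y * d_space (np P 1) T Y).
  apply: d_space_eq; have D := is_deriveM (n0 T Y) (n0 T Y).
  by apply: is_derive_eq; rewrite /GRing.scale/=; ring.
have K := kdv T Y.
have P31 := etrans (P3 T Y) (etrans (congr1 (fun z => z + _) z3) (add0r _)).
have SP := d_space_poisson rph rnp2 rnm2 T Y; rewrite P31 in SP.
rewrite /solvability SP /mass_lhs /ion_lhs /electron_lhs.
rewrite (N2 _ _ _ _ relnp relvp) (N2 _ _ _ _ relnm relvm) (N2 _ _ _ _ relvp relvp) (N2 _ _ _ _ relvm relvm).
rewrite (E2 _ rnp2 relnp) (E2 _ rnm2 relnm) (T1 _ _ relnm) (T1 _ _ relvp) (T1 _ _ relvm) X /k0.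
move: K; rewrite /dispersion; set nt := d_time _ _ _; set nx := _ * d_space (np P 1) T Y.
set n3 := d_space (d_space (d_space (np P 1))) T Y.
move=> K; have {K} -> : nt = - (c * nx) - (c ^+ 2 * me - 1) ^+ 2 / (2 * c * (1 + me)) * n3.
  by apply/eqP; rewrite -subr_eq0 -K; apply/eqP; ring.
move: (speed_sqr htau hme) c0 me0; set s := c; clearbody s => tauE c0 me0.
by rewrite tauE; field; rewrite c0 me0.
Qed.

(** P and its lower part L agree below order k; at order k they differ by the multiples 1, 1, c, c,
    c^2 - tau of n_+^(k), and at order k + 1 L is zero. In the difference of the two values of
    [solvability] the order k + 1 cancels, and n_+^(k) enters through 2 c (1 + tau) (1 + me) times
    the linearized KdV operator. The value at L is the forcing up to the opposite factor. *)
Lemma solvability_ge2 k : (1 < k < m)%N ->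
  ev (fun P => forall T Y : R, solvability tau me P k T Y = 0).
Proof.
move=> /andP[k1 km]; have k0 : (0 < k)%N by exact: ltnW.
have m0 : (0 < m)%N by exact: leq_trans km.
have k0m : (0 < k <= m)%N by rewrite k0 ltnW.
have k1m : (0 < k.+1 <= m)%N by [].
have D j : (0 < j <= k.+1)%N -> [/\ dp m (fun P => np P j), dp m (fun P => nm P j),
    dp m (fun P => vp P j), dp m (fun P => vm P j) & dp m (fun P => ph P j)].
  by move=> /andP[j0 jk]; apply: hierarchy_dp_le; rewrite j0 (leq_trans jk).
have D' j : (0 < j < k.+1)%N -> [/\ dp m (fun P => np P j), dp m (fun P => nm P j),
    dp m (fun P => vp P j), dp m (fun P => vm P j) & dp m (fun P => ph P j)].
  by move=> /andP[j0 jk]; apply: D; rewrite j0 ltnW.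
have [Dnp Dnm Dvp Dvm Dph] := hierarchy_dp_le tau me J k0m.
have [Dnp' Dnm' _ _ _] := hierarchy_dp_le tau me J k1m.
have [Dnp1 _ _ _ _] := @hierarchy_dp_le _ m tau me J 1 m0.
have C1 : dp m (fun P => conv (np P) (vp P) k.+1).
  by apply: (@dp_conv _ m tau me J m k.+1 (fun j P => np P j) (fun j P => vp P j)) => // j /D'[].
have C2 : dp m (fun P => conv (nm P) (vm P) k.+1).
  by apply: (@dp_conv _ m tau me J m k.+1 (fun j P => nm P j) (fun j P => vm P j)) => // j /D'[].
have C3 : dp m (fun P => conv (vp P) (vp P) k.+1).
  by apply: (@dp_conv _ m tau me J m k.+1 (fun j P => vp P j) (fun j P => vp P j)) => // j /D'[].
have C4 : dp m (fun P => conv (vm P) (vm P) k.+1).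
  by apply: (@dp_conv _ m tau me J m k.+1 (fun j P => vm P j) (fun j P => vm P j)) => // j /D'[].
have E1 : dp m (fun P => ell (np P) k.+1).
  by apply: (@dp_log_coef _ m tau me J m k.+1 (fun j P => np P j)) => // j /D[].
have E2 : dp m (fun P => ell (nm P) k.+1).
  by apply: (@dp_log_coef _ m tau me J m k.+1 (fun j P => nm P j)) => // j /D[].
have X : dp m (fun P T Y => np P 1 T Y * np P k T Y) by exact: dp_mul.
have A1 := ev_and (ev_space_regular3 Dnp) (ev_and (ev_space_regular3 Dph)
  (ev_and (dp_space_regular Dnp') (dp_space_regular Dnm'))).
have A2 := ev_and (dp_space_regular C1) (ev_and (dp_space_regular C2)
  (ev_and (dp_space_regular C3) (ev_and (dp_space_regular C4)
  (ev_and (dp_space_regular E1) (ev_and (dp_space_regular E2) (dp_space_regular X)))))).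
have A3 := ev_and (dp_time_regular Dnp) (ev_and (dp_time_regular Dnm)
  (ev_and (dp_time_regular Dvp) (dp_time_regular Dvm))).
have A4 : ev (fun P => [/\ relations_1 tau me P, relations_at tau me J P k,
    kdv_at tau me J P k & antiderivatives_at J P k.-1]).
  apply: ev_hier => s ini P H; split; first exact: hier_rel_1 H.
  - by apply: (hier_rel H); rewrite k1 ltnW.
  - by apply: (hier_kdv H); rewrite k1 ltnW.
  - by apply: (hier_int H); rewrite -ltnS prednK// k1 ltnW.
apply: ev1 (ev_and A1 (ev_and A2 (ev_and A3 A4))) _ => P.
case=> [[[n0 n1 n2] [[p0 p1 p2] [rnp' rnm']]] [[c1 [c2 [c3 [c4 [e1 [e2 x0]]]]]]]].
case=> [[tnp [tnm [tvp tvm]]] [rel1 rel kdv [[u1 _] [u2 _] [u3 _]]]] T Y.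
pose L := lower_part tau me J P k; pose B := below P k.
have lek j : (0 < j < k)%N -> (j < k)%N && (j != k) by move=> /andP[_ jk]; rewrite jk ltn_eqF.
have below_eq (f : nat -> R -> R -> R) j : (0 < j < k)%N ->
    f j = if (j < k)%N then f j else fun _ _ => 0 by move=> /andP[_ ->].
have lower_eq (f : nat -> R -> R -> R) (w : R -> R -> R) j : (0 < j < k)%N ->
    f j = if j == k then w else if (j < k)%N then f j else fun _ _ => 0.
  by move=> /andP[_ jk]; rewrite jk ltn_eqF.
have Bev (e : dpoly R) T' : dpoly_upto k.-1 e ->
    dpoly_eval (fun j => np B j T') e = dpoly_eval (fun j => np P j T') e.
  move=> ke; apply: (eq_dpoly_eval ke) => j /andP[_ jk].
  by rewrite /= (leq_ltn_trans jk)// ltn_predL.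
have npL : np L k = fun _ _ => 0 by rewrite /= ltnn.
have nmE T' Y' : nm L k T' Y' = nm P k T' Y' + (-1) * np P k T' Y'.
  have [-> _ _ _] := rel T' Y'; rewrite /L/= eqxx /rel_nm/= ltnn ltn_predL k0; ring.
have vpE T' Y' : vp L k T' Y' = vp P k T' Y' + (- c) * np P k T' Y'.
  have [_ -> _ _] := rel T' Y'; rewrite /L/= eqxx /rel_vp -/B (Bev _ _ u1).
  rewrite (@eq_conv _ k (np B) (vp B) (np P) (vp P)); last 2 first.
  - by move=> j jk; rewrite /= -(below_eq (np P)).
  - by move=> j jk; rewrite /= -(below_eq (vp P)).
  by rewrite /= ltnn; ring.
have vmE T' Y' : vm L k T' Y' = vm P k T' Y' + (- c) * np P k T' Y'.
  have [_ _ -> _] := rel T' Y'; rewrite /L/= eqxx /rel_vm -/B (Bev _ _ u2).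
  rewrite (@eq_conv _ k (nm B) (vm B) (nm P) (vm P)); last 2 first.
  - by move=> j jk; rewrite /= -(below_eq (nm P)).
  - by move=> j jk; rewrite /= -(below_eq (vm P)).
  by rewrite /rel_nm /= ltnn ltn_predL k0; ring.
have phE T' Y' : ph L k T' Y' = ph P k T' Y' + (- (c ^+ 2 - tau)) * np P k T' Y'.
  have [_ ev _ ->] := rel T' Y'; rewrite /rel_ph -ev.
  rewrite {1}/L/= eqxx /rel_ph -/B (Bev _ _ u3).
  rewrite (@eq_conv _ k (vp B) (vp B) (vp P) (vp P)); last 2 first.
  - by move=> j jk; rewrite /= -(below_eq (vp P)).
  - by move=> j jk; rewrite /= -(below_eq (vp P)).
  have := vpE T' Y'; rewrite {1}/L/= eqxx -/B => ->.
  have := @log_coef_diff _ k (fun i => np P i T' Y') (fun i => np B i T' Y') k1.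
  case=> [j jk|_]; first by rewrite /= -(below_eq (np P)).
  rewrite [np B k T' Y'](_ : _ = 0) ?subr0 => [H|]; last by rewrite /= ltnn.
  rewrite [X in _ - tau * X - _ - _ = _](_ : _ = ell (np P) k T' Y' - np P k T' Y'); first by ring.
  by rewrite -H opprB addrC subrK.
have vp1E T' Y' : vp P 1 T' Y' = c * np P 1 T' Y' by have [] := rel1 T' Y'.
have vm1E T' Y' : vm P 1 T' Y' = c * np P 1 T' Y' by have [] := rel1 T' Y'.
have nm1E T' Y' : nm P 1 T' Y' = np P 1 T' Y' by have [] := rel1 T' Y'.
have npE T' Y' : np L k T' Y' = np P k T' Y' + (-1) * np P k T' Y' by rewrite npL; ring.
have Lnp j : (0 < j < k)%N -> np P j = np L j by move=> jk; exact: below_eq.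
have Lnm j : (0 < j < k)%N -> nm P j = nm L j by move=> jk; exact: lower_eq.
have Lvp j : (0 < j < k)%N -> vp P j = vp L j by move=> jk; exact: lower_eq.
have Lvm j : (0 < j < k)%N -> vm P j = vm L j by move=> jk; exact: lower_eq.
have cv (a b a' b' : nat -> R -> R -> R) (x y x1 y1 : R) :
    (forall j, (0 < j < k)%N -> a j = a' j) -> (forall j, (0 < j < k)%N -> b j = b' j) ->
    (forall T Y, a' k T Y = a k T Y + (- x) * np P k T Y) ->
    (forall T Y, b' k T Y = b k T Y + (- y) * np P k T Y) ->
    (forall T Y, a 1%N T Y = x1 * np P 1 T Y) -> (forall T Y, b 1%N T Y = y1 * np P 1 T Y) ->
    space_regular (conv a b k.+1) -> d_space (conv a' b' k.+1) T Y =
      d_space (conv a b k.+1) T Y - (x1 * y + x * y1) * d_space (fun T Y => np P 1 T Y * np P k T Y) T Y.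
  move=> aa bb ak bk a1 b1 rc.
  have hE T' Y' : conv a' b' k.+1 T' Y' = conv a b k.+1 T' Y'
      + (- (x1 * y + x * y1)) * (np P 1 T' Y' * np P k T' Y').
    have := @conv_diff _ k a b a' b' T' Y' k1 aa bb.
    rewrite ak bk a1 b1 => H.
    have -> : conv a' b' k.+1 T' Y' = conv a b k.+1 T' Y' -
      (conv a b k.+1 T' Y' - conv a' b' k.+1 T' Y') by ring.
    by rewrite H; ring.
  by have [-> _] := d_space_lin rc x0 hE; rewrite mulNr.
have np11 T' Y' : np P 1 T' Y' = 1 * np P 1 T' Y' by rewrite mul1r.
have nm11 T' Y' : nm P 1 T' Y' = 1 * np P 1 T' Y' by rewrite mul1r.
have V1 := cv _ _ _ _ _ _ _ _ Lnp Lvp npE vpE np11 vp1E c1.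
have V2 := cv _ _ _ _ _ _ _ _ Lnm Lvm nmE vmE nm11 vm1E c2.
have V3 := cv _ _ _ _ _ _ _ _ Lvp Lvp vpE vpE vp1E vp1E c3.
have V4 := cv _ _ _ _ _ _ _ _ Lvm Lvm vmE vmE vm1E vm1E c4.
(* Passing to L removes from the logarithm of order k + 1 its linear term and the cross term - n^(1)
   n_+^(k). *)
have lg (a a' : nat -> R -> R -> R) : (forall j, (0 < j < k)%N -> a j = a' j) ->
    (forall T Y, a' k T Y = a k T Y + (-1) * np P k T Y) -> a' k.+1 = (fun _ _ => 0) ->
    (forall T Y, a 1%N T Y = np P 1 T Y) -> space_regular (a k.+1) ->
    space_regular (ell a k.+1) -> d_space (ell a' k.+1) T Y = d_space (ell a k.+1) T Y
      - d_space (a k.+1) T Y + d_space (fun T Y => np P 1 T Y * np P k T Y) T Y.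
  move=> aa ak ak1 a1 ra re.
  have [F1 r1] := @d_space_lin _ _ _ (fun T Y => ell a k.+1 T Y + (-1) * a k.+1 T Y)
     (-1) re ra (fun _ _ => erefl).
  have hE T' Y' : ell a' k.+1 T' Y' = ell a k.+1 T' Y' + (-1) * a k.+1 T' Y' +
      1 * (np P 1 T' Y' * np P k T' Y').
    have [|H _] := @log_coef_diff _ k (fun i => a i T' Y') (fun i => a' i T' Y') k1.
      by move=> j jk; rewrite aa.
    move: H; rewrite ak ak1 a1 /ell; clear.
    set u := log_coef _ _; set v := log_coef _ _ => H.
    by rewrite (_ : v = u - (u - v)); [rewrite H; ring|ring].
  by have [-> _] := d_space_lin r1 x0 hE; rewrite F1; ring.
have npL1 : np L k.+1 = fun _ _ => 0 by rewrite /= ltnNge leqnSn.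
have ltf : (k.+1 < k)%N = false by rewrite ltnNge leqnSn.
have nmL1 : nm L k.+1 = fun _ _ => 0 by rewrite /= gtn_eqF// ltf.
have vpL1 : vp L k.+1 = fun _ _ => 0 by rewrite /= gtn_eqF// ltf.
have vmL1 : vm L k.+1 = fun _ _ => 0 by rewrite /= gtn_eqF// ltf.
have phL1 : ph L k.+1 = fun _ _ => 0 by rewrite /= gtn_eqF// ltf.
have G1 := lg _ _ Lnp npE npL1 (fun _ _ => erefl) rnp' e1.
have G2 := lg _ _ Lnm nmE nmL1 nm1E rnm' e2.
have T1 := d_time_lin tnp tnp npE T Y.
have T2 := d_time_lin tnm tnp nmE T Y.
have T3 := d_time_lin tvp tnp vpE T Y.
have T4 := d_time_lin tvm tnp vmE T Y.
have [P3 rph] := d_space3_lin p0 n0 p1 n1 p2 n2 phE.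
have zr : space_regular (fun _ _ => 0 : R).
  by move=> T' Y'; rewrite d_space0; exact: is_derive_cst.
have rnpL : space_regular (np L k.+1) by rewrite npL1.
have rnmL : space_regular (nm L k.+1) by rewrite nmL1.
have SP := d_space_poisson p2 rnp' rnm' T Y.
have SL := d_space_poisson rph rnpL rnmL T Y.
have K := kdv T Y.
have DL : d_space (np L k.+1) T Y = 0 /\ d_space (nm L k.+1) T Y = 0 /\
   d_space (vp L k.+1) T Y = 0 /\ d_space (vm L k.+1) T Y = 0 /\ d_space (ph L k.+1) T Y = 0.
  by rewrite npL1 nmL1 vpL1 vmL1 phL1 d_space0.
case: DL => [DL1 [DL2 [DL3 [DL4 DL5]]]].
rewrite P3 DL1 DL2 in SL.
have c0 : c != 0 by rewrite gt_eqF// speed_gt0.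
have me0 : 1 + me != 0 by rewrite gt_eqF// addr_gt0.
have tau0 : 1 + tau != 0 by rewrite gt_eqF// ltr_pwDl.
have SLE : solvability tau me L k T Y = - (2 * c * (1 + tau) * (1 + me)) * forcing tau me J P k T Y.
  rewrite /forcing -/L; set z := solvability _ _ _ _ _ _; field.
  by rewrite c0 tau0 me0.
move: SLE; rewrite -K /solvability SP SL /mass_lhs /ion_lhs /electron_lhs.
rewrite T1 T2 T3 T4 V1 V2 V3 V4 G1 G2 DL1 DL2 DL3 DL4 DL5 /dispersion.
move: (speed_sqr htau hme) c0 me0; clear; set s := c; clearbody s.
(* With all derivatives turned into independent atoms, the goal and the KdV identity for L differ by
   a rational identity in c and [me]. *)
repeat match goal with |- context [d_space ?f ?t ?y] => generalize (d_space f t y); intro end.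
repeat match goal with |- context [d_time ?f ?t ?y] => generalize (d_time f t y); intro end.
move=> tauE c0 me0.
move/eqP; rewrite -subr_eq0 => /eqP H; rewrite -[RHS]H tauE.
by field; rewrite c0 me0.
Qed.

Lemma evolution k : (0 < k < m)%N -> ev (fun P => forall T Y : R,
  [/\ mass_lhs tau me (np P) (vp P) k T Y = 0, mass_lhs tau me (nm P) (vm P) k T Y = 0,
      ion_lhs tau me P k T Y = 0, electron_lhs tau me P k T Y = 0
    & poisson_lhs P k T Y = 0]).
Proof.
move=> km; have S : ev (fun P => forall T Y : R, solvability tau me P k T Y = 0).
  have [k1|k1] := ltnP 1 k; first by apply: solvability_ge2; rewrite k1; case/andP: km.
  have E : k = 1%N by apply/eqP; rewrite eqn_leq k1; case/andP: km.
  by rewrite E in km *; apply: solvability1.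
apply: ev1 (ev_and S (ion_mass_poisson tau me J km)) _ => P [h1 h2] T Y.
have [e1 e2 e3 e4] := h2 T Y; split => //.
have Z : poisson_lhs P k = fun _ _ => 0.
  by apply/funext => T'; apply/funext => Y'; have [] := h2 T' Y'.
have := h1 T Y; rewrite /solvability Z d_space0 e1 e2 e3 !mulr0 !add0r.
by move/eqP; rewrite mulf_eq0 gt_eqF/= ?ltr_pwDl// => /eqP.
Qed.

End solvability_condition.

(** * Scaled variables and power series in eps *)

Section scaling.
Context {R : realType}.
Local Notation mu := (@lebesgue_measure R).
Implicit Types (f : R -> R) (u : R -> R -> R).

Lemma sqint_affine f (a b : R) : 0 < a -> continuous f ->
  sqint (fun x => f (a * (x - b))) = ((a^-1)%:E * sqint f)%E.
Proof.
move=> a0 cf.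
pose F (x : R) := a * (x - b).
have dF (x : R) : is_derive x 1 F a.
  have D : is_derive x 1 (fun x : R => x - b) (1 - 0).
    by apply: is_deriveB.
  by have := @is_deriveZ _ _ _ _ a _ _ _ D; rewrite subr0 /GRing.scale/= mulr1.
have F' : derive1 F = cst a by apply/funext => x; rewrite derive1E; apply: derive_val.
have cG : continuous (fun x => f x ^+ 2).
  by move=> x; apply: (@cvgM _ _ _ _ f f) ; exact: cf.
have H : (\int[mu]_x ((fun x => f x ^+ 2) x)%:E =
    \int[mu]_x ((((fun x => f x ^+ 2) \o F) * derive1 F)%R x)%:E)%E.
  apply: increasing_ge0_integration_by_substitutionT => //.
  - by move=> x y xy; rewrite /F ltr_pM2l// ltrD2r.
  - by rewrite F' => x; exact: cvg_cst.
  - by rewrite F'; exact: is_cvg_cst.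
  - by rewrite F'; exact: is_cvg_cst.
  - by apply: gt0_cvgMrNy => //; exact: cvg_addrr_Ny.
  - by apply: gt0_cvgMry => //; exact: cvg_addrr.
  - by move=> x; rewrite sqr_ge0.
have mf : measurable_fun setT (fun x => (f (F x) ^+ 2)%:E : \bar R).
  apply/measurable_EFinP; apply: measurable_funX; apply: continuous_measurable_fun => x.
  by apply: continuous_comp; [apply/differentiable_continuous/derivable1_diffP; case: (dF x)|exact: cf].
have E : sqint f = (a%:E * sqint (fun x => f (F x)))%E.
  rewrite {1}/sqint H F' -ge0_integralZl//; last by rewrite lee_fin ltW.
    by apply: eq_integral => x _; rewrite /= mulrC.
  by move=> x _; rewrite lee_fin sqr_ge0.
by rewrite E muleA -EFinM mulVf ?gt_eqF// mul1e.
Qed.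

Lemma smooth0 q : smooth q 0 (fun _ : R => 0 : R).
Proof.
have I : (sqint (fun _ : R => 0%R : R) <= (0 ^+ 2)%:E)%E.
  by rewrite /sqint; under eq_integral do rewrite expr0n/=; rewrite integral0 expr0n.
have C : continuous (fun _ : R => 0 : R) by move=> x; exact: cvg_cst.
have N (x : R) : `|0 : R| <= 0 by rewrite normr0.
elim: q => [|q IH]; first by split.
split; [exact: C|exact: N|exact: I|split; first by move=> x; exact: derivable_cst].
rewrite (_ : derive1 _ = (fun x => 0))//; apply/funext => x.
by rewrite derive1_cst.
Qed.

(** Summands are added one at a time, each addition doubling the constant. *)
Lemma smooth_sum q n (b : nat -> R) (g : nat -> R -> R) :
  (forall r, (r < n)%N -> smooth q (b r) (g r)) ->
  smooth q (\sum_(r < n) 2 ^+ n * b r) (fun x => \sum_(r < n) g r x).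
Proof.
elim: n => [|n IH] H.
  rewrite big_ord0 (_ : (fun x => _) = (fun x => 0)); last by apply/funext => x; rewrite big_ord0.
  exact: smooth0.
have b0 r : (r < n.+1)%N -> 0 <= b r by move=> /H /smooth_ge0.
have S1 := IH (fun r rn => H r (ltnW rn)).
have := smooth_add S1 (H n (ltnSn n)).
rewrite (_ : (fun x => _) = (fun x => \sum_(r < n.+1) g r x)); last first.
  by apply/funext => x; rewrite big_ord_recr.
apply: smooth_le; rewrite big_ord_recr/= mulrDr; apply: lerD.
  rewrite mulr_sumr; apply: ler_sum => i _; rewrite mulrA exprS//.
by rewrite exprS -mulrA ler_pM2l// ler_peMl ?b0// exprn_ege1// ler1n.
Qed.

End scaling.

Section unscaled_derivatives.
Context {R : realType}.
Context (tau me eps : R) (eps0 : 0 < eps).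
Implicit Types (u : R -> R -> R).
Local Notation c := (speed tau me).
Local Notation uns := (unscale tau me eps).
Local Notation TT t := (eps `^ (3 / 2) * t).
Local Notation YY t x := (eps `^ (1 / 2) * (x - c * t)).

Lemma unscale_space u (t x : R) : space_regular u ->
  is_derive x 1 (uns u t) (eps `^ (1 / 2) * d_space u (TT t) (YY t x)).
Proof.
move=> ru; have D : is_derive x 1 (fun x : R => YY t x) (eps `^ (1 / 2)).
  have D1 : is_derive x 1 (fun x : R => x - c * t) (1 - 0) by apply: is_deriveB.
  by have := is_derive_scale (eps `^ (1 / 2)) D1; rewrite subr0 mulr1.
have := @is_derive1_comp _ (u (TT t)) (fun x : R => YY t x) x _ _ (ru (TT t) (YY t x)) D.
by rewrite /GRing.scale/= [X in is_derive _ _ _ X -> _]mulrC; exact.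
Qed.

(** The travelling frame contributes - c d_Y with the factor eps^(1/2), the slow time d_T with
    eps^(3/2); factoring out eps^(1/2) puts the latter one order higher. *)
Lemma unscale_time u (B t x : R) : time_regular u ->
  time_regular (d_space u) ->
  (forall T : R, `|T - TT t| < 1 -> smooth 2 B (u T)) ->
  is_derive t 1 (fun t' => uns u t' x) (eps `^ (1 / 2) *
   (eps * d_time u (TT t) (YY t x) - c * d_space u (TT t) (YY t x))).
Proof.
move=> tu tsu su.
pose b := - (eps `^ (1 / 2) * c); pose d := eps `^ (1 / 2) * x.
have YE t' : YY t' x = b * t' + d by rewrite /b /d; ring.
have := @is_derive_along _ u (d_time u (TT t) (YY t x)) (d_time (d_space u) (TT t) (YY t x))
  B (eps `^ (3 / 2)) b d t.
rewrite -YE => /(_ (tu _ _) (tsu _ _) su).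
rewrite (_ : (fun t' : R => u (TT t') (b * t' + d)) = (fun t' => uns u t' x)); last first.
  by apply/funext => t'; rewrite /unscale YE.
have E : eps `^ (3 / 2) = eps `^ (1 / 2) * eps.
  rewrite -[X in _ = _ * X]powRr1 ?ltW// -powRD; last by rewrite gt_eqF// implybT.
  by congr (_ `^ _); field.
move=> H; apply: (is_derive_eq H); rewrite -/(d_space u (TT t) (YY t x)).
by set p := d_time u _ _; set q := d_space u _ _; rewrite E /b; ring.
Qed.

End unscaled_derivatives.

Section series.
Context {R : realType}.
Implicit Types (u : R -> R -> R) (g a b : nat -> R -> R -> R) (e : R).

Definition ser (n : nat) e g : R -> R -> R :=
  fun T Y => \sum_(r < n) e ^+ r * g r T Y.

Lemma ser_lin n e a b (x T Y : R) :
  ser n e (fun r T Y => a r T Y + x * b r T Y) T Y = ser n e a T Y + x * ser n e b T Y.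
Proof.
by rewrite /ser mulr_sumr -big_split; apply: eq_bigr => r _ /=; ring.
Qed.

(** Multiplication by eps on coefficient sequences; it accounts for the slow time derivative and for
    d_x^2 = eps d_Y^2 in the Poisson equation. *)
Definition shift a : nat -> R -> R -> R :=
  fun r => if r is r'.+1 then a r' else fun _ _ => 0.

Lemma ser_shift n e a (T Y : R) : e * ser n e a T Y = ser n.+1 e (shift a) T Y.
Proof.
rewrite /ser big_ord_recl/= mulr0 add0r mulr_sumr; apply: eq_bigr => r _.
by rewrite exprS mulrA.
Qed.

Lemma ser_widen n e a (T Y : R) : a n T Y = 0 -> ser n.+1 e a T Y = ser n e a T Y.
Proof. by move=> a0; rewrite /ser big_ord_recr/= a0 mulr0 addr0. Qed.

Lemma horner_ser n e (q : R -> R -> {poly R}) (T Y : R) : (size (q T Y) <= n)%N ->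
  (q T Y).[e] = ser n e (fun r T Y => (q T Y)`_r) T Y.
Proof.
move=> qn; rewrite (horner_coef_wide _ qn) /ser; apply: eq_bigr => i _.
by rewrite mulrC.
Qed.

Context (tau me eps : R) (eps0 : 0 < eps).
Local Notation c := (speed tau me).
Local Notation uns := (unscale tau me eps).
Local Notation TT t := (eps `^ (3 / 2) * t).
Local Notation YY t x := (eps `^ (1 / 2) * (x - c * t)).

Lemma space_regular_ser n g : (forall r, (r < n)%N -> space_regular (g r)) ->
  space_regular (ser n eps g) /\
  forall T Y, d_space (ser n eps g) T Y = ser n eps (fun r => d_space (g r)) T Y.
Proof.
move=> rg.
have D (T Y : R) : is_derive Y 1 (ser n eps g T) (ser n eps (fun r => d_space (g r)) T Y).
  elim: n rg => [|n IH] rg.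
    rewrite (_ : ser 0 eps g T = fun _ => 0); last by apply/funext => y; rewrite /ser big_ord0.
    by rewrite /ser big_ord0; exact: is_derive_cst.
  rewrite (_ : ser n.+1 eps g T = fun y => ser n eps g T y + eps ^+ n * g n T y); last first.
    by apply/funext => y; rewrite /ser big_ord_recr.
  rewrite /ser big_ord_recr/=; apply: is_derive_lin; last exact: rg.
  by apply: IH => r rn; apply: rg; exact: ltnW.
by split => T Y; [rewrite (d_space_eq (D T Y))|exact: d_space_eq].
Qed.

Lemma unscale_ser_time n g : (forall r, (r < n)%N -> [/\ space_regular (g r),
    time_regular (g r), time_regular (d_space (g r)) &
    forall T0 : R, exists B : R, forall T : R, `|T| < T0 -> smooth 2 B (g r T)]) ->
  forall t x : R, is_derive t 1 (fun t' => uns (ser n eps g) t' x)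
   (eps `^ (1 / 2) * (eps * ser n eps (fun r => d_time (g r)) (TT t) (YY t x)
     - c * ser n eps (fun r => d_space (g r)) (TT t) (YY t x))).
Proof.
move=> rg t x; elim: n rg => [|n IH] rg.
  rewrite (_ : (fun t' => _) = fun _ => 0); last first.
    by apply/funext => y; rewrite /unscale /ser big_ord0.
  by rewrite /ser !big_ord0 !mulr0 subrr mulr0; exact: is_derive_cst.
rewrite (_ : (fun t' => _) = fun t' => uns (ser n eps g) t' x + eps ^+ n * uns (g n) t' x); last first.
  by apply/funext => t'; rewrite /unscale /ser big_ord_recr.
have [_ tg tsg sg] := rg n (ltnSn n).
have [B HB] := sg (`|TT t| + 1).
have HB' (T : R) : `|T - TT t| < 1 -> smooth 2 B (g n T).
  move=> TT1; apply: HB; rewrite -(subrK (TT t) T) addrC.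
  by rewrite (le_lt_trans (ler_normD _ _))// ltrD2l.
have IH' := IH (fun r rn => rg r (ltnW rn)).
have U := @unscale_time R tau me eps eps0 (g n) B t x tg tsg HB'.
have D := is_derive_lin (eps ^+ n) IH' U; refine (is_derive_eq D _).
by rewrite /ser !big_ord_recr/=; ring.
Qed.

Lemma unscale_ser_space n g : (forall r, (r < n)%N -> space_regular (g r)) ->
  forall t x : R, is_derive x 1 (uns (ser n eps g) t)
   (eps `^ (1 / 2) * ser n eps (fun r => d_space (g r)) (TT t) (YY t x)).
Proof.
by move=> /space_regular_ser[rs E] t x; rewrite -E; exact: unscale_space.
Qed.

End series.

Section series_bound.
Context {R : realType}.
Context (m : nat) (tau me : R) (J : antiderivatives R).
Implicit Types (P : profiles R) (u v : profiles R -> R -> R -> R).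
Local Notation ev := (ev m tau me J).
Local Notation dp := (dp m tau me J).
Local Notation uns eps := (unscale tau me eps).

Lemma uniform_bound W q (G : nat -> profiles R -> R -> R -> R) :
  (forall r, (r < W)%N -> dp m (G r)) -> exists (n : nat) (F : nat -> R -> R),
  ev (fun P => forall r, (r < W)%N -> forall (T B : R),
    (forall j, (0 < j <= m)%N -> smooth n B (np P j T)) -> smooth q (F r B) (G r P T)).
Proof.
elim: W => [|W IH] H; first by exists 0%N, (fun _ _ => 0); apply: ev_hier.
have [n [F HF]] := IH (fun r rW => H r (ltnW rW)).
have [n' [F' HF']] := dp_bound q (leqnn m) (H W (ltnSn W)).
exists (maxn n n'), (fun r => if r == W then F' else F r).
apply: ev1 (ev_and HF HF') _ => P [h1 h2] r; rewrite ltnS leq_eqVlt => rW T B HB.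
have [E|rW'] := eqVneq r W.
  rewrite E; apply: h2 => j jm; apply: smooth_leq (HB j jm); exact: leq_maxr.
apply: h1 => //; first by move: rW; rewrite (negbTE rW').
by move=> j jm; apply: smooth_leq (HB j jm); exact: leq_maxl.
Qed.

Lemma series_bound W (G : nat -> profiles R -> R -> R -> R) :
  (forall r, (r < W)%N -> dp m (G r)) ->
  ev (fun P => forall r, (r < W)%N -> (r <= m)%N -> forall T Y : R, G r P T Y = 0) ->
  exists (n : nat) (F : R -> R), ev (fun P => forall (B eps kappa t : R),
    0 < eps < 1 -> 0 <= t ->
    (forall T : R, 0 <= T -> forall j, (0 < j <= m)%N -> smooth n B (np P j T)) ->
    (L2norm (fun x => kappa * uns eps (ser W eps (fun r => G r P)) t x)%R <=
     (`|kappa| * (eps ^+ m.+1 * eps `^ (- (1 / 4)) * F B))%:E)%E).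
Proof.
move=> HG HZ; have [n [F HF]] := uniform_bound 0 HG.
exists n, (fun B => \sum_(r < W) 2 ^+ W * F r B).
apply: ev1 (ev_and HF HZ) _ => P [h1 h2] B eps kappa t /andP[e0 e1] t0 HB.
set K := \sum_(r < W) _; pose T := eps `^ (3 / 2) * t.
have T0 : 0 <= T by rewrite mulr_ge0// powR_ge0.
(* What is left of eps^r after extracting eps^(m+1). The value 0 at the vanishing orders keeps the
   index set, and eps < 1 gives |a r| <= 1, so the bound on the sum is free of eps. *)
pose a r := if (r <= m)%N then 0 else eps ^+ (r - m.+1).
have aE r : (r < W)%N -> forall Y, eps ^+ r * G r P T Y = eps ^+ m.+1 * (a r * G r P T Y).
  move=> rW Y; rewrite /a; case: leqP => rm; first by rewrite h2// !mulr0.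
  by rewrite mulrA -exprD subnKC.
have a1 r : `|a r| <= 1.
  rewrite /a; case: leqP => rm; first by rewrite normr0.
  by rewrite ger0_norm ?exprn_ge0 ?(ltW e0)// exprn_ile1 ?(ltW e0) ?(ltW e1).
have SH : smooth 0 K (fun Y => \sum_(r < W) a r * G r P T Y).
  apply: (@smooth_sum _ 0 W (fun r => F r B) (fun r Y => a r * G r P T Y)) => r rW.
  have S := h1 r rW T B (HB T T0).
  apply: smooth_le (smooth_scale (a r) S).
  by rewrite ler_piMl// (smooth_ge0 S).
have K0 := smooth_ge0 SH.
pose f Y := kappa * eps ^+ m.+1 * (\sum_(r < W) a r * G r P T Y).
have Sf : smooth 0 (`|kappa * eps ^+ m.+1| * K) f by exact: smooth_scale.
have fE : (fun x => kappa * uns eps (ser W eps (fun r => G r P)) t x) =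
    (fun x => f (eps `^ (1 / 2) * (x - speed tau me * t))).
  apply/funext => x; rewrite /f /unscale /ser -mulrA; congr (_ * _).
  by rewrite mulr_sumr; apply: eq_bigr => r _; rewrite -/T aE.
have p0 : 0 < eps `^ (1 / 2) by rewrite powR_gt0.
have B0 : 0 <= `|kappa| * (eps ^+ m.+1 * eps `^ (- (1 / 4)) * K).
  by rewrite !mulr_ge0// ?powR_ge0// exprn_ge0// ltW.
rewrite fE L2norm_le// sqint_affine//; last exact: smooth_continuous Sf.
apply: le_trans (lee_wpmul2l _ (smooth_sqint Sf)) _; first by rewrite lee_fin invr_ge0 ltW.
rewrite lee_fin normrM (ger0_norm (_ : 0 <= eps ^+ m.+1)) ?exprn_ge0 ?(ltW e0)//.
have q : eps `^ (- (1 / 4)) ^+ 2 = (eps `^ (1 / 2))^-1.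
  by rewrite -powR_mulrn ?powR_ge0// -powRrM -powRN; congr (_ `^ _); field.
by rewrite -q le_eqVlt; apply/orP; left; apply/eqP; ring.
Qed.

End series_bound.

(** * Expansion of the residuals *)

Section coefficient_functions.
Context {R : realType}.
Context (m : nat).
Implicit Types (n v : nat -> R -> R -> R).
Local Notation conv := Defs.conv.

(** For k = 1 this is the family n itself, set to 0 outside the orders 1 to m; all terms of a
    residual thus become series of one common length. *)
Definition cpow n k r : R -> R -> R := fun T Y => (tpoly m (fun i => n i T Y) ^+ k)`_r.
Definition cmul n v r : R -> R -> R :=
  fun T Y => (tpoly m (fun i => n i T Y) * tpoly m (fun i => v i T Y))`_r.

Lemma cpow1E n r : (0 < r <= m)%N -> cpow n 1 r = n r.
Proof.
by move=> rm; apply/funext => T; apply/funext => Y; rewrite /cpow expr1 tpoly_coef rm.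
Qed.

Lemma cpow0 n k : (0 < k)%N -> cpow n k 0 = fun _ _ => 0.
Proof.
move=> k0; apply/funext => T; apply/funext => Y.
by rewrite /cpow coef_exp_lt// tpoly_coef0.
Qed.

Lemma cpow1_gt n r : (m < r)%N -> cpow n 1 r = fun _ _ => 0.
Proof.
move=> mr; apply/funext => T; apply/funext => Y.
by rewrite /cpow expr1 tpoly_coef [(r <= m)%N]leqNgt mr andbF.
Qed.

(** Up to r = m + 1 both indices of every term stay between 1 and m, so the truncation is not
    felt. *)
Lemma cmulE n v r : (r <= m.+1)%N -> cmul n v r = conv n v r.
Proof.
move=> rm; apply/funext => T; apply/funext => Y; rewrite /cmul coefM /conv.
case: r rm => [|r] rm; first by rewrite big_ord_recl big_ord0 big_geq// tpoly_coef0 mul0r addr0.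
rewrite big_ord_recl big_ord_recr/= tpoly_coef0 mul0r add0r subnn tpoly_coef0 mulr0 addr0.
rewrite [RHS]big_add1/= [RHS]big_mkord; apply: eq_bigr => i _; rewrite /bump leq0n add1n subSS.
by rewrite !tpoly_coef !ifT//; have := ltn_ord i; lia.
Qed.

Lemma sum_cpow n r (T Y : R) : (r <= m)%N ->
  \sum_(1 <= k < m.+1) (-1) ^+ k.+1 / k%:R * cpow n k r T Y = ell n r T Y.
Proof. by move=> rm; rewrite /cpow /ell log_coef_trunc. Qed.

Lemma expansion_ser w e n (T Y : R) : (m < w)%N ->
  expansion m e n T Y = ser w e (cpow n 1) T Y.
Proof.
move=> mw; rewrite /expansion -horner_tpoly.
rewrite (@horner_ser _ w e (fun T Y => tpoly m (fun i => n i T Y))); last first.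
  by apply: leq_trans (size_tpoly _ _) _.
by apply: eq_bigr => r _; rewrite /cpow expr1.
Qed.

Lemma cmul_ser w e n v (T Y : R) : (m + m < w)%N ->
  ser w e (cpow n 1) T Y * ser w e (cpow v 1) T Y = ser w e (cmul n v) T Y.
Proof.
move=> mw; have mw' : (m < w)%N by apply: leq_ltn_trans mw; rewrite leq_addr.
rewrite -!expansion_ser// /expansion -!horner_tpoly -hornerM.
rewrite (@horner_ser _ w e (fun T Y => tpoly m (fun i => n i T Y) * tpoly m (fun i => v i T Y)))//.
apply: leq_trans (size_polyMleq _ _) _.
have := size_tpoly m (fun i => n i T Y); have := size_tpoly m (fun i => v i T Y); lia.
Qed.

Lemma cpow_ser w e n k (T Y : R) : (m < w)%N -> (m * k < w)%N ->
  ser w e (cpow n 1) T Y ^+ k = ser w e (cpow n k) T Y.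
Proof.
move=> mw mw'; rewrite -expansion_ser// /expansion -horner_tpoly -horner_exp.
rewrite (@horner_ser _ w e (fun T Y => tpoly m (fun i => n i T Y) ^+ k))//.
apply: leq_trans (size_poly_exp_leq _ _) _.
apply: leq_ltn_trans mw'; rewrite leq_mul2r; apply/orP; right.
by have := size_tpoly m (fun i => n i T Y); lia.
Qed.

End coefficient_functions.

Section residual_series.
Context {R : realType}.
Context (m : nat) (tau me : R).
Implicit Types (n v p : nat -> R -> R -> R).
Local Notation c := (speed tau me).
Local Notation uns eps := (unscale tau me eps).
Local Notation cpow := (cpow m).
Local Notation cmul := (cmul m).

(* Exceeds the degree in eps of all products and powers in the residuals. *)
Definition width := (m * m + m + m).+1.

(** The hypotheses under which a coefficient function can be differentiated in t at fixed x. *)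
Definition regular (u : R -> R -> R) := [/\ space_regular u,
    time_regular u, time_regular (d_space u) &
    forall T0 : R, exists B : R, forall T : R, `|T| < T0 -> smooth 2 B (u T)].

Definition mass_coef n v r : R -> R -> R := fun T Y =>
  shift (fun r => d_time (cpow n 1 r)) r T Y + (- c) * d_space (cpow n 1 r) T Y
  + 1 * d_space (cpow v 1 r) T Y + 1 * d_space (cmul n v r) T Y.

Definition momentum_coef (A B D : R) n v p r : R -> R -> R := fun T Y =>
  A * shift (fun r => d_time (cpow v 1 r)) r T Y + (- (A * c)) * d_space (cpow v 1 r) T Y
  + (A * 2^-1) * d_space (cmul v v r) T Y
  + B * (\sum_(1 <= k < m.+1) (-1) ^+ k.+1 / k%:R * d_space (cpow n k r) T Y)
  + D * d_space (cpow p 1 r) T Y.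

Definition poisson_coef n n' p r : R -> R -> R := fun T Y =>
  shift (fun r => d_space (d_space (cpow p 1 r))) r T Y
  + (-1) * cpow n' 1 r T Y + 1 * cpow n 1 r T Y.

(* The ion equation is (A, B, D) = (1, tau, 1), the electron equation (me, 1, -1). *)
Definition momentum_residual (A B D eps : R) n v p (t x : R) : R :=
  let N := Nxt m tau me eps n in let V := Vxt m tau me eps v in
  let Phi := Vxt m tau me eps p in
  - (eps * eps ^- m) *
    (A * (d_time V t x + 2^-1 * d_space (fun t' x' => V t' x' ^+ 2) t x)
     + B * truncated_log m N t x + D * d_space Phi t x).

Lemma Nxt_ser w eps n : (m < w)%N ->
  Nxt m tau me eps n = fun t x => 1 + uns eps (ser w eps (cpow n 1)) t x.
Proof.
move=> mw; apply/funext => t; apply/funext => x.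
by rewrite /Nxt /unscale (expansion_ser _ _ _ _ mw).
Qed.

Lemma Vxt_ser w eps v : (m < w)%N ->
  Vxt m tau me eps v = uns eps (ser w eps (cpow v 1)).
Proof.
move=> mw; apply/funext => t; apply/funext => x.
by rewrite /Vxt /unscale (expansion_ser _ _ _ _ mw).
Qed.

Lemma is_derive_addl (a : R) (f : R -> R) (df x : R) : is_derive x 1 f df ->
  is_derive x 1 (fun y => a + f y) df.
Proof.
move=> D; have H : is_derive x 1 (fun y => a + f y) (0 + df).
  by apply: is_deriveD.
by rewrite add0r in H.
Qed.

Lemma width_gt : (m < width)%N. Proof. by rewrite /width; lia. Qed.

(** The constant a covers both N (a = 1) and V (a = 0). [shift] lengthens the series of
    T-derivatives by one; that of Y-derivatives is padded by a zero coefficient to match. *)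
Lemma d_time_Vxt eps v (a t x : R) : 0 < eps ->
  (forall r, (r < width)%N -> regular (cpow v 1 r)) ->
  d_time (fun t x => a + Vxt m tau me eps v t x) t x = eps `^ (1 / 2) *
    (uns eps (ser width.+1 eps (shift (fun r => d_time (cpow v 1 r)))) t x
     - c * uns eps (ser width.+1 eps (fun r => d_space (cpow v 1 r))) t x).
Proof.
move=> e0 rv; apply: d_time_eq; rewrite (Vxt_ser _ _ width_gt).
have H := unscale_ser_time tau me e0 rv t x.
refine (is_derive_eq (is_derive_addl a H) _).
rewrite ser_shift /unscale.
rewrite [ser width.+1 eps (fun r => d_space (cpow v 1 r)) _ _]ser_widen//.
by rewrite cpow1_gt ?width_gt// d_space0.
Qed.

Lemma d_space_uns_ser w eps (g : nat -> R -> R -> R) (t x : R) : 0 < eps ->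
  (forall r, (r < w)%N -> space_regular (g r)) ->
  is_derive x 1 (uns eps (ser w eps g) t)
    (eps `^ (1 / 2) * uns eps (ser w eps (fun r => d_space (g r))) t x).
Proof. by move=> e0 rg; exact: unscale_ser_space. Qed.

Lemma res_n_series eps n v (t x : R) : 0 < eps ->
  (forall r, (r < width.+1)%N -> regular (cpow n 1 r)) ->
  (forall r, (r < width.+1)%N -> space_regular (cpow v 1 r)) ->
  (forall r, (r < width.+1)%N -> space_regular (cmul n v r)) ->
  res_n m tau me eps n v t x = (- (eps * eps ^- m) * eps `^ (1 / 2)) *
    uns eps (ser width.+1 eps (mass_coef n v)) t x.
Proof.
move=> e0 rn rv rnv; rewrite /res_n.
have w1 : (m < width.+1)%N by apply: ltnW; rewrite ltnS width_gt.
have -> : d_time (Nxt m tau me eps n) t x = eps `^ (1 / 2) *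
    (uns eps (ser width.+1 eps (shift (fun r => d_time (cpow n 1 r)))) t x
     - c * uns eps (ser width.+1 eps (fun r => d_space (cpow n 1 r))) t x).
  exact: (@d_time_Vxt eps n 1 t x e0 (fun r rw => rn r (ltnW rw))).
have -> : d_space (fun t' x' => Nxt m tau me eps n t' x' * Vxt m tau me eps v t' x') t x =
   eps `^ (1 / 2) * uns eps (ser width.+1 eps (fun r => d_space (cpow v 1 r))) t x
   + 1 * (eps `^ (1 / 2) * uns eps (ser width.+1 eps (fun r => d_space (cmul n v r))) t x).
  apply: d_space_eq; rewrite (Nxt_ser _ _ w1) (Vxt_ser _ _ w1).
  (* The flux N V is split as V + (N - 1) V, two series without constant term. *)
  rewrite (_ : (fun x' => _) = fun x' => uns eps (ser width.+1 eps (cpow v 1)) t x' +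
     1 * uns eps (ser width.+1 eps (cmul n v)) t x'); last first.
    apply/funext => y; rewrite /unscale -cmul_ser; last by rewrite /width; lia.
    by ring.
  by apply: is_derive_lin; exact: d_space_uns_ser.
rewrite /mass_coef /unscale !ser_lin; ring.
Qed.

Lemma ser_sum w eps (l : seq nat) (g : nat -> nat -> R -> R -> R) (T Y : R) :
  ser w eps (fun r T Y => \sum_(k <- l) g k r T Y) T Y = \sum_(k <- l) ser w eps (g k) T Y.
Proof.
rewrite /ser exchange_big/=; apply: eq_bigr => r _.
by rewrite mulr_sumr.
Qed.

Lemma res_v_series (A B D eps : R) n v p (t x : R) : 0 < eps ->
  (forall r, (r < width.+1)%N -> regular (cpow v 1 r)) ->
  (forall r, (r < width.+1)%N -> space_regular (cpow p 1 r)) ->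
  (forall r, (r < width.+1)%N -> space_regular (cmul v v r)) ->
  (forall k r, (0 < k <= m)%N -> (r < width.+1)%N -> space_regular (cpow n k r)) ->
  momentum_residual A B D eps n v p t x = (- (eps * eps ^- m) * eps `^ (1 / 2)) *
    uns eps (ser width.+1 eps (momentum_coef A B D n v p)) t x.
Proof.
move=> e0 rv rp rvv rn; rewrite /momentum_residual.
have w1 : (m < width.+1)%N by apply: ltnW; rewrite ltnS width_gt.
have -> : d_time (Vxt m tau me eps v) t x = eps `^ (1 / 2) *
    (uns eps (ser width.+1 eps (shift (fun r => d_time (cpow v 1 r)))) t x
     - c * uns eps (ser width.+1 eps (fun r => d_space (cpow v 1 r))) t x).
  rewrite -(@d_time_Vxt eps v 0 t x e0 (fun r rw => rv r (ltnW rw))).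
  by congr (d_time _ t x); apply/funext => t'; apply/funext => x'; rewrite add0r.
have -> : d_space (fun t' x' => Vxt m tau me eps v t' x' ^+ 2) t x =
   eps `^ (1 / 2) * uns eps (ser width.+1 eps (fun r => d_space (cmul v v r))) t x.
  apply: d_space_eq; rewrite (Vxt_ser _ _ w1).
  rewrite (_ : (fun x' => _) = uns eps (ser width.+1 eps (cmul v v)) t); last first.
    apply/funext => y; rewrite /unscale -cmul_ser ?expr2//.
    by rewrite /width; lia.
  exact: d_space_uns_ser.
have -> : d_space (Vxt m tau me eps p) t x =
   eps `^ (1 / 2) * uns eps (ser width.+1 eps (fun r => d_space (cpow p 1 r))) t x.
  by apply: d_space_eq; rewrite (Vxt_ser _ _ w1); exact: d_space_uns_ser.
have -> : truncated_log m (Nxt m tau me eps n) t x = eps `^ (1 / 2) *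
   \sum_(1 <= k < m.+1) (-1) ^+ k.+1 / k%:R *
     uns eps (ser width.+1 eps (fun r => d_space (cpow n k r))) t x.
  rewrite /truncated_log mulr_sumr; apply: eq_big_nat => k /andP[k0 km].
  rewrite mulrCA; congr (_ * _); apply: d_space_eq; rewrite (Nxt_ser _ _ w1).
  rewrite (_ : (fun x' => _) = uns eps (ser width.+1 eps (cpow n k)) t); last first.
    apply/funext => y; rewrite /unscale addrAC subrr add0r cpow_ser//.
    have : (m * k <= m * m)%N by rewrite leq_mul2l -ltnS km orbT.
    by rewrite /width; lia.
  by apply: d_space_uns_ser => // r rw; apply: rn; rewrite // k0.
have S : ser width.+1 eps (momentum_coef A B D n v p) (eps `^ (3 / 2) * t)
    (eps `^ (1 / 2) * (x - c * t)) =
   A * uns eps (ser width.+1 eps (shift (fun r => d_time (cpow v 1 r)))) t x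
   + (- (A * c)) * uns eps (ser width.+1 eps (fun r => d_space (cpow v 1 r))) t x
   + (A * 2^-1) * uns eps (ser width.+1 eps (fun r => d_space (cmul v v r))) t x
   + B * (\sum_(1 <= k < m.+1) (-1) ^+ k.+1 / k%:R *
     uns eps (ser width.+1 eps (fun r => d_space (cpow n k r))) t x)
   + D * uns eps (ser width.+1 eps (fun r => d_space (cpow p 1 r))) t x.
  rewrite /momentum_coef !ser_lin ser_sum /unscale; congr (_ + _ + _ + B * _ + _).
    by rewrite /ser mulr_sumr; apply: eq_bigr => r _; ring.
  apply: eq_bigr => k _.
  by rewrite /ser mulr_sumr; apply: eq_bigr => r _; ring.
rewrite [in RHS]/unscale S; ring.
Qed.

Lemma res_ph_series eps (P : profiles R) (t x : R) : 0 < eps ->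
  (forall r, (r < width.+1)%N -> space_regular (cpow (ph P) 1 r)) ->
  (forall r, (r < width.+1)%N -> space_regular (d_space (cpow (ph P) 1 r))) ->
  res_ph m tau me eps P t x = - (eps * eps ^- m) *
    uns eps (ser width.+1 eps (poisson_coef (np P) (nm P) (ph P))) t x.
Proof.
move=> e0 rp rdp; rewrite /res_ph; congr (_ * _).
have w1 : (m < width.+1)%N by apply: ltnW; rewrite ltnS width_gt.
have E : d_space (Vxt m tau me eps (ph P)) = fun t x =>
   eps `^ (1 / 2) * uns eps (ser width eps (fun r => d_space (cpow (ph P) 1 r))) t x.
  apply/funext => t'; apply/funext => x'; apply: d_space_eq.
  rewrite (Vxt_ser _ _ width_gt).
  exact: (@d_space_uns_ser width eps _ t' x' e0 (fun r rw => rp r (ltnW rw))).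
have -> : d_space (d_space (Vxt m tau me eps (ph P))) t x = eps *
   uns eps (ser width eps (fun r => d_space (d_space (cpow (ph P) 1 r)))) t x.
  rewrite E; apply: d_space_eq.
  have H : is_derive x 1 (uns eps (ser width eps (fun r => d_space (cpow (ph P) 1 r))) t)
     (eps `^ (1 / 2) * uns eps (ser width eps (fun r => d_space (d_space (cpow (ph P) 1 r)))) t x).
    exact: (@d_space_uns_ser width eps _ t x e0 (fun r rw => rdp r (ltnW rw))).
  refine (is_derive_eq (is_derive_scale _ H) _).
  rewrite mulrA -powRD ?(gt_eqF e0) ?implybT//.
  by rewrite (_ : 1 / 2 + 1 / 2 = 1); [rewrite powRr1// ltW|field].
rewrite !(Nxt_ser _ _ w1) /poisson_coef /unscale !ser_lin -ser_shift; ring.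
Qed.

End residual_series.

(** * Vanishing of the residual coefficients up to degree m *)

Section vanishing.
Context {R : realType}.
Context (m : nat) (tau me : R) (m0 : (0 < m)%N).
Implicit Types (n v p : nat -> R -> R -> R).
Local Notation conv := Defs.conv.
Local Notation c := (speed tau me).
Local Notation cpow := (cpow m).
Local Notation cmul := (cmul m).

Lemma d_space_sum (a b : nat) (x : nat -> R) (f : nat -> R -> R -> R) (T Y : R) :
  (forall k, (a <= k < b)%N -> space_regular (f k)) ->
  d_space (fun T Y => \sum_(a <= k < b) x k * f k T Y) T Y =
  \sum_(a <= k < b) x k * d_space (f k) T Y.
Proof.
move=> fr; apply: d_space_eq; elim: b fr => [|b IH] fr.
  by rewrite (_ : (fun Y => _) = fun _ => 0);
    [rewrite big_geq//; exact: is_derive_cst|apply/funext => y; rewrite big_geq].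
have [ab|ba] := leqP a b; last first.
  by rewrite (_ : (fun Y => _) = fun _ => 0);
    [rewrite big_geq//; exact: is_derive_cst|apply/funext => y; rewrite big_geq].
rewrite (_ : (fun Y => _) =
    fun y => \sum_(a <= k < b) x k * f k T y + x b * f b T y); last first.
  by apply/funext => y; rewrite big_nat_recr.
rewrite big_nat_recr//=; apply: is_derive_lin; last by apply: fr; rewrite ab leqnn.
by apply: IH => k /andP[ak kb]; apply: fr; rewrite ak leqW.
Qed.

Lemma conv_le1 n v r : (r <= 1)%N -> conv n v r = fun _ _ => 0.
Proof.
by move=> r1; apply/funext => T; apply/funext => Y; rewrite /conv big_geq.
Qed.

Lemma d_space_ell n r (T Y : R) : (r <= m)%N ->
  (forall k, (0 < k <= m)%N -> space_regular (cpow n k r)) ->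
  \sum_(1 <= k < m.+1) (-1) ^+ k.+1 / k%:R * d_space (cpow n k r) T Y =
  d_space (ell n r) T Y.
Proof.
move=> rm nr; rewrite -(@d_space_sum 1 m.+1 (fun k => (-1) ^+ k.+1 / k%:R) (fun k => cpow n k r)) => [|k /nr//].
by congr (d_space _ T Y); apply/funext => T'; apply/funext => Y'; rewrite sum_cpow.
Qed.

Lemma d_space_zero : d_space (fun _ _ => 0) = (fun _ _ => 0 : R).
Proof. by apply/funext => T; apply/funext => Y; rewrite d_space0. Qed.

Lemma d_time_zero : d_time (fun _ _ => 0) = (fun _ _ => 0 : R).
Proof. by apply/funext => T; apply/funext => Y; rewrite d_time0. Qed.

Lemma mass_coef_eq0 n v r (T Y : R) : (r <= m)%N -> space_regular (n 1) ->
  (forall T Y : R, v 1 T Y = c * n 1 T Y) ->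
  (forall k, (0 < k < m)%N -> mass_lhs tau me n v k T Y = 0) ->
  mass_coef m tau me n v r T Y = 0.
Proof.
move=> rm nr v1 H; rewrite /mass_coef cmulE; last exact: ltnW.
(* Degree 0 is empty and degree 1 is the relation between v^(1) and n^(1). Degree k + 2 carries the
   evolution equation of order k + 1, because the T-derivative enters shifted. *)
case: r rm => [|[|k]] rm /=.
- by rewrite !cpow0// conv_le1// d_space_zero !mulr0 !addr0.
- rewrite cpow0// !cpow1E// conv_le1// d_space_zero d_time_zero.
  suff -> : d_space (v 1) T Y = c * d_space (n 1) T Y by ring.
  apply: d_space_eq; rewrite (_ : v 1 T = fun y => c * n 1 T y); last exact/funext.
  by apply: is_derive_scale; exact: nr.
- rewrite !cpow1E//; last exact: ltnW.
  by rewrite -(H k.+1 rm) /mass_lhs; ring.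
Qed.

Lemma momentum_coef_eq0 (A B D : R) n v p r (T Y : R) : (r <= m)%N ->
  space_regular (n 1) -> space_regular (v 1) -> space_regular (p 1) ->
  (forall k, (0 < k <= m)%N -> space_regular (cpow n k r)) ->
  (forall T Y : R, - (A * c) * v 1 T Y + B * n 1 T Y + D * p 1 T Y = 0) ->
  (forall k, (0 < k < m)%N ->
    A * d_time (v k) T Y + (- (A * c)) * d_space (v k.+1) T Y
    + (A * 2^-1) * d_space (conv v v k.+1) T Y + B * d_space (ell n k.+1) T Y
    + D * d_space (p k.+1) T Y = 0) ->
  momentum_coef m tau me A B D n v p r T Y = 0.
Proof.
move=> rm nr vr pr nkr E H; rewrite /momentum_coef cmulE; last exact: ltnW.
case: r rm nkr => [|[|k]] rm nkr /=.
- rewrite !cpow0// conv_le1// d_space_zero !mulr0 !add0r addr0.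
  by rewrite big_nat big1 ?mulr0// => k /andP[k0 _]; rewrite cpow0// d_space_zero mulr0.
- rewrite d_space_ell// cpow0// !cpow1E// conv_le1// d_space_zero d_time_zero.
  have -> : ell n 1 = n 1.
    by apply/funext => T'; apply/funext => Y'; rewrite /ell log_coef1.
  (* The first-order relation is an identity between functions; its left-hand side is differentiated
     termwise and as the zero function. *)
  have D1 : is_derive Y 1 (fun y => - (A * c) * v 1 T y + B * n 1 T y + D * p 1 T y)
     (- (A * c) * d_space (v 1) T Y + B * d_space (n 1) T Y + D * d_space (p 1) T Y).
    apply: is_derive_lin; last exact: pr.
    by apply: is_derive_lin; [apply: is_derive_scale; exact: vr|exact: nr].
  have D2 : is_derive Y 1 (fun y => - (A * c) * v 1 T y + B * n 1 T y + D * p 1 T y) 0.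
    by rewrite (_ : (fun y => _) = fun _ => 0); [exact: is_derive_cst|apply/funext => y].
  by rewrite !mulr0 add0r addr0; case: D1 => _ <-; case: D2 => _ ->.
- rewrite d_space_ell// !cpow1E//; last exact: ltnW.
  exact: (H k.+1 rm).
Qed.

Lemma poisson_coef_eq0 (P : profiles R) r (T Y : R) : (r <= m)%N ->
  nm P 1 T Y = np P 1 T Y ->
  (forall k, (0 < k < m)%N -> poisson_lhs P k T Y = 0) ->
  poisson_coef m (np P) (nm P) (ph P) r T Y = 0.
Proof.
move=> rm E H; rewrite /poisson_coef; case: r rm => [|[|k]] rm /=.
- by rewrite !cpow0// !mulr0 !addr0.
- by rewrite cpow0// !cpow1E// !d_space_zero E; ring.
- rewrite !cpow1E//; last exact: ltnW.
  by rewrite -(H k.+1 rm) /poisson_lhs; ring.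
Qed.

End vanishing.

(** * Residual coefficients as differential polynomials *)

Section coefficient_dp.
Context {R : realType}.
Context (m : nat) (tau me : R) (J : antiderivatives R) (m0 : (0 < m)%N).
Implicit Types (P : profiles R) (x y : nat -> profiles R -> R -> R -> R).
Local Notation ev := (ev m tau me J).
Local Notation dp := (dp m tau me J m).

Definition dp_family x := forall i, (0 < i <= m)%N -> dp (x i).

Lemma dp_cpow x k r : dp_family x -> (0 < k)%N ->
  dp (fun P => cpow m (fun i => x i P) k r).
Proof. by move=> dx k0; exact: dp_tpoly_exp. Qed.

Lemma dp_cmul x y r : dp_family x -> dp_family y ->
  dp (fun P => cmul m (fun i => x i P) (fun i => y i P) r).
Proof.
move=> dx dy.
have D : dp (fun P T Y => \sum_(i < r.+1) cpow m (fun i => x i P) 1 i T Y *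
    cpow m (fun i => y i P) 1 (r - i) T Y).
  by apply: dp_sum => // i _; apply: dp_mul; exact: dp_cpow.
apply: dp_ext D; apply: ev_hier => s ini P _ T Y; rewrite /cmul coefM.
by apply: eq_bigr => i _; rewrite /cpow !expr1.
Qed.

Lemma dp_shift (x : nat -> profiles R -> R -> R -> R) r : (forall i, dp (x i)) ->
  dp (fun P => shift (fun r => x r P) r).
Proof. by case: r => [|r] dx; [exact: dp_zero|exact: dx]. Qed.

Lemma dp_mass_coef x y r : dp_family x -> dp_family y ->
  dp (fun P => mass_coef m tau me (fun i => x i P) (fun i => y i P) r).
Proof.
move=> dx dy; rewrite /mass_coef; apply: dp_add; first apply: dp_add; first apply: dp_add.
- apply: (@dp_shift (fun r P => d_time (cpow m (fun i => x i P) 1 r))) => i.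
  by have [] := dp_time_le (dp_cpow i dx (ltnSn 0)).
- by apply: dp_scale; apply: dp_space; exact: dp_cpow.
- by apply: dp_scale; apply: dp_space; exact: dp_cpow.
- by apply: dp_scale; apply: dp_space; exact: dp_cmul.
Qed.

Lemma dp_momentum_coef (A B D : R) x y z r : dp_family x -> dp_family y -> dp_family z ->
  dp (fun P => momentum_coef m tau me A B D (fun i => x i P) (fun i => y i P) (fun i => z i P) r).
Proof.
move=> dx dy dz; rewrite /momentum_coef.
apply: dp_add; first apply: dp_add; first apply: dp_add; first apply: dp_add.
- apply: dp_scale; apply: (@dp_shift (fun r P => d_time (cpow m (fun i => y i P) 1 r))) => i.
  by have [] := dp_time_le (dp_cpow i dy (ltnSn 0)).
- by apply: dp_scale; apply: dp_space; exact: dp_cpow.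
- by apply: dp_scale; apply: dp_space; exact: dp_cmul.
- apply: dp_scale; apply: dp_sum_nat => // k /andP[k0 _]; apply: dp_scale.
  by apply: dp_space; exact: dp_cpow.
- by apply: dp_scale; apply: dp_space; exact: dp_cpow.
Qed.

Lemma dp_poisson_coef x y z r : dp_family x -> dp_family y -> dp_family z ->
  dp (fun P => poisson_coef m (fun i => x i P) (fun i => y i P) (fun i => z i P) r).
Proof.
move=> dx dy dz; rewrite /poisson_coef; apply: dp_add; first apply: dp_add.
- apply: (@dp_shift (fun r P => d_space (d_space (cpow m (fun i => z i P) 1 r)))) => i.
  by do 2 apply: dp_space; exact: dp_cpow.
- by apply: dp_scale; exact: dp_cpow.
- by apply: dp_scale; exact: dp_cpow.
Qed.

Lemma dp_regular u : dp u -> ev (fun P => regular (u P)).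
Proof.
move=> du; have dsu : dp (fun P => d_space (u P)) by exact: dp_space.
apply: ev1 (ev_and (ev_and (dp_space_regular du) (dp_time_regular du))
  (ev_and (dp_time_regular dsu) (dp_smooth 2 (leqnn m) du))) _ => P [[? ?] [? ?]].
by split.
Qed.

Lemma dp_family_hierarchy : [/\ dp_family (fun i P => np P i), dp_family (fun i P => nm P i),
  dp_family (fun i P => vp P i), dp_family (fun i P => vm P i) & dp_family (fun i P => ph P i)].
Proof.
by split => i im; have [] := @hierarchy_dp_le _ m tau me J i im.
Qed.

End coefficient_dp.

(** * Uniform bounds *)

Section vandermonde.
Context {R : realType}.

Lemma expansion_coefficients (m : nat) : exists (e : nat -> R) (a : nat -> nat -> R),
  (forall i, 0 < e i < 1) /\
  forall (u : nat -> R -> R -> R) j (T Y : R), (0 < j <= m)%N ->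
    u j T Y = \sum_(i < m) a j i * expansion m (e i) u T Y.
Proof.
pose e (i : nat) : R := i.+2%:R^-1; exists e.
have e0 i : 0 < e i by rewrite invr_gt0 ltr0n.
have e1 i : e i < 1 by rewrite invf_lt1 ?ltr0n// ltr1n.
pose V := Vandermonde m (\row_(i < m) e i).
have Vu : V \in unitmx.
  rewrite unitmxE det_Vandermonde unitfE; apply/prodf_neq0 => i _.
  apply/prodf_neq0 => j ij; rewrite !mxE subr_eq0.
  by apply/eqP => /invr_inj/eqP; rewrite eqr_nat !eqSS => /eqP E; rewrite E ltnn in ij.
(* The nodes 1 / (i + 2) are distinct and lie in (0, 1). The factor 1 / e_i is there because
   expansions start at eps^1 whereas Vandermonde matrices start at power 0; indices out of range get
   0. *)
exists (fun j i => if insub j.-1 is Some k then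
  if insub i is Some l then (e i)^-1 * invmx V l k else 0 else 0).
split=> [i|u j T Y /andP[j0 jm]]; first by rewrite e0 e1.
pose x := \row_(k < m) u k.+1 T Y.
have jm' : (j.-1 < m)%N by rewrite prednK.
have -> : u j T Y = (x *m V *m invmx V) 0 (Ordinal jm').
  by rewrite mulmxK// mxE/= prednK.
rewrite mxE insubT; apply: eq_bigr => i _.
rewrite valK mulrAC; congr (_ * _).
rewrite mxE /expansion big_add1/= big_mkord mulr_sumr; apply: eq_bigr => k _.
by rewrite !mxE exprS -mulrA mulKf ?gt_eqF// mulrC.
Qed.

(** The bound valid at all T >= 0 simultaneously, hence the source of uniformity in time. The strict
    inequality n < s m pays for the Sobolev embedding. *)
Lemma profiles_smooth (m : nat) (tau me : R) (J : antiderivatives R) :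
  exists B : R -> R, forall s ini P (M : R) n, (0 < m)%N ->
    kdv_hierarchy m tau me J s ini P -> (n < s m)%N ->
    (expansion_size m (s m) P <= M%:E)%E ->
    forall T : R, 0 <= T -> forall j, (0 < j <= m)%N -> smooth n (B M) (np P j T).
Proof.
have [e [a [e01 ea]]] := expansion_coefficients m.
pose K (M : R) := 2 * (M + 1) ^+ 2 + 3.
pose b M j := \sum_(i < m) 2 ^+ m * (`|a j i| * K M).
exists (fun M => \sum_(j < m.+1) b M j) => s ini P M n m0 H nsm HM T T0 j jm.
have HN i : (Hnorm (s m) (expansion m (e i) (np P) T) <= M%:E)%E.
  apply: le_trans HM; apply: (@le_trans _ _ (expansion_norm m (s m) (e i) P T)).
    by rewrite /expansion_norm -!addeA leeDl// !adde_ge0// Hnorm_ge0.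
  by apply: ereal_sup_ubound; exists (e i, T) => //=; split.
have cN i : continuous (expansion m (e i) (np P) T).
  have C k : (k <= m)%N -> continuous (fun Y => \sum_(1 <= l < k.+1) e i ^+ l * np P l T Y).
    elim: k => [|k IH] km Y.
      by rewrite (_ : (fun Y => _) = fun _ => 0); [exact: cvg_cst|apply/funext => y; rewrite big_geq].
    rewrite (_ : (fun Y => _) = fun Y => \sum_(1 <= l < k.+1) e i ^+ l * np P l T Y
      + e i ^+ k.+1 * np P k.+1 T Y); last by apply/funext => y; rewrite big_nat_recr.
    have [[cu _] _ _ _ _] := @hier_class _ _ _ _ _ _ _ _ H k.+1 km.
    by apply: cvgD; [exact: IH (ltnW km) Y|apply: cvgMr; exact: cu].
  exact: C.
have sN i : smooth n (K M) (expansion m (e i) (np P) T) by exact: (@Hnorm_smooth _ n (s m)).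
have K0 : 0 <= K M by exact: smooth_ge0 (sN 0%N).
have S : smooth n (b M j) (np P j T).
  rewrite (_ : np P j T = fun Y => \sum_(i < m) a j i * expansion m (e i) (np P) T Y).
    apply: (@smooth_sum _ n m (fun i => `|a j i| * K M)
      (fun i Y => a j i * expansion m (e i) (np P) T Y)) => i _.
    exact: smooth_scale.
  by apply/funext => Y; exact: ea.
apply: smooth_le S; have /andP[_ jm'] := jm.
rewrite (bigD1 (Ordinal (jm' : (j < m.+1)%N)))//= lerDl sumr_ge0// => k _.
by rewrite sumr_ge0// => i _; rewrite !mulr_ge0.
Qed.

End vandermonde.

(** * The five residual estimates *)

Section residual_bounds.
Context {R : realType}.
Context (m : nat) (tau me : R) (J : antiderivatives R).
Context (m0 : (0 < m)%N) (htau : 0 <= tau) (hme : 0 < me).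
Local Notation ev := (ev m tau me J).
Local Notation dp := (dp m tau me J m).
Local Notation uns eps := (unscale tau me eps).
Local Notation c := (speed tau me).
Local Notation W := (width m).+1.

(** n and F belong to the residual alone; the solution enters only through the bound B on its n_+
    profiles over T >= 0. *)
Definition residual_bounded (a : R) (Q : R -> profiles R -> R -> R -> R) :=
  exists (n : nat) (F : R -> R), ev (fun P => forall (B eps t : R),
    0 < eps < 1 -> 0 <= t ->
    (forall T : R, 0 <= T -> forall j, (0 < j <= m)%N -> smooth n B (np P j T)) ->
    (L2norm (Q eps P t) <= (F B * eps `^ a)%:E)%E).

Lemma residual_boundedP (a : R) (kappa : R -> R)
    (Q : R -> profiles R -> R -> R -> R) (G : nat -> profiles R -> R -> R -> R) :
  (forall eps, 0 < eps -> `|kappa eps| * (eps ^+ m.+1 * eps `^ (- (1 / 4))) = eps `^ a) ->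
  (forall r, dp (G r)) ->
  ev (fun P => forall r, (r <= m)%N -> forall T Y : R, G r P T Y = 0) ->
  ev (fun P => forall eps, 0 < eps -> forall t x,
    Q eps P t x = kappa eps * uns eps (ser W eps (fun r => G r P)) t x) ->
  residual_bounded a Q.
Proof.
move=> ka DG ZG QE.
have ZG' : ev (fun P => forall r, (r < W)%N -> (r <= m)%N -> forall T Y : R, G r P T Y = 0).
  by apply: ev1 ZG _ => P H r _; exact: H.
have [n [F HF]] := series_bound (fun r (_ : (r < W)%N) => DG r) ZG'.
exists n, F; apply: ev1 (ev_and HF QE) _ => P [h1 h2] B eps t e01 t0 HB.
have /andP[e0 _] := e01.
rewrite (_ : Q eps P t = fun x => kappa eps * uns eps (ser W eps (fun r => G r P)) t x).
  by apply: le_trans (h1 B eps (kappa eps) t e01 t0 HB) _; rewrite mulrA mulrC -ka// mulrA.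
by apply/funext => x; exact: h2.
Qed.

Lemma residual_factor1 (eps : R) : 0 < eps ->
  `|- (eps * eps ^- m)| * (eps ^+ m.+1 * eps `^ (- (1 / 4))) = eps `^ (7 / 4).
Proof.
move=> e0; rewrite normrN ger0_norm; last by rewrite mulr_ge0 ?invr_ge0 ?exprn_ge0// ltW.
rewrite (_ : 7 / 4 = 2%:R + - (1 / 4)); last by field.
rewrite powRD; last by rewrite (gt_eqF e0) implybT.
rewrite powR_mulrn ?ltW// mulrA; congr (_ * _).
by rewrite exprS expr2 mulrACA mulVf ?mulr1// expf_neq0// gt_eqF.
Qed.

Lemma residual_factor2 (eps : R) : 0 < eps ->
  `|- (eps * eps ^- m) * eps `^ (1 / 2)| * (eps ^+ m.+1 * eps `^ (- (1 / 4))) =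
  eps `^ (9 / 4).
Proof.
move=> e0; rewrite normrM mulrAC residual_factor1// ger0_norm ?powR_ge0//.
rewrite -powRD; last by rewrite (gt_eqF e0) implybT.
by congr (_ `^ _); field.
Qed.

Lemma ev_regular u : (forall r, dp (u r)) ->
  ev (fun P => forall r, (r < W)%N -> regular (u r P)).
Proof. by move=> du; apply: ev_forall => r _; exact: dp_regular. Qed.

Lemma ev_evolution : ev (fun P => forall k, (0 < k < m)%N -> forall T Y : R,
  [/\ mass_lhs tau me (np P) (vp P) k T Y = 0, mass_lhs tau me (nm P) (vm P) k T Y = 0,
      ion_lhs tau me P k T Y = 0, electron_lhs tau me P k T Y = 0
    & poisson_lhs P k T Y = 0]).
Proof.
have : ev (fun P => forall k, (k < m)%N -> (0 < k)%N -> forall T Y : R,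
  [/\ mass_lhs tau me (np P) (vp P) k T Y = 0, mass_lhs tau me (nm P) (vm P) k T Y = 0,
      ion_lhs tau me P k T Y = 0, electron_lhs tau me P k T Y = 0
    & poisson_lhs P k T Y = 0]).
  apply: ev_forall => k km; have [k0|k0] := posnP k; first by apply: ev_hier; rewrite k0.
  have km' : (0 < k < m)%N by rewrite k0.
  by apply: ev1 (@evolution _ m tau me J htau hme k km') _ => P H _.
by move=> H; apply: ev1 H _ => P H k /andP[k0 km]; exact: H.
Qed.

Lemma ev_relations1 : ev (relations_1 tau me).
Proof. by apply: ev_hier => s ini P; exact: hier_rel_1. Qed.

Lemma res_n_bounded (x y : nat -> profiles R -> R -> R -> R) :
  dp_family m tau me J x -> dp_family m tau me J y ->
  ev (fun P => forall T Y : R, y 1%N P T Y = c * x 1%N P T Y) ->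
  ev (fun P => forall k, (0 < k < m)%N -> forall T Y : R,
    mass_lhs tau me (fun i => x i P) (fun i => y i P) k T Y = 0) ->
  residual_bounded (9 / 4)
    (fun eps P => res_n m tau me eps (fun i => x i P) (fun i => y i P)).
Proof.
move=> dx dy E H; apply: (residual_boundedP residual_factor2).
- by move=> r; exact: (dp_mass_coef m0 r dx dy).
- apply: ev1 (ev_and (dp_space_regular (dx 1%N m0)) (ev_and E H)) _ => P [xr [E' H']] r rm T Y.
  by apply: mass_coef_eq0 => // k km; exact: H'.
- have Rx := ev_regular (fun r => dp_cpow m0 r dx (ltnSn 0)).
  have Ry := ev_regular (fun r => dp_cpow m0 r dy (ltnSn 0)).
  have Rxy := ev_regular (fun r => dp_cmul m0 r dx dy).
  apply: ev1 (ev_and Rx (ev_and Ry Rxy)) _ => P [rx [ry rxy]] eps e0 t z.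
  apply: res_n_series => // r rW; first by have [] := ry r rW.
  by have [] := rxy r rW.
Qed.

Lemma res_v_bounded (A B D : R) (x y z : nat -> profiles R -> R -> R -> R) :
  dp_family m tau me J x -> dp_family m tau me J y -> dp_family m tau me J z ->
  ev (fun P => forall T Y : R,
    - (A * c) * y 1%N P T Y + B * x 1%N P T Y + D * z 1%N P T Y = 0) ->
  ev (fun P => forall k, (0 < k < m)%N -> forall T Y : R,
    A * d_time (y k P) T Y + (- (A * c)) * d_space (y k.+1 P) T Y
    + (A * 2^-1) * d_space (Defs.conv (fun i => y i P) (fun i => y i P) k.+1) T Y
    + B * d_space (ell (fun i => x i P) k.+1) T Y + D * d_space (z k.+1 P) T Y = 0) ->
  residual_bounded (9 / 4) (fun eps P => momentum_residual m tau me A B D eps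
    (fun i => x i P) (fun i => y i P) (fun i => z i P)).
Proof.
move=> dx dy dz E H; apply: (residual_boundedP residual_factor2).
- by move=> r; exact: (dp_momentum_coef m0 A B D r dx dy dz).
- have Rx : ev (fun P => forall r, (r < m.+1)%N -> forall k, (k < m.+1)%N -> (0 < k)%N ->
      space_regular (cpow m (fun i => x i P) k r)).
    apply: ev_forall => r _; apply: ev_forall => k _.
    have [k0|k0] := posnP k; first by apply: ev_hier; rewrite k0.
    by apply: ev1 (dp_space_regular (dp_cpow m0 r dx k0)) _ => P R' _.
  apply: ev1 (ev_and (ev_and (dp_space_regular (dx 1%N m0)) (dp_space_regular (dy 1%N m0)))
    (ev_and (ev_and (dp_space_regular (dz 1%N m0)) Rx) (ev_and E H))) _.
  move=> P [[xr yr] [[zr R'] [E' H']]] r rm T Y.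
  apply: momentum_coef_eq0 => // k => [/andP[k0 km]|km]; first exact: R'.
  exact: H'.
- have Rx : ev (fun P => forall k, (k < m.+1)%N -> (0 < k)%N -> forall r, (r < W)%N ->
      regular (cpow m (fun i => x i P) k r)).
    apply: ev_forall => k _; have [k0|k0] := posnP k; first by apply: ev_hier; rewrite k0.
    by apply: ev1 (ev_regular (fun r => dp_cpow m0 r dx k0)) _ => P R' _.
  have Ry := ev_regular (fun r => dp_cpow m0 r dy (ltnSn 0)).
  have Rz := ev_regular (fun r => dp_cpow m0 r dz (ltnSn 0)).
  have Ryy := ev_regular (fun r => dp_cmul m0 r dy dy).
  apply: ev1 (ev_and (ev_and Rx Ry) (ev_and Rz Ryy)) _ => P [[rx ry] [rz ryy]] eps e0 t w.
  apply: res_v_series => //.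
  + by move=> r rW; have [] := rz r rW.
  + by move=> r rW; have [] := ryy r rW.
  + by move=> k r /andP[k0 km] rW; have [] := rx k km k0 r rW.
Qed.

Lemma res_np_bounded : residual_bounded (9 / 4) (fun eps => res_np m tau me eps).
Proof.
have [dnp _ dvp _ _] := dp_family_hierarchy m tau me J.
apply: (res_n_bounded dnp dvp).
  by apply: ev1 ev_relations1 _ => P H T Y; have [] := H T Y.
by apply: ev1 ev_evolution _ => P H k km T Y; have [] := H k km T Y.
Qed.

Lemma res_nm_bounded : residual_bounded (9 / 4) (fun eps => res_nm m tau me eps).
Proof.
have [_ dnm _ dvm _] := dp_family_hierarchy m tau me J.
apply: (res_n_bounded dnm dvm).
  by apply: ev1 ev_relations1 _ => P H T Y; have [-> _ -> _] := H T Y.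
by apply: ev1 ev_evolution _ => P H k km T Y; have [] := H k km T Y.
Qed.

Lemma res_vp_bounded : residual_bounded (9 / 4) (fun eps => res_vp m tau me eps).
Proof.
have [dnp _ dvp _ dph] := dp_family_hierarchy m tau me J.
have := @res_v_bounded 1 tau 1 _ _ _ dnp dvp dph.
rewrite /residual_bounded => H.
have me1 : 1 + me != 0 by rewrite gt_eqF// addr_gt0.
have [||n [F HF]] := H.
- apply: ev1 ev_relations1 _ => P R' T Y; have [_ -> _ ->] := R' T Y.
  (* The ion dispersion relation c^2 = tau + (1 - tau me) / (1 + me). *)
  by move: (speed_sqr htau hme); generalize (speed tau me) => d ->; field.
- apply: ev1 ev_evolution _ => P E k km T Y; have [_ _ E' _ _] := E k km T Y.
  by rewrite -E' /ion_lhs; ring.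
exists n, F; apply: ev1 HF _ => P HP B eps t e01 t0 HB.
rewrite (_ : res_vp m tau me eps P t = momentum_residual m tau me 1 tau 1 eps (np P) (vp P) (ph P) t).
  exact: HP.
by apply/funext => x; rewrite /res_vp /momentum_residual !mul1r.
Qed.

Lemma res_vm_bounded : residual_bounded (9 / 4) (fun eps => res_vm m tau me eps).
Proof.
have [_ dnm _ dvm dph] := dp_family_hierarchy m tau me J.
have := @res_v_bounded me 1 (-1) _ _ _ dnm dvm dph.
rewrite /residual_bounded => H.
have me1 : 1 + me != 0 by rewrite gt_eqF// addr_gt0.
have [||n [F HF]] := H.
- apply: ev1 ev_relations1 _ => P R' T Y; have [-> _ -> ->] := R' T Y.
  (* The electron dispersion relation c^2 me = 1 - (1 - tau me) / (1 + me). *)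
  by move: (speed_sqr htau hme); generalize (speed tau me) => d ->; field.
- apply: ev1 ev_evolution _ => P E k km T Y; have [_ _ _ E' _] := E k km T Y.
  by rewrite -E' /electron_lhs; ring.
exists n, F; apply: ev1 HF _ => P HP B eps t e01 t0 HB.
rewrite (_ : res_vm m tau me eps P t = momentum_residual m tau me me 1 (-1) eps (nm P) (vm P) (ph P) t).
  exact: HP.
by apply/funext => x; rewrite /res_vm /momentum_residual mul1r mulN1r.
Qed.

Lemma res_ph_bounded : residual_bounded (7 / 4) (fun eps => res_ph m tau me eps).
Proof.
have [dnp dnm _ _ dph] := dp_family_hierarchy m tau me J.
apply: (residual_boundedP residual_factor1).
- by move=> r; exact: (dp_poisson_coef m0 r dnp dnm dph).
- apply: ev1 (ev_and ev_relations1 ev_evolution) _ => P [R' E] r rm T Y.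
  apply: poisson_coef_eq0 => // [|k km]; first by have [] := R' T Y.
  by have [] := E k km T Y.
- have Rz := ev_regular (fun r => dp_cpow m0 r dph (ltnSn 0)).
  have Rzz := ev_regular (fun r => dp_space (dp_cpow m0 r dph (ltnSn 0))).
  apply: ev1 (ev_and Rz Rzz) _ => P [rz rzz] eps e0 t x.
  have rz' r : (r < W)%N -> space_regular (cpow m (ph P) 1 r).
    by move=> rW; case: (rz r rW).
  have rzz' r : (r < W)%N -> space_regular (d_space (cpow m (ph P) 1 r)).
    by move=> rW; case: (rzz r rW) => H _ _ _; exact: H.
  exact: res_ph_series e0 rz' rzz'.
Qed.

(** The absolute value makes each constant nonnegative, so that the sum of the five can serve as the
    common C. *)
Lemma sup_residual_bounded (a : R) (Q : R -> profiles R -> R -> R -> R) :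
  residual_bounded a Q -> exists (n : nat) (C : R -> R), forall s ini P (M eps : R),
    (forall k, (1 <= k <= m)%N -> (n <= s k)%N) ->
    kdv_hierarchy m tau me J s ini P -> (expansion_size m (s m) P <= M%:E)%E ->
    0 < eps < 1 -> (sup_L2 (Q eps P) <= (`|C M| * eps `^ a)%:E)%E.
Proof.
move=> [n [F [r HF]]]; have [B HB] := profiles_smooth m tau me J.
(* r is the threshold hidden in [ev]; n + 1 is what the Sobolev embedding asks for. *)
exists (maxn r n.+1), (fun M => F (B M)) => s ini P M eps sk H HM e01.
have sm : (maxn r n.+1 <= s m)%N by apply: sk; rewrite m0 leqnn.
apply: ge_ereal_sup => _ [t /= t0 <-].
have HP : hier m tau me J r P.
  exists s, ini; split => // k km; apply: leq_trans (sk k km); exact: leq_maxl.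
have S := HB s ini P M n m0 H (leq_trans (leq_maxr _ _) sm) HM.
apply: le_trans (HF P HP (B M) eps t e01 t0 S) _.
by rewrite lee_fin ler_wpM2r ?powR_ge0// ler_norm.
Qed.

End residual_bounds.

Theorem theorem2p7 (R : realType) (m : nat) (hm : (1 <= m)%N)
    (tau me : R) (htau : 0 <= tau) (hme : 0 < me) (J : antiderivatives R) :
  exists S : nat,
  forall s : nat -> nat,
    (2 <= s 1)%N ->
    (forall k : nat, (1 <= k <= m)%N -> (S <= s k)%N) ->
    (forall k : nat, (2 <= k <= m)%N -> (s k + 3 * (k - 1) <= s 1)%N) ->
  exists C : R -> R,
  forall (ini : nat -> R -> R) (P : profiles R),
    kdv_hierarchy m tau me J s ini P ->
  forall M : R,
    (expansion_size m (s m) P <= M%:E)%E ->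
  forall eps : R, 0 < eps < 1 ->
    [/\ (sup_L2 (res_np m tau me eps P) <= (C M * eps `^ (9 / 4))%:E)%E,
        (sup_L2 (res_nm m tau me eps P) <= (C M * eps `^ (9 / 4))%:E)%E,
        (sup_L2 (res_vp m tau me eps P) <= (C M * eps `^ (9 / 4))%:E)%E,
        (sup_L2 (res_vm m tau me eps P) <= (C M * eps `^ (9 / 4))%:E)%E
      & (sup_L2 (res_ph m tau me eps P) <= (C M * eps `^ (7 / 4))%:E)%E].
Proof.
have [n1 [C1 H1]] := sup_residual_bounded hm (res_np_bounded J hm htau hme).
have [n2 [C2 H2]] := sup_residual_bounded hm (res_nm_bounded J hm htau hme).
have [n3 [C3 H3]] := sup_residual_bounded hm (res_vp_bounded J hm htau hme).
have [n4 [C4 H4]] := sup_residual_bounded hm (res_vm_bounded J hm htau hme).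
have [n5 [C5 H5]] := sup_residual_bounded hm (res_ph_bounded J hm htau hme).
exists (n1 + n2 + n3 + n4 + n5)%N => s _ sk _.
exists (fun M => `|C1 M| + `|C2 M| + `|C3 M| + `|C4 M| + `|C5 M|) => ini P H M HM eps e01.
have K (C D a : R) (q : \bar R) : C <= D ->
    (q <= (C * eps `^ a)%:E)%E -> (q <= (D * eps `^ a)%:E)%E.
  by move=> CD /le_trans; apply; rewrite lee_fin ler_wpM2r ?powR_ge0.
have [s1 s2 s3 s4 s5] : [/\ forall k, (1 <= k <= m)%N -> (n1 <= s k)%N,
    forall k, (1 <= k <= m)%N -> (n2 <= s k)%N, forall k, (1 <= k <= m)%N -> (n3 <= s k)%N,
    forall k, (1 <= k <= m)%N -> (n4 <= s k)%N & forall k, (1 <= k <= m)%N -> (n5 <= s k)%N].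
  by split => k /sk; clear; lia.
have [a1 a2 a3 a4 a5] : [/\ 0 <= `|C1 M|, 0 <= `|C2 M|, 0 <= `|C3 M|, 0 <= `|C4 M| & 0 <= `|C5 M|].
  by [].
split.
- by apply: K (H1 s ini P M eps s1 H HM e01); move: a2 a3 a4 a5; clear; lra.
- by apply: K (H2 s ini P M eps s2 H HM e01); move: a1 a3 a4 a5; clear; lra.
- by apply: K (H3 s ini P M eps s3 H HM e01); move: a1 a2 a4 a5; clear; lra.
- by apply: K (H4 s ini P M eps s4 H HM e01); move: a1 a2 a3 a5; clear; lra.
- by apply: K (H5 s ini P M eps s5 H HM e01); move: a1 a2 a3 a4; clear; lra.
Qed.
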